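(* Let $T>0$, let $(B_s)_{s\in\mathbb{R}}$ be a two-sided standard Brownian motion on a probability space $(\Omega,\mathcal{F},\mathbb{P})$, and let $f:\mathbb{R}\to\mathbb{R}$ be a measurable function such that $f=0$ on $\mathbb{R}_+=[0,\infty)$, $\int_{-\infty}^t (f(s-t)-f(s))^2\,ds<\infty$ for every $t\ge 0$, and $f$ is nonzero on a set of positive Lebesgue measure. Define $$X_t=\int_{-\infty}^t \big(f(s-t)-f(s)\big)\,dB_s,\qquad t\in[0,T],$$ and assume $X$ has continuous sample paths. Then $X$ satisfies the conditional full support (CFS) condition with respect to its natural filtration $\mathcal{F}_t=\sigma(X_s;\,s\le t)$, i.e. for every $t\in[0,T]$, $$\operatorname{supp}\operatorname{Law}(X_u;\ t\le u\le T\mid \mathcal{F}_t)=C_{X_t}[t,T]\quad\text{a.s.}$$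
   Context: For $x\in\mathbb{R}$ and $0\le t\le T$, $C[t,T]$ denotes the space of continuous real-valued functions on $[t,T]$ with the topology of uniform convergence, and $C_x[t,T]$ denotes the subset of functions $g\in C[t,T]$ with $g(t)=x$. The conditional distribution $\operatorname{Law}(X_u;\,t\le u\le T\mid\mathcal{F}_t)$ is viewed as a (regular conditional) probability measure on $C[t,T]$, and ''supp'' denotes its topological support (the smallest closed set of full measure). *)

(* Defs.v *)
From HB Require Import structures.
From mathcomp Require Import all_boot all_order all_algebra.
From mathcomp Require Import all_classical all_reals all_analysis.
Set Implicit Arguments. Unset Strict Implicit. Unset Printing Implicit Defensive.
Import Order.TTheory GRing.Theory Num.Theory.
Import numFieldNormedType.Exports.
Local Open Scope classical_set_scope.
Local Open Scope ring_scope.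

Section defs.
Context {R : realType} {d : measure_display} {Omega : measurableType d}.
Variable P : probability Omega R.

Definition mutually_independent n (Y : 'I_n -> Omega -> R) : Prop :=
  forall A : 'I_n -> set R, (forall i, measurable (A i)) ->
    P (\bigcap_(i in [set: 'I_n]) (Y i @^-1` A i)) =
    (\prod_(i < n) P (Y i @^-1` A i))%E.

Definition two_sided_BM (B : R -> Omega -> R) : Prop :=
  [/\ (forall s, measurable_fun setT (B s)),
      (forall w, B 0 w = 0),
      (forall w, continuous (fun s => B s w)),
      (forall s t A, s < t -> measurable A ->
          P [set w | B t w - B s w \in A] = normal_prob 0 (Num.sqrt (t - s)) A)
    & (forall n (u : nat -> R), (forall i, u i < u i.+1) ->
          mutually_independent (fun i : 'I_n => fun w => B (u i.+1) w - B (u i) w))].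

(** Step functions sum_k c_k 1_{(a_k,b_k]}, encoded as lists of (c_k,a_k,b_k),
    and their elementary stochastic integrals sum_k c_k (B_{b_k} - B_{a_k}). *)
Definition stepfun (h : seq (R * R * R)) (x : R) : R :=
  \sum_(p <- h) p.1.1 * (if (p.1.2 < x) && (x <= p.2) then 1 else 0).
Definition stepint (B : R -> Omega -> R) (h : seq (R * R * R)) (w : Omega) : R :=
  \sum_(p <- h) p.1.1 * (B p.2 w - B p.1.2 w).

Definition wiener_integral (B : R -> Omega -> R) (g : R -> R) (Y : Omega -> R) : Prop :=
  measurable_fun setT Y /\
  exists hs : nat -> seq (R * R * R),
    (forall n, all (fun p => p.1.2 < p.2) (hs n)) /\
    ((\int[lebesgue_measure]_x ((g x - stepfun (hs n) x) ^+ 2)%:E)%E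
        @[n --> \oo] --> 0%E) /\
    ((\int[P]_w ((Y w - stepint B (hs n) w) ^+ 2)%:E)%E @[n --> \oo] --> 0%E).

End defs.

(** ---- The path space C[t,T] ----
  An element of C[t,T] is represented by its canonical extension to R,
  constant outside [t,T]: this is a bijection with C[t,T]. *)
Section paths.
Context {R : realType}.
Variables t T : R.

Definition clamp (u : R) : R := Num.max t (Num.min u T).

Definition Cpath : set (R -> R) :=
  [set g | {within [set u | t <= u <= T], continuous g} /\ forall u, g u = g (clamp u)].

Definition supdist (g h : R -> R) : \bar R :=
  ereal_sup [set (`|g u - h u|)%:E | u in [set u | t <= u <= T]].

Definition path_open (U : set (R -> R)) : Prop :=
  U `<=` Cpath /\ forall g, U g -> exists2 e : R, 0 < e &
     forall h, Cpath h -> (supdist g h < e%:E)%E -> U h.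
Definition path_closed (F : set (R -> R)) : Prop :=
  F `<=` Cpath /\ path_open (Cpath `\` F).

Definition path_borel : set (set (R -> R)) := <<s Cpath, path_open >>.

Definition Cpath_from (x : R) : set (R -> R) := [set g | Cpath g /\ g t = x].

Definition path_support (mu : set (R -> R) -> \bar R) : set (R -> R) :=
  [set g | Cpath g /\ forall F, path_closed F -> mu F = 1%E -> F g].

Definition path_probability (mu : set (R -> R) -> \bar R) : Prop :=
  [/\ mu set0 = 0%E,
      (forall S, path_borel S -> (0 <= mu S)%E),
      (forall S : nat -> set (R -> R), (forall n, path_borel (S n)) ->
         trivIset setT S ->
         (fun n => \sum_(k < n) mu (S k))%E @ \oo --> mu (\bigcup_k S k))
    & mu Cpath = 1%E].
End paths.

Section cond.
Context {R : realType} {d : measure_display} {Omega : measurableType d}.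
Variable P : probability Omega R.

Definition path_of (X : R -> Omega -> R) (t T : R) (w : Omega) : R -> R :=
  fun u => X (clamp t T u) w.

Definition natural_filtration (X : R -> Omega -> R) (t : R) : set (set Omega) :=
  <<s setT, [set E | exists s (A : set R), [/\ 0 <= s <= t, open A & E = X s @^-1` A]] >>.

Definition regular_cond_law (X : R -> Omega -> R) (t T : R) (G : set (set Omega))
    (kappa : Omega -> set (R -> R) -> \bar R) : Prop :=
  [/\ (forall w, path_probability t T (kappa w)),
      (forall S, path_borel t T S -> forall r : R, G [set w | (kappa w S <= r%:E)%E])
    & (forall A S, G A -> path_borel t T S ->
         P (A `&` (path_of X t T @^-1` S)) = (\int[P]_(w in A) kappa w S)%E)].
End cond.

(* Main.v *)
(** Shifting the Brownian path by the primitive of c 1_(a,b] changes its law into an equivalent one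
    (Cameron-Martin) and shifts X_u by c times the integral over (a,b] of the kernel of X_u. Let -g be
    the essential supremum of the support of f. With a = t - g + s, s > 0, and b > T, this shift of X
    vanishes on [0,t] and equals c G(u - t - s) for u in [t,T], where G is the primitive of the
    function x |-> f(- g - x), x > 0, which does not vanish near 0. By the Titchmarsh convolution
    theorem, the translates of this function span a dense subspace of L2[0,T-t], so that sums of such
    shifts approximate uniformly every continuous path on [t,T] vanishing at t. Hence every event of
    F_t of positive probability meets every uniform tube around X_t + gamma with positive probability,
    and the conditional law charges every ball. The conditional law exists because C[t,T] is coded
    measurably by real numbers, whose conditional quantile functions come from Radon-Nikodym densities. *)
Require Import Defs.
From HB Require Import structures.
From mathcomp Require Import all_boot all_order all_algebra.
From mathcomp Require Import all_classical all_reals all_analysis.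
From mathcomp Require Import measurable_realfun ring lra.
Set Implicit Arguments. Unset Strict Implicit. Unset Printing Implicit Defensive.
Import Order.TTheory GRing.Theory Num.Theory.
Import numFieldNormedType.Exports.
Local Open Scope classical_set_scope.
Local Open Scope ring_scope.

(** Titchmarsh's theorem is obtained from real Laplace transforms sampled at the integers, without
    complex analysis: exponential decay of a transform at rate b is equivalent, in the form needed
    here, to absence of mass below b, and the supports are read off the decay rates of the products
    of derivatives of the two transforms. The process is known only through Wiener integrals at
    single times, which are L2 limits of elementary integrals. The Cameron-Martin formula is
    therefore a statement on finitely many independent Gaussian increments, carried to Wiener
    integrals by Lipschitz test functions and to all events of the product sigma-algebra by a
    pi-system. Of this formula only null sets are used. If an event A of the past met the target
    tube in a null set, the shifted copy of that set would be null as well; but it contains the part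
    of A in some thin tube, and one of countably many thin tubes has positive probability inside A.
    Countability matters throughout: uniform conditions on paths are tested at rational times
    clamped to [t,T], which makes them measurable. *)

Section real_integrals.
Context d (T : measurableType d) (R : realType) (mu : {measure set T -> \bar R}).
Implicit Types f g : T -> R.

(** * Real-valued integrals *)

Lemma integrable_le f g : measurable_fun setT f -> (forall x, `|f x| <= g x) ->
  mu.-integrable setT (EFin \o g) -> mu.-integrable setT (EFin \o f).
Proof.
move=> mf fg; apply: le_integrable => //; first exact/measurable_EFinP.
by move=> x _ /=; rewrite lee_fin (le_trans (fg x)) ?ler_norm.
Qed.

Lemma measurable_integrable f : mu.-integrable setT (EFin \o f) ->
  measurable_fun setT f.
Proof. by move/measurable_int/measurable_EFinP. Qed.

Lemma EFin_Rintegral f : mu.-integrable setT (EFin \o f) ->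
  ((\int[mu]_x f x)%R%:E = \int[mu]_x (f x)%:E)%E.
Proof. by move=> fi; rewrite /Rintegral fineK//; exact: integrable_fin_num. Qed.

Lemma Rintegral_dct (f_ : nat -> T -> R) f g :
  (forall n, measurable_fun setT (f_ n)) -> measurable_fun setT f ->
  (forall x, f_ n x @[n --> \oo] --> f x) ->
  mu.-integrable setT (EFin \o g) -> (forall n x, `|f_ n x| <= g x) ->
  \int[mu]_x f_ n x @[n --> \oo] --> \int[mu]_x f x.
Proof.
move=> mf_ mf cf ig fg.
have [||||| ifi _ /= h] := @dominated_convergence _ _ _ mu setT measurableT
  (fun n x => (f_ n x)%:E) (EFin \o f) (EFin \o g).
- by move=> n; exact/measurable_EFinP.
- exact/measurable_EFinP.
- apply: aeW => /= x _.
  by apply: cvg_EFin; [exact: nearW|exact: cf].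
- exact: ig.
- by apply: aeW => x n _ /=; rewrite lee_fin.
move: h; rewrite -(EFin_Rintegral ifi) => h; exact: (fine_cvg h).
Qed.

Lemma integrable_mul_bounded f g (M : R) : measurable_fun setT f ->
  (forall x, `|f x| <= M) ->
  mu.-integrable setT (EFin \o g) -> mu.-integrable setT (EFin \o (fun x => f x * g x)).
Proof.
move=> mf fM ig; apply: (@integrable_le _ (fun x => M * `|g x|)).
- by apply: measurable_funM => //; exact: measurable_integrable.
- by move=> x; rewrite normrM ler_wpM2r.
have := integrableZl measurableT M (integrable_norm ig).
by apply: eq_integrable.
Qed.

Lemma integrableZ (c : R) f : mu.-integrable setT (EFin \o f) ->
  mu.-integrable setT (EFin \o (fun x => c * f x)).
Proof. by move/(integrableZl measurableT c); apply: eq_integrable. Qed.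

Lemma integrable_addf f g : mu.-integrable setT (EFin \o f) ->
  mu.-integrable setT (EFin \o g) ->
  mu.-integrable setT (EFin \o (fun x => f x + g x)).
Proof. by move=> fi gi; have := integrableD measurableT fi gi; apply: eq_integrable. Qed.

Lemma integrable_subf f g : mu.-integrable setT (EFin \o f) ->
  mu.-integrable setT (EFin \o g) ->
  mu.-integrable setT (EFin \o (fun x => f x - g x)).
Proof. by move=> fi gi; have := integrableB measurableT fi gi; apply: eq_integrable. Qed.

Lemma integrable_sumf I (s : seq I) (h : I -> T -> R) :
  (forall i, mu.-integrable setT (EFin \o h i)) ->
  mu.-integrable setT (EFin \o (fun x => \sum_(i <- s) h i x)).
Proof.
move=> hi; have := @integrable_sum _ _ _ mu setT measurableT I s predT
  (fun i => EFin \o h i) (fun i _ => hi i).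
by apply: eq_integrable => // x _ /=; rewrite sumEFin.
Qed.

Lemma Rintegral_sum I (s : seq I) (h : I -> T -> R) :
  (forall i, mu.-integrable setT (EFin \o h i)) ->
  \int[mu]_x (\sum_(i <- s) h i x) = \sum_(i <- s) \int[mu]_x h i x.
Proof.
move=> hi; elim: s => [|a s IH].
  rewrite big_nil; under eq_Rintegral do rewrite big_nil.
  by rewrite Rintegral_cst// mul0r.
under eq_Rintegral do rewrite big_cons.
by rewrite RintegralD ?big_cons ?IH//; exact: integrable_sumf.
Qed.

End real_integrals.

(** * From decay of Laplace transforms at the integers to vanishing of mass *)

Section laplace.
Context {R : realType}.

Lemma sum_exp_coeff_le (x : R) n : 0 <= x ->
  \sum_(1 <= k < n) x ^+ k / k`!%:R <= expR x - 1.
Proof.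
move=> x0.
have h : series (exp_coeff x) n.+1 <= expR x.
  apply: nondecreasing_cvgn_le; last exact: is_cvg_series_exp_coeff.
  apply/nondecreasing_seqP => k; rewrite /series/= big_nat_recr//= lerDl.
  exact: exp_coeff_ge0.
rewrite lerBrDr (le_trans _ h)// /series/= big_nat_recl//= addrC.
rewrite {1}/exp_coeff/= expr0 fact0 divr1 lerD2l.
case: n h => [|n] _; first by rewrite !big_geq.
rewrite big_add1/= big_nat_recr//= lerDl.
exact: exp_coeff_ge0.
Qed.

Context d (T : measurableType d) (mu : {measure set T -> \bar R}).
Variables (Z w : T -> R) (b C : R).
Hypothesis mZ : measurable_fun setT Z.
Hypothesis iw : mu.-integrable setT (EFin \o w).
Hypothesis Z0 : forall x, w x != 0 -> 0 <= Z x.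

Let mw : measurable_fun setT w := measurable_integrable iw.

Lemma norm_expR_weight_le (a q : R) x : 0 <= a ->
  `|expR (q - a * Z x) * w x| <= expR q * `|w x|.
Proof.
move=> a0; rewrite normrM ger0_norm ?expR_ge0//.
have [->|/Z0 Zx] := eqVneq (w x) 0; first by rewrite normr0 !mulr0.
by rewrite ler_wpM2r// ler_expR gerBl mulr_ge0.
Qed.

Lemma integrable_expR_weight (a q : R) : 0 <= a ->
  mu.-integrable setT (EFin \o (fun x => expR (q - a * Z x) * w x)).
Proof.
move=> a0; apply: (@integrable_le _ _ _ _ _ (fun x => expR q * `|w x|)).
- apply: measurable_funM => //; apply: measurableT_comp => //.
  by apply: measurable_funB => //; exact: measurable_funM.
- by move=> x; exact: norm_expR_weight_le.
- by apply: integrableZ; exact: integrable_norm.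
Qed.

Hypothesis C0 : 0 <= C.
Hypothesis ZC : forall n : nat,
  `|\int[mu]_x (expR (- (n%:R * Z x)) * w x)| <= C * expR (- (n%:R * b)).

(** Expanding the outer exponential gives a series of Laplace transforms at the multiples [k * a].
    By [ZC] the k-th term is at most C e^(k(q - ab)) / k!, and the sum over k >= 1 is the stated
    bound; the term k = 0 is the integral of [w], which is subtracted. *)
Lemma Rintegral_expR_expR (a : nat) (q : R) :
  `|\int[mu]_x (expR (- expR (q - a%:R * Z x)) * w x) - \int[mu]_x w x|
    <= C * (expR (expR (q - a%:R * b)) - 1).
Proof.
pose p n x := (\sum_(0 <= k < n) (- expR (q - a%:R * Z x)) ^+ k / k`!%:R) * w x.
have ter k : (fun x => (- expR (q - a%:R * Z x)) ^+ k / k`!%:R * w x) =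
    (fun x => (-1) ^+ k / k`!%:R * expR (k%:R * q) *
       (expR (- ((k * a)%:R * Z x)) * w x)).
  apply/funext => x /=.
  have -> : (- expR (q - a%:R * Z x)) ^+ k = (-1) ^+ k *
      (expR (k%:R * q) * expR (- ((k * a)%:R * Z x))).
    rewrite [LHS]exprNn -(expRM_natl k (q - a%:R * Z x)) -expRD natrM.
    by congr (_ * expR _); ring.
  by ring.
have iter k : mu.-integrable setT
    (EFin \o (fun x => (- expR (q - a%:R * Z x)) ^+ k / k`!%:R * w x)).
  rewrite ter; apply: integrableZ.
  have := @integrable_expR_weight (k * a)%:R 0 (ler0n _ _).
  by apply: eq_integrable => // x _ /=; rewrite sub0r.
have pE n x : p n x = \sum_(0 <= k < n) ((- expR (q - a%:R * Z x)) ^+ k / k`!%:R * w x).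
  by rewrite /p mulr_suml.
have mE : measurable_fun setT (fun x => expR (q - a%:R * Z x)).
  apply: measurableT_comp => //.
  by apply: measurable_funB => //; exact: measurable_funM.
have cvgp : \int[mu]_x p n x @[n --> \oo] -->
    \int[mu]_x (expR (- expR (q - a%:R * Z x)) * w x).
  apply: (@Rintegral_dct _ _ _ _ _ _ (fun x => expR (expR q) * `|w x|)).
  - move=> n.
    apply: (@eq_measurable_fun _ _ _ _ _ (fun x => \sum_(0 <= k < n)
       ((- expR (q - a%:R * Z x)) ^+ k / k`!%:R * w x))).
      by move=> x _; rewrite pE.
    by apply: measurable_sum => k; exact: measurable_integrable.
  - apply: measurable_funM => //; apply: measurableT_comp => //.
    exact: measurableT_comp.
  - move=> x; apply: cvgM; last exact: cvg_cst.
    exact: (@is_cvg_series_exp_coeff R (- expR (q - a%:R * Z x))).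
  - by apply: integrableZ; exact: integrable_norm.
  - move=> n x; rewrite normrM.
    have [->|/Z0 Zx] := eqVneq (w x) 0; first by rewrite normr0 !mulr0.
    rewrite ler_wpM2r//.
    apply: (@le_trans _ _ (expR (expR (q - a%:R * Z x)))); last first.
      by rewrite !ler_expR gerBl mulr_ge0.
    apply: (le_trans (ler_norm_sum _ _ _)).
    apply: (@le_trans _ _ (series (exp_coeff (expR (q - a%:R * Z x))) n)).
      rewrite /series/= ler_sum// => k _; rewrite /exp_coeff/= normrM normrX normrN.
      by rewrite !ger0_norm ?expR_ge0// invr_ge0.
    apply: nondecreasing_cvgn_le; last exact: is_cvg_series_exp_coeff.
    apply/nondecreasing_seqP => k; rewrite /series/= big_nat_recr//= lerDl.
    by apply: exp_coeff_ge0; exact: expR_ge0.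
have ptE n : \int[mu]_x p n x = \sum_(0 <= k < n)
    (-1) ^+ k / k`!%:R * expR (k%:R * q) *
       \int[mu]_x (expR (- ((k * a)%:R * Z x)) * w x).
  under eq_Rintegral do rewrite pE.
  rewrite Rintegral_sum//; apply: eq_bigr => k _.
  rewrite ter RintegralZl//.
  have := @integrable_expR_weight (k * a)%:R 0 (ler0n _ _).
  by apply: eq_integrable => // x _ /=; rewrite sub0r.
suff h n : (0 < n)%N -> `|\int[mu]_x p n x - \int[mu]_x w x| <=
    C * (expR (expR (q - a%:R * b)) - 1).
  have : `|\int[mu]_x p n x - \int[mu]_x w x| @[n --> \oo] -->
    `|\int[mu]_x (expR (- expR (q - a%:R * Z x)) * w x) - \int[mu]_x w x|.
    by apply: cvg_norm; apply: cvgB => //; exact: cvg_cst.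
  move=> cv; rewrite -(cvg_lim _ cv)//; apply: limr_le.
    by apply/cvg_ex; eexists; exact: cv.
  by near=> n; apply: h; near: n; exact: nbhs_infty_gt.
move=> n0; rewrite ptE big_ltn// fact0 expr0 !mul0r expR0 divr1 !mul1r mul0n.
rewrite [X in X + _ - _](_ : _ = \int[mu]_x w x); last first.
  by apply: eq_Rintegral => x _; rewrite mul0r oppr0 expR0 mul1r.
rewrite addrAC subrr add0r.
apply: (le_trans (ler_norm_sum _ _ _)).
apply: (@le_trans _ _ (\sum_(1 <= k < n) C * (expR (q - a%:R * b) ^+ k / k`!%:R))).
  apply: ler_sum => k _.
  rewrite !normrM normrX normrN1 expr1n mul1r ger0_norm ?invr_ge0//.
  rewrite (ger0_norm (expR_ge0 _)).
  have -> : C * (expR (q - a%:R * b) ^+ k / k`!%:R) =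
     k`!%:R^-1 * expR (k%:R * q) * (C * expR (- ((k * a)%:R * b))).
    have -> : expR (q - a%:R * b) ^+ k =
        expR (k%:R * q) * expR (- ((k * a)%:R * b)).
      rewrite -(expRM_natl k (q - a%:R * b)) -expRD natrM.
      by congr expR; ring.
    by ring.
  by rewrite ler_wpM2l// mulr_ge0 ?invr_ge0 ?expR_ge0.
by rewrite -mulr_sumr ler_wpM2l// sum_exp_coeff_le// expR_ge0.
Unshelve. all: end_near. Qed.

End laplace.

Section laplace_support.
Context {R : realType} d (T : measurableType d) (mu : {measure set T -> \bar R}).
Variables (Z w : T -> R).
Hypothesis mZ : measurable_fun setT Z.
Hypothesis iw : mu.-integrable setT (EFin \o w).
Hypothesis Z0 : forall x, w x != 0 -> 0 <= Z x.

Let mw : measurable_fun setT w := measurable_integrable iw.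

Lemma measurable_ltr_ind (t : R) : measurable_fun setT (fun x => (Z x < t)%R%:R : R).
Proof.
have -> : (fun x => (Z x < t)%R%:R) = (\1_(Z @^-1` `]-oo, t[) : T -> R).
  apply/funext => x; rewrite indicE; congr ((nat_of_bool _)%:R : R).
  by apply/idP/idP; rewrite in_setE/= in_itv.
apply: measurable_indic; rewrite -[X in measurable X]setTI.
by apply: mZ => //; exact: measurable_itv.
Qed.

Lemma integrable_ltr_ind (t : R) :
  mu.-integrable setT (EFin \o (fun x => (Z x < t)%R%:R * w x)).
Proof.
apply: (@integrable_mul_bounded _ _ _ _ _ _ 1) => //; first exact: measurable_ltr_ind.
by move=> x; case: ltP => _; rewrite ?normr1 ?normr0.
Qed.

Variables (b C : R).
Hypothesis C0 : 0 <= C.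
Hypothesis ZC : forall n : nat,
  `|\int[mu]_x (expR (- (n%:R * Z x)) * w x)| <= C * expR (- (n%:R * b)).

(* [e N] tends to the indicator of [Z >= t]; expanded in powers of [expR (- N^2 Z)], its integral
   against [w] is a series of Laplace transforms of [w], small because of the decay [ZC]. *)
Lemma laplace_decay_vanish (t : R) : t <= b ->
  \int[mu]_x ((Z x < t)%R%:R * w x) = 0.
Proof.
move=> tb.
(* The inner exponent is N^2 (t - Z) - N: it tends to +oo for Z < t, while the extra - N sends it to
   -oo for Z >= t, including Z = t. The same - N makes the error bound C (exp(exp(-N)) - 1) vanish
   even when t = b. *)
pose q (N : nat) : R := (N ^ 2)%N%:R * t - N%:R.
pose e (N : nat) x : R := expR (- expR (q N - (N ^ 2)%N%:R * Z x)).
have me N : measurable_fun setT (e N).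
  do 2 (apply: measurableT_comp => //).
  apply: measurableT_comp => //.
  by apply: measurable_funB => //; exact: measurable_funM.
have ele x N : 0 <= e N x <= 1.
  by rewrite expR_ge0/= -[leRHS]expR0 ler_expR oppr_le0 expR_ge0.
have cvge x : e N x @[N --> \oo] --> (1 - (Z x < t)%R%:R : R).
  case: ltP => [Zt|tZ].
  - rewrite subrr; apply: (squeeze_cvgr _ (@cvg_cst _ (0:R) _ _ _) (@cvgn_expR R)).
    near=> N; rewrite expR_ge0/= ler_expR lerN2.
    have h : N%:R <= q N - (N ^ 2)%:R * Z x.
      have hN : 2 / (t - Z x) <= N%:R by near: N; exact: nbhs_infty_ger.
      rewrite ler_pdivrMr ?subr_gt0// in hN.
      rewrite /q natrX; have := ler0n R N; set M := (N%:R : R) in hN *.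
      by move=> M0; nra.
    apply: (le_trans h); apply: (le_trans _ (expR_ge1Dx _)).
    by rewrite lerDr.
  - rewrite subr0.
    have h : 1 - expR (- N%:R) @[N --> \oo] --> (1 - 0 : R).
      by apply: cvgB; [exact: cvg_cst|exact: (@cvgn_expR R)].
    rewrite subr0 in h.
    apply: (squeeze_cvgr _ h (@cvg_cst _ (1:R) _ _ _)).
    near=> N; have /andP[_ ->] := ele x N; rewrite andbT.
    apply: (le_trans _ (expR_ge1Dx _)); rewrite lerD2l lerN2 ler_expR /q natrX.
    have := ler0n R N; set M := (N%:R : R) => M0.
    rewrite -addrA -opprD opprD addrCA gerDl -mulrBr mulr_ge0_le0 ?sqr_ge0//.
    by rewrite subr_le0.
have cI : \int[mu]_x (e N x * w x) @[N --> \oo] -->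
    \int[mu]_x ((1 - (Z x < t)%R%:R) * w x).
  apply: (@Rintegral_dct _ _ _ _ _ _ (fun x => `|w x|)).
  - by move=> N; exact: measurable_funM.
  - apply: measurable_funM => //; apply: measurable_funB => //.
    exact: measurable_ltr_ind.
  - by move=> x; apply: cvgM => //; exact: cvg_cst.
  - exact: integrable_norm.
  - move=> N x; rewrite normrM ler_piMl//; have /andP[? ?] := ele x N.
    by rewrite ger0_norm.
have cB : C * (expR (expR (- N%:R)) - 1) @[N --> \oo] --> (C * (expR 0 - 1)).
  apply: cvgM; first exact: cvg_cst.
  apply: cvgB; last exact: cvg_cst.
  by apply: continuous_cvg; [exact: continuous_expR|exact: (@cvgn_expR R)].
rewrite expR0 subrr mulr0 in cB.
have c0 : \int[mu]_x (e N x * w x) - \int[mu]_x w x @[N --> \oo] --> (0 : R).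
  apply/cvgrPdist_le => eps eps0; near=> N; rewrite sub0r normrN.
  apply: (le_trans (Rintegral_expR_expR mZ iw Z0 C0 ZC (N ^ 2)%N (q N))).
  apply: (@le_trans _ _ (C * (expR (expR (- N%:R)) - 1))).
    rewrite ler_wpM2l// lerD2r !ler_expR /q.
    rewrite addrAC gerDr -mulrBr mulr_ge0_le0// ?ler0n//.
    by rewrite subr_le0.
  near: N.
  move/cvgrPdist_le : cB => /(_ _ eps0); apply: filterS => N.
  by rewrite sub0r normrN; apply: le_trans; exact: ler_norm.
have c1 : \int[mu]_x (e N x * w x) - \int[mu]_x w x @[N --> \oo] -->
    \int[mu]_x ((1 - (Z x < t)%R%:R) * w x) - \int[mu]_x w x.
  by apply: cvgB => //; exact: cvg_cst.
have : \int[mu]_x ((1 - (Z x < t)%R%:R) * w x) - \int[mu]_x w x = 0.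
  exact: (cvg_unique (@Rhausdorff R) c1 c0).
rewrite -RintegralB//; last first.
  have := integrable_subf iw (integrable_ltr_ind t).
  by apply: eq_integrable => // x _ /=; rewrite mulrBl mul1r.
move=> h; apply/eqP; rewrite -oppr_eq0 -mulN1r -RintegralZl//; last first.
  exact: integrable_ltr_ind.
by apply/eqP; rewrite -[RHS]h; apply: eq_Rintegral => x _; ring.
Unshelve. all: end_near. Qed.

(** Every slice s <= Z < t with t <= b carries zero [w]-mass, so step functions of [Z] on the mesh
    1/N integrate to 0; they converge to psi(Z) on Z < b and are dominated. The thresholds are cut
    at [b] because nothing is known above it. *)
Lemma vanish_comp (psi : R -> R) (M : R) : continuous psi ->
  (forall z, 0 <= z <= b -> `|psi z| <= M) ->
  (forall t, t <= b -> \int[mu]_x ((Z x < t)%R%:R * w x) = 0) ->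
  \int[mu]_x ((Z x < b)%R%:R * (psi (Z x) * w x)) = 0.
Proof.
move=> cpsi psiM W0.
pose K (N : nat) := (Num.truncn (b * N%:R)).+1.
pose c (N k : nat) : R := psi (k%:R / N%:R).
pose g (N : nat) x : R := \sum_(0 <= k < K N) c N k *
  ((Z x < Num.min b (k.+1%:R / N%:R))%R%:R - (Z x < Num.min b (k%:R / N%:R))%R%:R).
have gE N x : (0 < N)%N -> 0 <= Z x ->
    g N x = (Z x < b)%R%:R * psi ((Num.truncn (Z x * N%:R))%:R / N%:R).
  move=> N0 Zx0; have N0' : 0 < N%:R :> R by rewrite ltr0n.
  rewrite /g; under eq_bigr do rewrite !lt_min.
  case: (ltP (Z x) b) => Zb /=; last first.
    by rewrite mul0r big1// => k _; rewrite subrr mulr0.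
  have /andP[h1 h2] : (Num.truncn (Z x * N%:R))%:R <= Z x * N%:R
      < (Num.truncn (Z x * N%:R)).+1%:R.
    by apply: truncn_itv; rewrite mulr_ge0// ltW.
  have hk k : (Z x < k%:R / N%:R) = (Num.truncn (Z x * N%:R) < k)%N.
    by rewrite ltr_pdivlMr// truncn_lt_nat// mulr_ge0// ltW.
  rewrite (bigD1_seq (Num.truncn (Z x * N%:R)))/=; last first.
    - exact: (iota_uniq 0 (K N)).
    - rewrite mem_index_iota /K leq0n ltnS /=; apply: le_truncn.
      by rewrite ler_pM2r// ltW.
  rewrite !hk ltnSn ltnn subr0 mulr1 mul1r big1 ?addr0// => k kn.
  rewrite !hk ltnS leq_eqVlt eq_sym.
  by rewrite (negbTE kn)/= subrr mulr0.
have ig N : mu.-integrable setT (EFin \o (fun x => g N x * w x)).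
  have : mu.-integrable setT (EFin \o (fun x => \sum_(0 <= k < K N) c N k *
      ((Z x < Num.min b (k.+1%:R / N%:R))%R%:R * w x -
       (Z x < Num.min b (k%:R / N%:R))%R%:R * w x))).
    apply: integrable_sumf => k; apply: integrableZ.
    by apply: integrable_subf; exact: integrable_ltr_ind.
  apply: eq_integrable => // x _ /=; rewrite /g mulr_suml; congr EFin.
  by apply: eq_bigr => k _; ring.
have g0 N : \int[mu]_x (g N x * w x) = 0.
  under eq_Rintegral do rewrite /g mulr_suml.
  rewrite Rintegral_sum; last first.
    move=> k; have : mu.-integrable setT (EFin \o (fun x => c N k *
      ((Z x < Num.min b (k.+1%:R / N%:R))%R%:R * w x -
       (Z x < Num.min b (k%:R / N%:R))%R%:R * w x))).
      by apply: integrableZ; apply: integrable_subf; exact: integrable_ltr_ind.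
    by apply: eq_integrable => // x _ /=; congr EFin; ring.
  rewrite big1// => k _; under eq_Rintegral do rewrite -mulrA mulrBl.
  rewrite RintegralZl//; last first.
    by apply: integrable_subf; exact: integrable_ltr_ind.
  rewrite RintegralB ?W0 ?ge_min ?lexx// ?subrr ?mulr0//; exact: integrable_ltr_ind.
have M0 x : (Z x < b) -> 0 <= Z x -> 0 <= M.
  by move=> zb z0; apply: le_trans (psiM (Z x) _) => //; rewrite z0 ltW.
have mpsi : measurable_fun setT psi by exact: continuous_measurable_fun.
have cv : \int[mu]_x (g N.+1 x * w x) @[N --> \oo] -->
    \int[mu]_x ((Z x < b)%R%:R * (psi (Z x) * w x)).
  apply: (@Rintegral_dct _ _ _ _ _ _ (fun x => `|M| * `|w x|)).
  - by move=> N; exact: measurable_integrable (ig _).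
  - apply: measurable_funM; first exact: measurable_ltr_ind.
    by apply: measurable_funM => //; exact: measurableT_comp.
  - move=> x; rewrite mulrA.
    have [->|/Z0 Zx] := eqVneq (w x) 0.
      by under eq_fun do rewrite mulr0; rewrite mulr0; exact: cvg_cst.
    apply: cvgM; last exact: cvg_cst.
    under eq_fun do rewrite gE//.
    apply: cvgM; first exact: cvg_cst.
    apply: continuous_cvg; first exact: cpsi.
    have h : Z x - harmonic N @[N --> \oo] --> Z x - 0.
      by apply: cvgB; [exact: cvg_cst|exact: cvg_harmonic].
    rewrite subr0 in h.
    apply: (squeeze_cvgr _ h (@cvg_cst _ (Z x) _ _ _)).
    apply: nearW => N.
    have /andP[h1 h2] : (Num.truncn (Z x * N.+1%:R))%:R <= Z x * N.+1%:R
        < (Num.truncn (Z x * N.+1%:R)).+1%:R by apply: truncn_itv; rewrite mulr_ge0.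
    rewrite ler_pdivrMr ?ltr0n// h1 andbT ler_pdivlMr ?ltr0n//.
    rewrite mulrBl /harmonic/= mulVf ?pnatr_eq0// lerBlDr ltW//.
    by rewrite natr1.
  - by apply: integrableZ; exact: integrable_norm.
  - move=> N x; rewrite normrM.
    have [->|/Z0 Zx] := eqVneq (w x) 0; first by rewrite normr0 !mulr0.
    rewrite ler_wpM2r// gE//; case: ltP => Zb; last by rewrite mul0r normr0.
    rewrite mul1r (le_trans _ (ler_norm _))// psiM//.
    rewrite divr_ge0//= ler_pdivrMr//.
    apply: (@le_trans _ _ (Z x * N.+1%:R)); last by rewrite ler_pM2r// ltW.
    by rewrite truncn_le mulr_ge0.
move: cv; under eq_fun do rewrite g0.
by move=> /cvg_lim <-//; rewrite lim_cst.
Unshelve. all: end_near. Qed.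

End laplace_support.

Section moments.
Context {R : realType} d (T : measurableType d) (mu : {measure set T -> \bar R}).

(** The exponential series expresses every Laplace transform through moments, so all of them vanish
    and the decay hypothesis holds with constant 0 at any rate, in particular at rate [t]. *)
Lemma vanish_moments (Z w : T -> R) (M : R) : measurable_fun setT Z ->
  mu.-integrable setT (EFin \o w) -> (forall x, w x != 0 -> 0 <= Z x <= M) ->
  (forall j, \int[mu]_x (Z x ^+ j * w x) = 0) ->
  forall t, \int[mu]_x ((Z x < t)%R%:R * w x) = 0.
Proof.
move=> mZ iw ZM Zw t.
have mw := measurable_integrable iw.
apply: (@laplace_decay_vanish _ _ _ _ _ _ _ _ _ t 0) => //.
  by move=> x /ZM /andP[].
move=> n; rewrite mul0r normr_le0; apply/eqP.
pose p N x := (\sum_(0 <= k < N) (- (n%:R * Z x)) ^+ k / k`!%:R) * w x.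
have ipow k : mu.-integrable setT (EFin \o (fun x => Z x ^+ k * w x)).
  apply: (@integrable_le _ _ _ _ _ (fun x => `|M| ^+ k * `|w x|)).
  - by apply: measurable_funM => //; exact: measurable_funX.
  - move=> x; rewrite normrM.
    have [->|/ZM /andP[z0 zM]] := eqVneq (w x) 0; first by rewrite normr0 !mulr0.
    rewrite ler_wpM2r// normrX lerXn2r ?nnegrE// ger0_norm//.
    by rewrite (le_trans zM)// ler_norm.
  - by apply: integrableZ; exact: integrable_norm.
have iter k : mu.-integrable setT
    (EFin \o (fun x => (- n%:R) ^+ k / k`!%:R * (Z x ^+ k * w x))).
  exact: integrableZ.
have pE N x : p N x = \sum_(0 <= k < N) (- n%:R) ^+ k / k`!%:R * (Z x ^+ k * w x).
  rewrite /p mulr_suml; apply: eq_bigr => k _.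
  by rewrite -mulNr exprMn; ring.
have p0 N : \int[mu]_x p N x = 0.
  under eq_Rintegral do rewrite pE.
  rewrite Rintegral_sum// big1// => k _.
  by rewrite RintegralZl// Zw mulr0.
have : \int[mu]_x p N x @[N --> \oo] --> \int[mu]_x (expR (- (n%:R * Z x)) * w x).
  apply: (@Rintegral_dct _ _ _ _ _ _ (fun x => expR (n%:R * `|M|) * `|w x|)).
  - move=> N.
    apply: (@eq_measurable_fun _ _ _ _ _ (fun x => \sum_(0 <= k < N)
       ((- n%:R) ^+ k / k`!%:R * (Z x ^+ k * w x)))).
      by move=> x _; rewrite pE.
    by apply: measurable_sum => k; exact: measurable_integrable (iter k).
  - apply: measurable_funM => //; apply: measurableT_comp => //.
    by apply: measurableT_comp => //; exact: measurable_funM.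
  - move=> x; apply: cvgM; last exact: cvg_cst.
    exact: (@is_cvg_series_exp_coeff R (- (n%:R * Z x))).
  - by apply: integrableZ; exact: integrable_norm.
  - move=> N x; rewrite normrM.
    have [->|/ZM /andP[z0 zM]] := eqVneq (w x) 0; first by rewrite normr0 !mulr0.
    rewrite ler_wpM2r//; apply: (le_trans (ler_norm_sum _ _ _)).
    apply: (@le_trans _ _ (expR (n%:R * Z x))); last first.
      by rewrite ler_expR ler_wpM2l// (le_trans zM)// ler_norm.
    apply: (@le_trans _ _ (series (exp_coeff (n%:R * Z x)) N)).
      rewrite /series/= ler_sum// => k _; rewrite /exp_coeff/= normrM normrX normrN.
      by rewrite !ger0_norm ?mulr_ge0// invr_ge0.
    apply: nondecreasing_cvgn_le; last exact: is_cvg_series_exp_coeff.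
    apply/nondecreasing_seqP => k; rewrite /series/= big_nat_recr//= lerDl.
    by apply: exp_coeff_ge0; exact: mulr_ge0.
by under eq_fun do rewrite p0; move=> /cvg_lim <-//; rewrite lim_cst.
Qed.

End moments.

(** * Titchmarsh's convolution theorem in Laplace form *)

Section product_integral.
Context {R : realType} d1 d2 (T1 : measurableType d1) (T2 : measurableType d2).
Variables (m1 : {sigma_finite_measure set T1 -> \bar R}).
Variables (m2 : {sigma_finite_measure set T2 -> \bar R}).
Variables (f : T1 -> R) (g : T2 -> R).
Hypotheses (fi : m1.-integrable setT (EFin \o f)) (gi : m2.-integrable setT (EFin \o g)).

Lemma integrable_prod :
  (m1 \x m2)%E.-integrable setT (EFin \o (fun z => f z.1 * g z.2)).
Proof.
have mf := measurable_integrable fi; have mg := measurable_integrable gi.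
apply/integrable12ltyP.
  apply/measurable_EFinP; apply: measurable_funM; exact: measurableT_comp.
under eq_integral => x _.
  under eq_integral => y _ do rewrite /= normrM EFinM.
  rewrite ge0_integralZl_EFin//; last first.
    by apply/measurable_EFinP; exact: measurableT_comp.
  over.
have /fineK <- : (\int[m2]_y `|g y|%:E)%E \is a fin_num.
  exact: integrable_fin_num (integrable_norm gi).
rewrite integralZr//; last exact: (integrable_norm fi).
by rewrite -EFin_Rintegral ?ltry//; exact: (integrable_norm fi).
Qed.

Lemma Rintegral_prod :
  \int[(m1 \x m2)%E]_z (f z.1 * g z.2) = \int[m1]_x f x * \int[m2]_y g y.
Proof.
rewrite /Rintegral.
rewrite -(integral12_prod_meas1 integrable_prod) /fubini_F/=.
under eq_integral => x _.
  under eq_integral => y _ do rewrite EFinM.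
  rewrite integralZl// -EFin_Rintegral//.
  over.
rewrite integralZr// -EFin_Rintegral//.
Qed.

End product_integral.

Section concave_sequence.
Context {R : realType}.

(* A bounded sequence that is concave as long as it decreases cannot decrease. *)
Lemma lower_concave_ge (A : nat -> R) : (forall s, 0 <= A s) ->
  (forall s, A s + Num.min (A s.+1) (A s.+2) <= 2 * A s.+1) ->
  forall s, A 0%N <= A s.
Proof.
move=> A0 Ac; elim=> // s IH; apply: (le_trans IH); rewrite leNgt; apply/negP => lt.
(* A drop by [del] at one step forces a drop by at least [del] at every later step, which finally
   contradicts nonnegativity. *)
set del := A s - A s.+1; have del0 : 0 < del by rewrite subr_gt0.
have h k : A (s + k).+1 <= A (s + k)%N - del.
  elim: k => [|k IHk]; first by rewrite addn0 /del opprB addrC subrK.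
  rewrite addnS; have := Ac (s + k)%N.
  case: (leP (A (s + k).+1) (A (s + k).+2)) => h1; lra.
have g k : A (s + k)%N <= A s - k%:R * del.
  elim: k => [|k IHk]; first by rewrite addn0 mul0r subr0.
  by rewrite addnS -natr1; have := h k; lra.
pose k := (Num.truncn (A s / del)).+1.
have : A s < k%:R * del.
  rewrite -ltr_pdivrMr//.
  by have /andP[] : (Num.truncn (A s / del))%:R <= A s / del < k%:R
    by apply: truncn_itv; rewrite divr_ge0// ltW.
by have := g k; have := A0 (s + k)%N; lra.
Qed.

End concave_sequence.

Section titchmarsh.
Context {R : realType} d1 d2 (T1 : measurableType d1) (T2 : measurableType d2).
Variables (m1 : {sigma_finite_measure set T1 -> \bar R}).
Variables (m2 : {sigma_finite_measure set T2 -> \bar R}).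
Variables (X f : T1 -> R) (Y g : T2 -> R) (M : R).
Hypotheses (mX : measurable_fun setT X) (mY : measurable_fun setT Y).
Hypotheses (fi : m1.-integrable setT (EFin \o f)) (gi : m2.-integrable setT (EFin \o g)).
Hypotheses (fM : forall x, f x != 0 -> 0 <= X x <= M).
Hypotheses (gM : forall x, g x != 0 -> 0 <= Y x <= M).

Let pw T (Z h : T -> R) (i : nat) (x : T) := Z x ^+ i * h x.
(** Up to the sign (-1)^i, the i-th derivative at n of the Laplace transform of the weight [h] seen
    through [Z]. *)
Let lap d (T : measurableType d) (mu : {measure set T -> \bar R}) (Z h : T -> R)
    (i n : nat) : R :=
  \int[mu]_x (expR (- (n%:R * Z x)) * pw Z h i x).

Let integrable_pw d (T : measurableType d) (mu : {measure set T -> \bar R}) (Z h : T -> R) i :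
  measurable_fun setT Z ->
  mu.-integrable setT (EFin \o h) -> (forall x, h x != 0 -> 0 <= Z x <= M) ->
  mu.-integrable setT (EFin \o pw Z h i).
Proof.
move=> mZ hi hM; apply: (@integrable_le _ _ _ _ _ (fun x => `|M| ^+ i * `|h x|)).
- by apply: measurable_funM; [exact: measurable_funX|exact: measurable_integrable hi].
- move=> x; rewrite /pw normrM.
  have [->|/hM /andP[z0 zM]] := eqVneq (h x) 0; first by rewrite normr0 !mulr0.
  rewrite ler_wpM2r// normrX lerXn2r ?nnegrE// ger0_norm//.
  by rewrite (le_trans zM)// ler_norm.
- by apply: integrableZ; exact: integrable_norm.
Qed.

Let pw_neq0 T (Z h : T -> R) i x : pw Z h i x != 0 -> h x != 0.
Proof. by rewrite /pw mulf_eq0 negb_or => /andP[]. Qed.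

Let integrable_lap d (T : measurableType d) (mu : {measure set T -> \bar R}) (Z h : T -> R) i n :
  measurable_fun setT Z ->
  mu.-integrable setT (EFin \o h) -> (forall x, h x != 0 -> 0 <= Z x <= M) ->
  mu.-integrable setT (EFin \o (fun x => expR (- (n%:R * Z x)) * pw Z h i x)).
Proof.
move=> mZ hi hM.
have Z0 x : pw Z h i x != 0 -> 0 <= Z x.
  by move=> hx; have /andP[] := hM _ (pw_neq0 hx).
have := integrable_expR_weight mZ (integrable_pw i mZ hi hM) Z0 0 (ler0n R n).
by apply: eq_integrable => // x _ /=; rewrite sub0r.
Qed.

(** The weight f(x) g(y) seen through X + Y on the product space stands for the convolution, which
    is never formed as a function. Its transform is a product by [lapE]. *)
Let Z (z : T1 * T2) : R := X z.1 + Y z.2.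
Let w i j (z : T1 * T2) : R := pw X f i z.1 * pw Y g j z.2.

Let mZ : measurable_fun setT Z.
Proof. by apply: measurable_funD; exact: measurableT_comp. Qed.

Let iw i j : (m1 \x m2)%E.-integrable setT (EFin \o w i j).
Proof. by apply: integrable_prod; exact: integrable_pw. Qed.

Let w_neq0 i j z : w i j z != 0 -> (0 <= X z.1 <= M) && (0 <= Y z.2 <= M).
Proof.
rewrite /w mulf_eq0 negb_or => /andP[hf hg].
by rewrite (fM (pw_neq0 hf)) (gM (pw_neq0 hg)).
Qed.

Let Z0 i j z : w i j z != 0 -> 0 <= Z z.
Proof. by move=> /w_neq0 /andP[/andP[? _] /andP[? _]]; rewrite addr_ge0. Qed.

Let lapE i j n : \int[(m1 \x m2)%E]_z (expR (- (n%:R * Z z)) * w i j z) =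
  lap m1 X f i n * lap m2 Y g j n.
Proof.
rewrite -Rintegral_prod; [|exact: integrable_lap|exact: integrable_lap].
apply: eq_Rintegral => z _; rewrite /w /Z mulrDr opprD expRD; ring.
Qed.

Let decay i j b := exists2 C, 0 <= C &
  forall n, `|lap m1 X f i n * lap m2 Y g j n| <= C * expR (- (n%:R * b)).

Let decay_vanish i j b t : decay i j b -> t <= b ->
  \int[(m1 \x m2)%E]_z ((Z z < t)%R%:R * w i j z) = 0.
Proof.
move=> [C C0 hC] tb; apply: (laplace_decay_vanish mZ (iw i j) (@Z0 i j) C0 _ tb).
by move=> n; rewrite lapE.
Qed.

(** The sum is minus the derivative of the product of transforms, that is the transform of [Z * w].
    Decay at rate [b] means that [w] has no mass on slices of [Z] below [b]; by [vanish_comp]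
    neither has exp(-nZ) Z w, and on Z >= b the exponential is at most exp(-nb). *)
Let decay_deriv i j b : decay i j b -> exists2 C, 0 <= C &
  forall n, `|lap m1 X f i.+1 n * lap m2 Y g j n + lap m1 X f i n * lap m2 Y g j.+1 n|
    <= C * expR (- (n%:R * b)).
Proof.
move=> dij.
have wE z : Z z * w i j z = w i.+1 j z + w i j.+1 z.
  by rewrite /w /pw /Z !exprS; ring.
have iZw : (m1 \x m2)%E.-integrable setT (EFin \o (fun z => Z z * w i j z)).
  have := integrable_addf (iw i.+1 j) (iw i j.+1).
  by apply: eq_integrable => // z _ /=; rewrite wE.
have Zw0 z : Z z * w i j z != 0 -> 0 <= Z z.
  by rewrite mulf_eq0 negb_or => /andP[_ /Z0].
have ieZw n : (m1 \x m2)%E.-integrable setT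
    (EFin \o (fun z => expR (- (n%:R * Z z)) * (Z z * w i j z))).
  have := integrable_expR_weight mZ iZw Zw0 0 (ler0n R n).
  by apply: eq_integrable => // z _ /=; rewrite sub0r.
exists (\int[(m1 \x m2)%E]_z `|Z z * w i j z|).
  by apply: Rintegral_ge0 => z _.
move=> n; rewrite -!lapE -RintegralD//; last 2 first.
- have := integrable_expR_weight mZ (iw i.+1 j) (@Z0 _ _) 0 (ler0n R n).
  by apply: eq_integrable => // z _ /=; rewrite sub0r.
- have := integrable_expR_weight mZ (iw i j.+1) (@Z0 _ _) 0 (ler0n R n).
  by apply: eq_integrable => // z _ /=; rewrite sub0r.
under eq_Rintegral do rewrite -mulrDr -wE.
have van : \int[(m1 \x m2)%E]_z ((Z z < b)%R%:R * ((expR (- (n%:R * Z z)) * Z z) * w i j z)) = 0.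
  apply: (vanish_comp mZ (iw i j) (@Z0 i j) (psi := fun z => expR (- (n%:R * z)) * z) (M := b)).
  - move=> z; apply: cvgM; last exact: cvg_id.
    apply: continuous_cvg; first exact: continuous_expR.
    by apply: cvgN; apply: cvgM; [exact: cvg_cst|exact: cvg_id].
  - move=> z /andP[z0 zb]; rewrite normrM !ger0_norm ?expR_ge0//.
    by rewrite -[leRHS]mul1r ler_pM ?expR_ge0// -[leRHS]expR0 ler_expR oppr_le0 mulr_ge0.
  - by move=> t tb; exact: decay_vanish dij tb.
have iv : (m1 \x m2)%E.-integrable setT (EFin \o (fun z => (Z z < b)%R%:R *
    (expR (- (n%:R * Z z)) * (Z z * w i j z)))).
  exact: integrable_ltr_ind.
have -> : \int[(m1 \x m2)%E]_z (expR (- (n%:R * Z z)) * (Z z * w i j z)) =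
   \int[(m1 \x m2)%E]_z (expR (- (n%:R * Z z)) * (Z z * w i j z) -
    (Z z < b)%R%:R * (expR (- (n%:R * Z z)) * (Z z * w i j z))).
  rewrite RintegralB//; under [X in _ - X]eq_Rintegral do rewrite [_ * (Z _ * _)]mulrA.
  by rewrite van subr0.
apply: (le_trans (le_normr_Rintegral measurableT _)).
  by apply: integrable_subf.
rewrite -RintegralZr//; last exact: integrable_norm.
apply: le_Rintegral => //.
- by apply: integrable_norm; exact: integrable_subf.
- have := integrableZ (expR (- (n%:R * b))) (integrable_norm iZw).
  by apply: eq_integrable => // z _ /=; rewrite mulrC.
- move=> z _; rewrite -{1}[expR _ * _]mul1r -mulrBl mulrC.
  case: (ltP (Z z) b) => zb; first by rewrite subrr mulr0 normr0 mulr_ge0// expR_ge0.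
  rewrite subr0 mulr1 normrM mulrC ler_wpM2l// ger0_norm ?expR_ge0// ler_expR lerN2.
  by rewrite ler_wpM2l.
Qed.

Let P s b := forall i j, (i + j)%N = s -> decay i j b.

(** Quantitative form of the classical argument by which a vanishing convolution of f and g makes
    that of f and xg vanish. The square of F0 G1 equals F0 G1 (F1 G0 + F0 G1) - (F0 G0) (F1 G1). The
    first product has rate b + a by [decay_deriv], the second rate a + c, and the square root halves
    the exponent. *)
Let P_step s a b c : P s a -> P s.+1 b -> P s.+2 c ->
  P s.+1 ((a + Num.min b c) / 2).
Proof.
move=> Pa Pb Pc i j ijs.
have key i' j' : (i' + j')%N = s -> exists2 C, 0 <= C & forall n,
    `|lap m1 X f i' n * lap m2 Y g j'.+1 n| ^+ 2 <= C * expR (- (n%:R * (a + Num.min b c))) /\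
    `|lap m1 X f i'.+1 n * lap m2 Y g j' n| ^+ 2 <= C * expR (- (n%:R * (a + Num.min b c))).
  move=> s'.
  have [C1 C10 h1] := decay_deriv (Pa _ _ s').
  have [C2 C20 h2] := Pa _ _ s'.
  have [C3 C30 h3] : decay i' j'.+1 b by apply: Pb; rewrite addnS s'.
  have [C4 C40 h4] : decay i'.+1 j' b by apply: Pb; rewrite addSn s'.
  have [C5 C50 h5] : decay i'.+1 j'.+1 c by apply: Pc; rewrite addSn addnS s'.
  exists ((C3 + C4) * C1 + C2 * C5).
    by rewrite addr_ge0// mulr_ge0// addr_ge0.
  move=> n; move: (h1 n) (h2 n) (h3 n) (h4 n) (h5 n).
  set F0 := lap m1 X f i' n; set F1 := lap m1 X f i'.+1 n.
  set G0 := lap m2 Y g j' n; set G1 := lap m2 Y g j'.+1 n => k1 k2 k3 k4 k5.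
  pose ee := expR (- (n%:R * (a + Num.min b c))).
  have e1 : expR (- (n%:R * b)) * expR (- (n%:R * a)) <= ee.
    rewrite -expRD ler_expR -opprD lerN2 -mulrDr ler_wpM2l// addrC lerD2r.
    by rewrite ge_min lexx.
  have e2 : expR (- (n%:R * a)) * expR (- (n%:R * c)) <= ee.
    rewrite -expRD ler_expR -opprD lerN2 -mulrDr ler_wpM2l// lerD2l.
    by rewrite ge_min lexx orbT.
  have b2 : `|F0 * G0| * `|F1 * G1| <= C2 * C5 * ee.
    apply: (@le_trans _ _ ((C2 * expR (- (n%:R * a))) * (C5 * expR (- (n%:R * c))))).
      by apply: ler_pM.
    by rewrite mulrACA ler_wpM2l// mulr_ge0.
  have b1 (V D : R) : 0 <= D -> D <= C3 + C4 -> `|V| <= D * expR (- (n%:R * b)) ->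
      `|V| * `|F1 * G0 + F0 * G1| <= (C3 + C4) * C1 * ee.
    move=> D0 DC XD.
    apply: (@le_trans _ _ ((D * expR (- (n%:R * b))) * (C1 * expR (- (n%:R * a))))).
      by apply: ler_pM.
    rewrite mulrACA ler_pM ?mulr_ge0 ?expR_ge0//.
    by rewrite ler_wpM2r.
  split.
  - rewrite -normrX.
    have -> : (F0 * G1) ^+ 2 = F0 * G1 * (F1 * G0 + F0 * G1) - F0 * G0 * (F1 * G1) by ring.
    rewrite (le_trans (ler_normB _ _))// !normrM -/ee mulrDl lerD//.
      by rewrite -normrM (b1 _ C3)// lerDl.
    by move: b2; rewrite !normrM.
  - rewrite -normrX.
    have -> : (F1 * G0) ^+ 2 = F1 * G0 * (F1 * G0 + F0 * G1) - F0 * G0 * (F1 * G1) by ring.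
    rewrite (le_trans (ler_normB _ _))// !normrM -/ee mulrDl lerD//.
      by rewrite -normrM (b1 _ C4)// lerDr.
    by move: b2; rewrite !normrM.
have fin C V n : 0 <= C -> 0 <= V -> V ^+ 2 <= C * expR (- (n%:R * (a + Num.min b c))) ->
    V <= Num.sqrt C * expR (- (n%:R * ((a + Num.min b c) / 2))).
  move=> C0 X0 h.
  rewrite -(@ler_pXn2r _ 2)// ?nnegrE ?mulr_ge0 ?expR_ge0 ?sqrtr_ge0//.
  rewrite exprMn sqr_sqrtr// -expRM_natl.
  by rewrite (_ : 2%:R * _ = - (n%:R * (a + Num.min b c))) //; field.
(* A pair of sum s + 1 comes from a pair of sum s by raising one index: the first one if j = 0, the
   second one otherwise. *)
case: j ijs => [|j'].
- rewrite addn0 => ->; have [C C0 h] := key s 0%N (addn0 s).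
  by exists (Num.sqrt C); rewrite ?sqrtr_ge0// => n; apply: fin => //; exact: (h n).2.
- rewrite addnS => -[/key[C C0 h]].
  by exists (Num.sqrt C); rewrite ?sqrtr_ge0// => n; apply: fin => //; exact: (h n).1.
Qed.

Let P_le s b b' : b' <= b -> P s b -> P s b'.
Proof.
move=> bb Pb i j /Pb[C C0 h]; exists C => // n; apply: (le_trans (h n)).
by rewrite ler_wpM2l// ler_expR lerN2 ler_wpM2l.
Qed.

Let P0 s : P s 0.
Proof.
move=> i j _; exists (\int[m1]_x `|pw X f i x| * \int[m2]_x `|pw Y g j x|).
  by rewrite mulr_ge0// Rintegral_ge0.
have bd d (T : measurableType d) (mu : {measure set T -> \bar R}) (V h : T -> R) k n :
  measurable_fun setT V ->
  mu.-integrable setT (EFin \o h) -> (forall x, h x != 0 -> 0 <= V x <= M) ->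
  `|lap mu V h k n| <= \int[mu]_x `|pw V h k x|.
  move=> mV hi hM; apply: (le_trans (le_normr_Rintegral measurableT _)).
    exact: integrable_lap.
  apply: le_Rintegral => //.
  - by apply: integrable_norm; exact: integrable_lap.
  - by apply: integrable_norm; exact: integrable_pw.
  - move=> x _; rewrite normrM.
    have [->|hx] := eqVneq (pw V h k x) 0; first by rewrite normr0 mulr0.
    have /andP[x0 _] := hM _ (pw_neq0 hx).
    by rewrite ler_piMl// ger0_norm ?expR_ge0// -[leRHS]expR0 ler_expR oppr_le0 mulr_ge0.
by move=> n; rewrite mulr0 oppr0 expR0 mulr1 normrM ler_pM// bd.
Qed.

(* The best decay rate A_s of all products of derivatives F^(i) G^(j), i + j = s, satisfies
   A_s + min (A_(s+1)) (A_(s+2)) <= 2 A_(s+1), so that it never drops below A_0. *)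
Let P_liouville b0 : 0 <= b0 -> P 0 b0 -> forall s b, b < b0 -> P s b.
Proof.
move=> b00 P0b.
(* The cap at [b0] makes the suprema exist; for s = 0 it is attained. *)
pose S s := [set b | b <= b0 /\ P s b].
have S0 s : S s 0 by split => //; exact: P0.
have hS s : has_sup (S s) by split; [exists 0|exists b0 => x []].
have A0 s : 0 <= sup (S s) by apply: ub_le_sup => //; exact: (hS s).2.
have Ab s : sup (S s) <= b0 by apply: ge_sup; [exists 0|move=> x []].
have PA s b : b < sup (S s) -> P s b.
  move=> /(sup_gt (hS s).1) [c [_ Pc] bc]; exact: P_le (ltW bc) Pc.
have A00 : sup (S 0%N) = b0.
  by apply/eqP; rewrite eq_le Ab/=; apply: ub_le_sup; [exact: (hS _).2|split].
have Ac s : sup (S s) + Num.min (sup (S s.+1)) (sup (S s.+2)) <= 2 * sup (S s.+1).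
  rewrite -ler_pdivrMl// mulrC; apply/ler_addgt0Pr => e e0.
  rewrite -lerBlDr.
  apply: ub_le_sup; first exact: (hS _).2.
  (* The suprema need not be attained, so [P_step] is applied to rates smaller by [e], which lowers
     its conclusion by [e] as well. *)
  have -> : (sup (S s) + Num.min (sup (S s.+1)) (sup (S s.+2))) / 2 - e =
    ((sup (S s) - e) + Num.min (sup (S s.+1) - e) (sup (S s.+2) - e)) / 2.
    by rewrite -addr_minl; field.
  split; last by apply: P_step; apply: PA; rewrite ltrBlDr ltrDl.
  have m : Num.min (sup (S s.+1) - e) (sup (S s.+2) - e) <= sup (S s.+1) - e.
    by rewrite ge_min lexx.
  by have := Ab s; have := Ab s.+1; lra.
move=> s b bb; apply: PA; apply: (lt_le_trans bb).
rewrite -A00; exact: (lower_concave_ge A0 Ac).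
Qed.

(** Since all derivatives keep the rate, every weight X^i Y^j f g has zero integral on X + Y < u +
    v. Applying [vanish_moments] in Y, then in X, localizes to the rectangle X < u, Y < v; it lies
    inside that region wherever the weight lives, and there the integral factorizes. *)
Lemma titchmarsh_laplace (b C : R) : 0 <= b -> 0 <= C ->
  (forall n : nat, `|(\int[m1]_x (expR (- (n%:R * X x)) * f x)) *
     (\int[m2]_x (expR (- (n%:R * Y x)) * g x))| <= C * expR (- (n%:R * b))) ->
  forall u v, u + v < b ->
  (\int[m1]_x ((X x < u)%R%:R * f x)) * (\int[m2]_x ((Y x < v)%R%:R * g x)) = 0.
Proof.
move=> b0 C0 hC u v uvb.
have pw0 T (V h : T -> R) : pw V h 0 = h by apply/funext => x; rewrite /pw expr0 mul1r.
have P0b : P 0 b.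
  move=> i j /eqP; rewrite addn_eq0 => /andP[/eqP -> /eqP ->].
  by exists C => // n; rewrite /lap !pw0.
have van i j : \int[(m1 \x m2)%E]_z ((Z z < u + v)%R%:R * w i j z) = 0.
  by apply: (@decay_vanish i j (u + v)) => //; exact: (P_liouville b0 P0b uvb).
pose w1 i z := (Z z < u + v)%R%:R * w i 0 z.
have iw1 i : (m1 \x m2)%E.-integrable setT (EFin \o w1 i) by exact: integrable_ltr_ind.
have w1_neq0 i z : w1 i z != 0 -> (0 <= X z.1 <= M) && (0 <= Y z.2 <= M).
  by rewrite mulf_eq0 negb_or => /andP[_ /w_neq0].
have van1 i : \int[(m1 \x m2)%E]_z ((Y z.2 < v)%R%:R * w1 i z) = 0.
  apply: (@vanish_moments _ _ _ _ (Y \o snd) (w1 i) M) => //.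
    exact: measurableT_comp.
    by move=> z /w1_neq0 /andP[].
  move=> j; rewrite -[RHS](van i j); apply: eq_Rintegral => z _.
  by rewrite /w1 /w /pw expr0; ring.
pose w2 z := (Y z.2 < v)%R%:R * w1 0%N z.
have iw2 : (m1 \x m2)%E.-integrable setT (EFin \o w2).
  apply: (@integrable_ltr_ind _ _ _ _ (Y \o snd)) => //.
  exact: measurableT_comp.
have van2 : \int[(m1 \x m2)%E]_z ((X z.1 < u)%R%:R * w2 z) = 0.
  apply: (@vanish_moments _ _ _ _ (X \o fst) w2 M) => //.
    exact: measurableT_comp.
    by move=> z; rewrite mulf_eq0 negb_or => /andP[_ /w1_neq0 /andP[]].
  move=> i; rewrite -[RHS](van1 i); apply: eq_Rintegral => z _.
  by rewrite /w2 /w1 /w /pw !expr0; ring.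
rewrite -Rintegral_prod; [|exact: integrable_ltr_ind|exact: integrable_ltr_ind].
rewrite -[RHS]van2; apply: eq_Rintegral => z _.
rewrite /w2 /w1 /w !pw0 /Z.
case: (ltP (X z.1) u) => zu; last by rewrite !mul0r.
case: (ltP (Y z.2) v) => zv; last by rewrite !mul0r !mulr0.
by rewrite ltrD// !mul1r.
Qed.

End titchmarsh.

(** * Square-integrable functions: completeness and a density criterion *)

Section square_integrable.
Context d (T : measurableType d) (R : realType) (mu : {measure set T -> \bar R}).
Implicit Types f g : T -> R.

Definition sqi f := measurable_fun setT f /\
  mu.-integrable setT (EFin \o (fun x => f x ^+ 2)).

Lemma integrable_mulf f g : sqi f -> sqi g ->
  mu.-integrable setT (EFin \o (fun x => f x * g x)).
Proof.
move=> [mf fi] [mg gi]; apply: (@integrable_le _ _ _ _ _ (fun x => f x ^+ 2 + g x ^+ 2)).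
- exact: measurable_funM.
- move=> x; rewrite ler_norml; have := sqr_ge0 (f x - g x); have := sqr_ge0 (f x + g x).
  by have := sqr_ge0 (f x); have := sqr_ge0 (g x); rewrite !expr2; nra.
- exact: integrable_addf.
Qed.

Lemma sqiD f g : sqi f -> sqi g -> sqi (fun x => f x + g x).
Proof.
move=> sf sg; have fg := integrable_mulf sf sg; case: sf => mf fi; case: sg => mg gi.
split; first exact: measurable_funD.
have := integrable_addf (integrable_addf fi gi) (integrableZ 2 fg).
by apply: eq_integrable => // x _ /=; congr EFin; ring.
Qed.

Lemma sqiZ c f : sqi f -> sqi (fun x => c * f x).
Proof.
move=> [mf fi]; split; first exact: measurable_funM.
by have := integrableZ (c ^+ 2) fi; apply: eq_integrable => // x _ /=; rewrite exprMn.
Qed.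

Lemma sqiB f g : sqi f -> sqi g -> sqi (fun x => f x - g x).
Proof.
move=> sf sg; have := sqiD sf (sqiZ (-1) sg).
by congr sqi; apply/funext => x; rewrite mulN1r.
Qed.

Lemma sqi_bounded (M : R) f g : measurable_fun setT f -> (forall x, `|f x| <= M) ->
  sqi g -> sqi (fun x => f x * g x).
Proof.
move=> mf fM [mg gi]; split; first exact: measurable_funM.
have : mu.-integrable setT (EFin \o (fun x => f x ^+ 2 * g x ^+ 2)).
  apply: (@integrable_mul_bounded _ _ _ _ _ _ (M ^+ 2)) => //; first exact: measurable_funX.
  by move=> x; rewrite normrX lerXn2r ?nnegrE// (le_trans _ (fM x)).
by apply: eq_integrable => // x _ /=; rewrite exprMn.
Qed.

Lemma Rintegral_sqr_ge0 f : 0 <= \int[mu]_x (f x ^+ 2).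
Proof. by apply: Rintegral_ge0 => x _; exact: sqr_ge0. Qed.

Lemma Rintegral_sqr_comb (a b : R) f g : sqi f -> sqi g ->
  \int[mu]_x ((a * f x + b * g x) ^+ 2) =
  a ^+ 2 * \int[mu]_x (f x ^+ 2) + 2 * a * b * \int[mu]_x (f x * g x) +
  b ^+ 2 * \int[mu]_x (g x ^+ 2).
Proof.
move=> sf sg; have fg := integrable_mulf sf sg; case: sf => mf fi; case: sg => mg gi.
transitivity (\int[mu]_x (a ^+ 2 * f x ^+ 2 + 2 * a * b * (f x * g x) + b ^+ 2 * g x ^+ 2)).
  by apply: eq_Rintegral => x _; ring.
rewrite RintegralD//; [|exact: integrable_addf (integrableZ _ _) (integrableZ _ _)|exact: integrableZ].
by rewrite RintegralD// ?RintegralZl//; exact: integrableZ.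
Qed.

Lemma cauchy_schwarz f g : sqi f -> sqi g ->
  (\int[mu]_x (f x * g x)) ^+ 2 <= (\int[mu]_x (f x ^+ 2)) * (\int[mu]_x (g x ^+ 2)).
Proof.
move=> sf sg; set A := \int[mu]_x (f x ^+ 2); set C := \int[mu]_x (g x ^+ 2).
set B := \int[mu]_x (f x * g x).
have C0 : 0 <= C by exact: Rintegral_sqr_ge0.
have h a b : 0 <= a ^+ 2 * A + 2 * a * b * B + b ^+ 2 * C.
  by rewrite -Rintegral_sqr_comb//; exact: Rintegral_sqr_ge0.
have [C00|Cn0] := eqVneq C 0.
- have [->|Bn0] := eqVneq B 0; first by rewrite C00 mulr0 expr0n.
  have := h 1 (- (A + 1) / (2 * B)); rewrite C00 mulr0 addr0.
  have -> : 2 * 1 * (- (A + 1) / (2 * B)) * B = - (A + 1) by field.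
  by lra.
- have C1 : 0 < C by rewrite lt_def Cn0.
  have := h C (- B); have -> : C ^+ 2 * A + 2 * C * - B * B + (- B) ^+ 2 * C =
    C * (A * C - B ^+ 2) by ring.
  by rewrite pmulr_rge0// subr_ge0.
Qed.

Lemma cauchy_schwarz_norm f g : sqi f -> sqi g ->
  `|\int[mu]_x (f x * g x)| <=
    Num.sqrt (\int[mu]_x (f x ^+ 2)) * Num.sqrt (\int[mu]_x (g x ^+ 2)).
Proof.
move=> sf sg; rewrite -sqrtrM ?Rintegral_sqr_ge0// -sqrtr_sqr.
by rewrite ler_sqrt ?mulr_ge0 ?Rintegral_sqr_ge0//; exact: cauchy_schwarz.
Qed.

(** Riesz-Fischer argument for a rapidly Cauchy sequence: almost sure convergence of the increments,
    then Fatou's lemma for the rate. *)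
Lemma sqi_complete (e : nat -> T -> R) : (forall n, sqi (e n)) ->
  (forall n m, (n <= m)%N -> \int[mu]_x ((e m x - e n x) ^+ 2) <= 4 ^- n) ->
  exists2 r, sqi r & forall n, \int[mu]_x ((r x - e n x) ^+ 2) <= 4 ^- n.
Proof.
move=> se ce.
pose D k x := e k.+1 x - e k x.
have sD k : sqi (D k) by exact: sqiB.
(* With the weight 2^k the integrals are still summable, being at most 2^k 4^-k = 2^-k, while |D| <=
   2^-k + 2^k D^2 turns finiteness of [G x] into absolute convergence of the increments. *)
pose h k x : R := 2 ^+ k * D k x ^+ 2.
have h0 k x : 0 <= h k x by rewrite mulr_ge0// ?sqr_ge0// exprn_ge0.
have ih k : mu.-integrable setT (EFin \o h k) by apply: integrableZ; exact: (sD k).2.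
pose G x : \bar R := (\sum_(k <oo) (h k x)%:E)%E.
have mG : measurable_fun setT G.
  apply: ge0_emeasurable_sum => [k x _ _|k _]; first by rewrite lee_fin.
  exact: measurable_int (ih k).
have G0 x : (0 <= G x)%E by apply: nneseries_ge0 => k _ _; rewrite lee_fin.
have Goo : (\int[mu]_x G x < +oo)%E.
  rewrite integral_nneseries//; last 2 first.
  - by move=> k; exact: measurable_int (ih k).
  - by move=> k x _; rewrite lee_fin.
  apply: (@le_lt_trans _ _ (2%:E)); last exact: ltry.
  apply: lime_le.
    by apply: is_cvg_nneseries => k _ _; apply: integral_ge0 => x _; rewrite lee_fin.
  apply: nearW => n.
  apply: (@le_trans _ _ (\sum_(0 <= k < n) (2 ^- k)%:E)%E).
    apply: lee_sum => k _; rewrite -EFin_Rintegral// lee_fin.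
    rewrite RintegralZl//; last exact: (sD k).2.
    apply: (@le_trans _ _ (2 ^+ k * 4 ^- k)).
      by rewrite ler_wpM2l ?exprn_ge0//; exact: ce.
    have -> : (4 : R) = 2 * 2 by ring.
    by rewrite exprMn invfM mulrA mulfV ?mul1r// expf_neq0.
  rewrite sumEFin lee_fin.
  suff -> : \sum_(0 <= k < n) 2 ^- k = 2 - 2 * 2 ^- n :> R.
    by rewrite gerBl mulr_ge0// invr_ge0 exprn_ge0.
  elim: n => [|n IH]; first by rewrite big_geq// expr0 invr1 mulr1 subrr.
  by rewrite big_nat_recr//= IH exprS invfM; field; rewrite expf_neq0.
have Gae : {ae mu, forall x, G x \is a fin_num}.
  have : mu.-integrable setT G.
    apply/integrableP; split => //.
    by under eq_integral do rewrite gee0_abs//.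
  move=> /(integrable_ae measurableT); apply: filterS => x; exact.
pose A := [set x | G x \is a fin_num].
have mA : measurable A.
  rewrite (_ : A = setT `&` [set x | (-oo < G x)%E] `&` [set x | (G x < +oo)%E]).
    apply: measurableI.
      exact: emeasurable_fun_o_infty.
    by rewrite -[X in measurable X]setTI; exact: emeasurable_fun_infty_o.
  apply/seteqP; split => x; rewrite /A/= fin_numElt; first by case/andP => -> ->.
  by case=> [[_ ->] ->].
(* Cutting to the full-measure set [A] makes the sequence converge at every point, so that its limit
   is measurable. *)
pose e' n x := \1_A x * e n x.
have me' n : measurable_fun setT (e' n).
  by apply: measurable_funM => //; exact: (se n).1.
have cv x : cvgn (e' ^~ x).
  have [Ax|Ax] := pselect (A x); last first.
    have -> : e' ^~ x = fun _ => 0.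
      by apply/funext => n; rewrite /e' indicE memNset// mul0r.
    exact: is_cvg_cst.
  have -> : e' ^~ x = e ^~ x by apply/funext => n; rewrite /e' indicE mem_set// mul1r.
  have cvD : cvgn (series (D ^~ x)).
    apply: normed_cvg.
    apply: (@series_le_cvg _ _ (fun k => 2^-1 ^+ k + h k x)).
    - by move=> k /=.
    - by move=> k; rewrite addr_ge0// exprn_ge0// invr_ge0.
    - move=> k /=; rewrite /h exprVn; set a : R := 2 ^+ k; set y := D k x.
      have a0 : 0 < a by exact: exprn_gt0.
      have [ya|ya] := leP `|y| a^-1; first by rewrite (le_trans ya)// lerDl mulr_ge0 ?sqr_ge0// ltW.
      rewrite -real_normK ?num_real//; set z := `|y| in ya *.
      have : 1 <= a * z by rewrite -ler_pdivrMl// mulr1 ltW.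
      have : 0 <= a^-1 by rewrite invr_ge0 ltW.
      have : 0 <= z by rewrite /z.
      by rewrite expr2; nra.
    - have -> : series (fun k => 2^-1 ^+ k + h k x) =
         series (geometric 1 2^-1) \+ series (h ^~ x).
        apply/funext => n; rewrite /series/= -big_split/=; apply: eq_bigr => k _.
        by rewrite mul1r.
      apply: is_cvgD.
        apply: is_cvg_geometric_series.
        by rewrite ger0_norm ?invr_ge0// invf_lt1 ?ltr1n.
      apply: nondecreasing_is_cvgn.
        by apply/nondecreasing_seqP => n; rewrite /series/= big_nat_recr//= lerDl.
      exists (fine (G x)) => _ [n _ <-]; rewrite -lee_fin fineK// /series/= -sumEFin.
      by apply: nneseries_lim_ge => k _ _; rewrite lee_fin.
  have -> : e ^~ x = fun n => e 0%N x + series (D ^~ x) n.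
    apply/funext => n; rewrite (_ : D ^~ x = telescope (e ^~ x))//.
    by rewrite telescopeK /= addrC subrK.
  by apply: is_cvgD => //; exact: is_cvg_cst.
pose r x := limn (e' ^~ x).
have cr x : e' n x @[n --> \oo] --> r x by exact: cv.
have mr : measurable_fun setT r by apply: (@measurable_fun_cvg _ _ _ _ e').
have ae_e' n : {ae mu, forall x, e' n x = e n x}.
  by apply: filterS Gae => x Ax; rewrite /e' indicE mem_set// mul1r.
have key n : (\int[mu]_x ((r x - e n x) ^+ 2)%:E <= (4 ^- n)%:E)%E.
  have mn m : measurable_fun setT (fun x => ((e' (m + n)%N x - e n x) ^+ 2)%:E).
    apply/measurable_EFinP; apply: measurable_funX; apply: measurable_funB => //.
    exact: (se n).1.
  have F := @fatou _ _ _ mu setT measurableT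
    (fun m x => ((e' (m + n)%N x - e n x) ^+ 2)%:E) mn _.
  have {}F := F (fun m x _ => _).
  apply: le_trans (le_trans (F _) _).
  - rewrite le_eqVlt; apply/orP; left; apply/eqP; apply: eq_integral => x _.
    have c : ((e' (m + n)%N x - e n x) ^+ 2)%:E @[m --> \oo] --> ((r x - e n x) ^+ 2)%:E.
      apply: cvg_EFin; first exact: nearW.
      have c1 : (e' (m + n)%N x - e n x) @[m --> \oo] --> r x - e n x.
        by apply: cvgB; [move: (cr x); rewrite -(cvg_shiftn n)|exact: cvg_cst].
      by rewrite expr2; under eq_fun do rewrite expr2; exact: cvgM.
    by rewrite is_cvg_limn_einfE; [exact/esym/cvg_lim|apply/cvg_ex; eexists; exact: c].
  - by move=> m x; rewrite lee_fin sqr_ge0.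
  - rewrite limn_einf_lim; apply: lime_le; first exact: is_cvg_einfs.
    apply: nearW => m; apply: ge_ereal_inf; eexists; first by exists m => /=.
    move=> /=.
    rewrite [leLHS](_ : _ = \int[mu]_x ((e (m + n)%N x - e n x) ^+ 2)%:E)%E; last first.
      apply: ge0_ae_eq_integral => //.
      - apply/measurable_EFinP; apply: measurable_funX; apply: measurable_funB.
          exact: (se _).1.
        exact: (se n).1.
      - by move=> x _; rewrite lee_fin sqr_ge0.
      - by move=> x _; rewrite lee_fin sqr_ge0.
      - by apply: filterS (ae_e' (m + n)%N) => x -> _.
    rewrite -EFin_Rintegral ?lee_fin ?ce ?leq_addl//.
    exact: (sqiB (se _) (se _)).2.
have sre n : sqi (fun x => r x - e n x).
  split; first by apply: measurable_funB => //; exact: (se n).1.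
  apply/integrableP; split.
    apply/measurable_EFinP; apply: measurable_funX; apply: measurable_funB => //.
    exact: (se n).1.
  under eq_integral do rewrite gee0_abs ?lee_fin ?sqr_ge0//.
  by apply: le_lt_trans (key n) _; exact: ltry.
exists r.
  have := sqiD (sre 0%N) (se 0%N).
  by congr sqi; apply/funext => x; rewrite subrK.
by move=> n; have := key n; rewrite -EFin_Rintegral ?lee_fin//; exact: (sre n).2.
Qed.

End square_integrable.

Lemma le0_geometric {R : realType} (x K : R) : (forall n, x <= K * 2 ^- n) -> x <= 0.
Proof.
move=> h.
have c : K * 2 ^- n @[n --> \oo] --> K * 0.
  apply: cvgM; first exact: cvg_cst.
  rewrite (_ : (fun n => 2 ^- n) = (fun n => 2^-1 ^+ n)).
    2: by apply/funext => n; rewrite exprVn.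
  apply: cvg_expr.
  by rewrite ger0_norm ?invr_ge0// invf_lt1 ?ltr1n.
rewrite mulr0 in c; rewrite -(cvg_lim _ c)//; apply: limr_ge.
  by apply/cvg_ex; exists 0.
exact: nearW.
Qed.

Lemma exprV4 {R : realType} n : 4 ^- n = (2 ^- n) ^+ 2 :> R.
Proof. by rewrite exprVn -exprM mulnC exprM; congr (_ ^- _); rewrite expr2; ring. Qed.

Section L2_density.
Context d (T : measurableType d) (R : realType) (mu : {measure set T -> \bar R}).
Variables (E : set (T -> R)) (psi : T -> R).
Hypotheses (E0 : E (fun=> 0)) (ED : forall f g, E f -> E g -> E (fun x => f x + g x)).
Hypotheses (EZ : forall c f, E f -> E (fun x => c * f x)).
Hypotheses (Esqi : forall f, E f -> sqi mu f) (spsi : sqi mu psi).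
Hypothesis Eperp : forall r, sqi mu r ->
  (forall e, E e -> \int[mu]_x (r x * e x) = 0) -> \int[mu]_x (r x * psi x) = 0.

(* The difference of [psi] and its orthogonal projection on the closure of [E]
   is orthogonal to [E], hence to [psi] and to itself. *)
Lemma L2_dense (eps : R) : 0 < eps ->
  exists2 e, E e & \int[mu]_x ((psi x - e x) ^+ 2) < eps.
Proof.
move=> eps0.
pose D := [set \int[mu]_x ((psi x - e x) ^+ 2) | e in E].
have D0 : has_inf D.
  split; first by eexists; exists (fun=> 0).
  by exists 0 => _ [e _ <-]; exact: Rintegral_sqr_ge0.
have dD e : E e -> inf D <= \int[mu]_x ((psi x - e x) ^+ 2).
  by move=> Ee; apply: ge_inf; [exact: D0.2|exists e].
(* With slack 4^-n / 4, the parallelogram law gives exactly the bound 4^-n that [sqi_complete] asks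
   for. *)
have ex n : exists e, E e /\ \int[mu]_x ((psi x - e x) ^+ 2) < inf D + 4 ^- n / 4.
  have p : 0 < 4 ^- n / 4 :> R by rewrite divr_gt0// invr_gt0 exprn_gt0.
  by have [_ [e Ee <-] h] := inf_adherent p D0; exists e.
have [e he] := choice ex.
have se n : sqi mu (e n) by apply: Esqi; exact: (he n).1.
pose u n x := psi x - e n x.
have su n : sqi mu (u n) by exact: sqiB.
have cu n m : (n <= m)%N -> \int[mu]_x ((u m x - u n x) ^+ 2) <= 4 ^- n.
  move=> nm.
  have h1 := Rintegral_sqr_comb 1 1 (su m) (su n).
  have h2 := Rintegral_sqr_comb 1 (-1) (su m) (su n).
  have -> : \int[mu]_x ((u m x - u n x) ^+ 2) =
     \int[mu]_x ((1 * u m x + -1 * u n x) ^+ 2).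
    by apply: eq_Rintegral => x _; rewrite mul1r mulN1r.
  have h3 : 4 * inf D <= \int[mu]_x ((1 * u m x + 1 * u n x) ^+ 2).
    have Ee : E (fun x => 2^-1 * (e m x + e n x)).
      by apply: EZ; apply: ED; [exact: (he m).1|exact: (he n).1].
    have := dD _ Ee; rewrite -(ler_pM2l (_ : 0 < 4 :> R))// => h; apply: (le_trans h).
    rewrite -RintegralZl//; last exact: (sqiB spsi (Esqi Ee)).2.
    rewrite le_eqVlt; apply/orP; left; apply/eqP; apply: eq_Rintegral => x _.
    by rewrite /u; field.
  have := (he n).2; have := (he m).2; rewrite -/(u m) -/(u n).
  have : 4 ^- m <= 4 ^- n :> R.
    by rewrite lef_pV2 ?posrE ?exprn_gt0// ler_weXn2l// ler1n.
  rewrite h2; move: h1 h3; rewrite /u.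
  set a := \int[mu]_x ((psi x - e m x) ^+ 2).
  set b := \int[mu]_x ((psi x - e n x) ^+ 2).
  by move=> -> ; rewrite sqrrN !expr1n; lra.
have [r sr hr] := sqi_complete su cu.
have srt n : Num.sqrt (\int[mu]_x ((r x - u n x) ^+ 2)) <= 2 ^- n.
  rewrite -(@ler_pXn2r _ 2)// ?nnegrE ?sqrtr_ge0 ?invr_ge0 ?exprn_ge0//.
  rewrite sqr_sqrtr ?Rintegral_sqr_ge0// (le_trans (hr n))//.
  by rewrite exprV4.
have rE f : E f -> \int[mu]_x (r x * f x) = 0.
  move=> Ef; have sf := Esqi Ef; set Q := \int[mu]_x (f x ^+ 2).
  have Q0 : 0 <= Q by exact: Rintegral_sqr_ge0.
  apply/eqP; rewrite -normr_le0; apply: (@le0_geometric _ _ (1 + Q + Num.sqrt Q)) => n.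
  (* [u n1] nearly minimizes the norm, so perturbing it by t f with t = 2^-n1 and t = - 2^-n1 bounds
     its inner product with f from both sides. *)
  have B n1 : `|\int[mu]_x (u n1 x * f x)| <= 2 ^- n1 * (1 + Q).
    have p2 : 0 < 2 ^- n1 :> R by rewrite invr_gt0 exprn_gt0.
    have h t : 2 * t * \int[mu]_x (u n1 x * f x) <= 4 ^- n1 / 4 + t ^+ 2 * Q.
      have Ee : E (fun x => e n1 x + t * f x).
        by apply: ED; [exact: (he n1).1|exact: EZ].
      have := dD _ Ee.
      rewrite (_ : \int[mu]_x _ = \int[mu]_x ((1 * u n1 x + (- t) * f x) ^+ 2)); last first.
        by apply: eq_Rintegral => x _; rewrite /u; ring.
      rewrite Rintegral_sqr_comb// => h.
      have := (he n1).2; rewrite -/(u n1) => h'.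
      by move: h h'; rewrite expr1n mul1r sqrrN mulr1 -/Q; lra.
    have := h (2 ^- n1); have := h (- 2 ^- n1); rewrite exprV4.
    set y := 2 ^- n1 in p2 *; set I := \int[mu]_x _; rewrite sqrrN => h1 h2.
    rewrite ler_norml; apply/andP; split; rewrite -(ler_pM2l p2); nra.
  have -> : \int[mu]_x (r x * f x) =
      \int[mu]_x (u n x * f x) + \int[mu]_x ((r x - u n x) * f x).
    rewrite -RintegralD//; [|exact: integrable_mulf|].
      by apply: eq_Rintegral => x _; ring.
    by apply: integrable_mulf => //; exact: sqiB.
  apply: (le_trans (ler_normD _ _)).
  have := B n; have := cauchy_schwarz_norm (sqiB sr (su n)) sf; rewrite -/Q.
  have := srt n; have := sqrtr_ge0 Q; set q := Num.sqrt Q; set z := Num.sqrt _.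
  have : 0 <= z by rewrite sqrtr_ge0.
  set y := 2 ^- n; nra.
have r0 : \int[mu]_x (r x ^+ 2) = 0.
  apply/eqP; rewrite eq_le Rintegral_sqr_ge0 andbT.
  set Q := \int[mu]_x (r x ^+ 2); apply: (@le0_geometric _ _ (Num.sqrt Q)) => n.
  (* [u n] is the difference of [psi] and an element of [E], both orthogonal to [r]. *)
  have eQ : Q = \int[mu]_x (r x * (r x - u n x)).
    transitivity (\int[mu]_x (r x * (r x - u n x)) +
       (\int[mu]_x (r x * psi x) - \int[mu]_x (r x * e n x))).
      rewrite -RintegralB//; [|exact: integrable_mulf..].
      rewrite -RintegralD//; last 2 first.
      - by apply: integrable_mulf => //; exact: sqiB.
      - by apply: integrable_subf; exact: integrable_mulf.
      by apply: eq_Rintegral => x _; rewrite /u; ring.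
    by rewrite (Eperp sr rE) (rE (e n)) ?subr0 ?addr0//; exact: (he n).1.
  rewrite [leLHS]eQ.
  apply: (le_trans (ler_norm _)); apply: (le_trans (cauchy_schwarz_norm sr (sqiB sr (su n)))).
  by rewrite ler_wpM2l ?sqrtr_ge0.
have [n hn] : exists n : nat, 4 ^- n < eps.
  exists (Num.truncn eps^-1).+1; rewrite -[ltRHS]invrK ltf_pV2 ?posrE ?invr_gt0 ?exprn_gt0//.
  have /andP[_] : (Num.truncn eps^-1)%:R <= eps^-1 < (Num.truncn eps^-1).+1%:R.
    by apply: truncn_itv; rewrite invr_ge0 ltW.
  move/lt_le_trans; apply; rewrite -natrX ler_nat ltnW// ltn_expl//.
exists (e n); first exact: (he n).1.
apply: le_lt_trans hn; apply: le_trans (hr n).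
have := Rintegral_sqr_comb 1 (-1) sr (su n).
have := cauchy_schwarz_norm sr (su n); rewrite r0 sqrtr0 mul0r normr_le0 => /eqP ->.
rewrite !mulr0 !add0r sqrrN expr1n mul1r => <-.
by rewrite le_eqVlt; apply/orP; left; apply/eqP; apply: eq_Rintegral => x _; ring.
Qed.

End L2_density.

(** * Lebesgue integrals under reflection and translation; indicators of intervals *)

Section reflection.
Context {R : realType}.
Notation leb := (@lebesgue_measure R).

Lemma lebesgue_measure_reflect (c : R) (A : set R) : measurable A ->
  leb ((fun x => c - x) @^-1` A) = leb A.
Proof.
move=> mA.
have mc : measurable_fun setT (fun x : measurableTypeR R => c - x : measurableTypeR R).
  exact: measurable_funB.
pose f : {mfun measurableTypeR R >-> measurableTypeR R} :=
  HB.pack (fun x : measurableTypeR R => c - x : measurableTypeR R)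
    (isMeasurableFun.Build _ _ _ _ _ mc).
apply/esym; apply: (@lebesgue_measure_unique _ (pushforward leb f)) => //.
move=> _ [[a b]] _ <-.
rewrite [RHS](_ : _ = leb `[c - b, c - a[%classic); last first.
  rewrite /pushforward; congr (leb _).
  by apply/seteqP; split => x /=; rewrite !in_itv/= => /andP[h1 h2]; apply/andP; split; lra.
rewrite !lebesgue_measure_itv/= !lte_fin ltrD2l ltrN2.
by case: ifP => // _; congr EFin; ring.
Qed.

Lemma ge0_integral_reflect (c : R) (h : R -> \bar R) : measurable_fun setT h ->
  (forall x, (0 <= h x)%E) ->
  (\int[leb]_x h (c - x)%R = \int[leb]_x h x)%E.
Proof.
move=> mh h0.
have mc : measurable_fun setT (fun x : measurableTypeR R => c - x : measurableTypeR R).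
  exact: measurable_funB.
have := @ge0_integral_pushforward _ _ _ _ R _ mc leb setT h measurableT mh (fun x _ => h0 x).
rewrite preimage_setT => <-; apply: eq_measure_integral => A mA _.
exact: lebesgue_measure_reflect.
Qed.

Lemma integral_reflect (c : R) (h : R -> \bar R) : measurable_fun setT h ->
  (\int[leb]_x h (c - x)%R = \int[leb]_x h x)%E.
Proof.
move=> mh; rewrite integralE [RHS]integralE; congr (_ - _)%E.
  have H := ge0_integral_reflect c (measurable_funepos mh) (funepos_ge0 h).
  by rewrite -H; apply: eq_integral => x _; rewrite !funeposE.
have H := ge0_integral_reflect c (measurable_funeneg mh) (funeneg_ge0 h).
by rewrite -H; apply: eq_integral => x _; rewrite !funenegE.
Qed.

Lemma Rintegral_reflect (c : R) (h : R -> R) : measurable_fun setT h ->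
  \int[leb]_x h (c - x)%R = \int[leb]_x h x.
Proof.
move=> mh; rewrite /Rintegral.
by rewrite (integral_reflect c (h := EFin \o h))//; exact/measurable_EFinP.
Qed.

(** A translation is the composite of two reflections. *)
Lemma integral_translate (c : R) (h : R -> \bar R) : measurable_fun setT h ->
  (\int[leb]_x h (x - c)%R = \int[leb]_x h x)%E.
Proof.
move=> mh; rewrite -(integral_reflect 0 mh).
have mN : measurable_fun setT (fun x : R => h (0 - x)).
  by apply: measurableT_comp => //; exact: measurable_funB.
rewrite -[RHS](integral_reflect c mN); apply: eq_integral => x _.
by congr h; ring.
Qed.

Lemma Rintegral_translate (c : R) (h : R -> R) : measurable_fun setT h ->
  \int[leb]_x h (x - c)%R = \int[leb]_x h x.
Proof.
move=> mh; rewrite /Rintegral.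
by rewrite (integral_translate c (h := EFin \o h))//; exact/measurable_EFinP.
Qed.

Lemma integrable_reflect (c : R) (h : R -> R) : leb.-integrable setT (EFin \o h) ->
  leb.-integrable setT (EFin \o (fun x => h (c - x))).
Proof.
move=> hi; have mh := measurable_integrable hi.
have mr : measurable_fun setT (fun x : R => h (c - x)).
  by apply: measurableT_comp => //; exact: measurable_funB.
apply/integrableP; split; first exact/measurable_EFinP.
rewrite (integral_reflect c (h := fun x => `|(h x)%:E|%E)); last first.
  by apply: measurableT_comp => //; exact/measurable_EFinP.
by case/integrableP : hi.
Qed.

Lemma integrable_translate (c : R) (h : R -> R) : leb.-integrable setT (EFin \o h) ->
  leb.-integrable setT (EFin \o (fun x => h (x - c))).
Proof.
move=> hi; have := integrable_reflect c (integrable_reflect 0 hi).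
by apply: eq_integrable => // x _ /=; congr (h _)%:E; ring.
Qed.

End reflection.

Section interval_indicators.
Context {R : realType}.
Notation leb := (@lebesgue_measure R).

Lemma measurable_itvind (a b : R) : measurable_fun setT (fun x : R => (a <= x <= b)%R%:R : R).
Proof.
have -> : (fun x : R => (a <= x <= b)%R%:R) = (\1_`[a, b]%classic : R -> R).
  apply/funext => x; rewrite indicE; congr ((nat_of_bool _)%:R : R).
  by apply/idP/idP; rewrite in_setE/= in_itv.
exact: measurable_indic.
Qed.

Lemma normr_bool_le1 (b : bool) : `|b%:R : R| <= 1.
Proof. by case: b; rewrite ?normr1 ?normr0. Qed.

Lemma measurable_ocind (a b : R) : measurable_fun setT (fun v : R => (a < v <= b)%R%:R : R).
Proof.
have -> : (fun x : R => (a < x <= b)%R%:R) = (\1_`]a, b]%classic : R -> R).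
  apply/funext => x; rewrite indicE; congr ((nat_of_bool _)%:R : R).
  by apply/idP/idP; rewrite in_setE/= in_itv.
exact: measurable_indic.
Qed.

Lemma measurable_ltind (t : R) : measurable_fun setT (fun x : R => (x < t)%R%:R : R).
Proof. exact: (@measurable_ltr_ind _ _ _ id). Qed.

Lemma integrable_ltind_mul (t : R) (f : R -> R) : leb.-integrable setT (EFin \o f) ->
  leb.-integrable setT (EFin \o (fun x => (x < t)%R%:R * f x)).
Proof. by move=> fi; apply: (@integrable_ltr_ind R _ (measurableTypeR R) leb id f). Qed.

Lemma integrable_itvind (a b : R) :
  leb.-integrable setT (EFin \o (fun x : R => (a <= x <= b)%R%:R)).
Proof.
have := @integrable_indic_itv R a b true false.
apply: eq_integrable => // x _ /=; rewrite indicE; congr ((nat_of_bool _)%:R%:E : \bar R).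
by apply/idP/idP; rewrite in_setE/= in_itv.
Qed.

Lemma sqi_itvind (a b : R) : sqi leb (fun x : R => (a <= x <= b)%R%:R).
Proof.
split; first exact: measurable_itvind.
apply: eq_integrable (integrable_itvind a b) => // x _ /=.
by case: (a <= x <= b); rewrite ?expr1n ?expr0n.
Qed.

End interval_indicators.

(** * L2 density of the translates of a function that does not vanish near 0 *)

Section volterra.
Context {R : realType}.
Notation leb := (@lebesgue_measure R).
Variables (L : R) (g : R -> R).
Hypothesis L0 : 0 <= L.
Hypothesis g0 : forall x, x <= 0 -> g x = 0.

Let ind (x : R) : R := (0 <= x <= L)%R%:R.

Hypothesis sg : sqi leb (fun x => ind x * g x).

Lemma sqi_integrable_itv (a b : R) f : sqi leb f ->
  leb.-integrable setT (EFin \o (fun x => (a <= x <= b)%R%:R * f x)).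
Proof. by move=> sf; apply: integrable_mulf => //; exact: sqi_itvind. Qed.

(** Truncation to [0,L] makes [g] integrable on the line; at points v <= L the translates by s >= 0
    see only this truncation. *)
Let gL x := ind x * g x.

Let igL : leb.-integrable setT (EFin \o gL).
Proof.
have := sqi_integrable_itv 0 L sg; apply: eq_integrable => // x _ /=.
by rewrite /gL /ind; case: (0 <= x <= L); rewrite ?mul1r ?mul0r.
Qed.

Let mgL : measurable_fun setT gL := measurable_integrable igL.

Let gLE x : x <= L -> gL x = g x.
Proof.
move=> xL; rewrite /gL /ind xL andbT; case: (leP 0 x) => x0; first by rewrite mul1r.
by rewrite mul0r g0// ltW.
Qed.

Let sqi_shift s : 0 <= s -> sqi leb (fun v => ind v * g (v - s)).
Proof.
move=> s0.
have mgs : measurable_fun setT (fun v : R => gL (v - s)).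
  by apply: measurableT_comp => //; exact: measurable_funB.
have : sqi leb (fun v => ind v * gL (v - s)).
  apply: (@sqi_bounded _ _ _ _ 1).
  - exact: measurable_itvind.
  - by move=> x; rewrite /ind; case: (_ && _); rewrite ?normr1 ?normr0.
  - split => //; exact: (integrable_translate s sg.2).
congr sqi; apply/funext => v; rewrite /ind.
case: (boolP (0 <= v <= L)) => [/andP[_ vL]|_]; last by rewrite !mul0r.
by rewrite gLE// (le_trans _ vL)// gerBl.
Qed.

Let comb (l : seq (R * R)) (v : R) : R := \sum_(p <- l) p.1 * g (v - p.2).

Lemma sqi_translates (l : seq (R * R)) : all (fun p => 0 < p.2) l ->
  sqi leb (fun v => (0 <= v <= L)%R%:R * \sum_(p <- l) p.1 * g (v - p.2)).
Proof.
elim: l => [_|[c s] l IH /= /andP[s0 /IH h]].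
  have := sqiZ 0 sg.
  by congr sqi; apply/funext => x; rewrite big_nil mulr0 mul0r.
have := sqiD (sqiZ c (sqi_shift (ltW s0))) h.
by congr sqi; apply/funext => v; rewrite big_cons/= /ind; ring.
Qed.

Hypothesis g_nondeg : forall d, 0 < d -> exists2 u, 0 < u < d &
  \int[leb]_x ((x < u)%R%:R * g x) != 0.

Section annihilator.
Variable r : R -> R.
Hypothesis sr : sqi leb r.
Hypothesis r_perp : forall s, 0 < s -> \int[leb]_v (r v * (ind v * g (v - s))) = 0.

Let r1 v := ind v * r v.
Let ir1 : leb.-integrable setT (EFin \o r1) := sqi_integrable_itv 0 L sr.
Let mr1 : measurable_fun setT r1 := measurable_integrable ir1.
Let r1_neq0 v : r1 v != 0 -> 0 <= v <= L.
Proof. by rewrite /r1 /ind; case: (0 <= v <= L); rewrite ?mul0r ?eqxx. Qed.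
Let gL_neq0 v : gL v != 0 -> 0 <= v <= L.
Proof. by rewrite /gL /ind; case: (0 <= v <= L); rewrite ?mul0r ?eqxx. Qed.

Section exponent.
Variable n : nat.
Let J (z : R * R) : R := gL z.2 * r1 z.1.
Let iJ : (leb \x leb)%E.-integrable setT (EFin \o J).
Proof.
have := integrable_prod ir1 igL.
by apply: eq_integrable => // z _ /=; rewrite /J mulrC.
Qed.
Let K (z : R * R) : R := expR (n%:R * (z.1 - z.2)) * J z.
Let lt12 (z : R * R) : R := (z.2 < z.1)%R%:R.

Let mlt12 : measurable_fun setT lt12.
Proof.
have := @measurable_ltr_ind R _ _ (fun z : R * R => z.2 - z.1) _ 0.
move=> H; have {}H := H (measurable_funB (@measurable_snd _ _ _ _) (@measurable_fst _ _ _ _)).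
by apply: eq_measurable_fun H => z _; rewrite subr_lt0.
Qed.

Let mexp : measurable_fun setT (fun z : R * R => expR (n%:R * (z.1 - z.2))).
Proof.
apply: measurableT_comp => //; apply: measurable_funM => //.
exact: (measurable_funB (@measurable_fst _ _ _ _) (@measurable_snd _ _ _ _)).
Qed.

Let iK : (leb \x leb)%E.-integrable setT (EFin \o K).
Proof.
apply: (integrable_le _ _ (integrableZ (expR (n%:R * L)) (integrable_norm iJ))).
- by apply: measurable_funM => //; exact: measurable_integrable iJ.
- move=> z; rewrite /K normrM /=; have [->|] := eqVneq (J z) 0; first by rewrite normr0 !mulr0.
  rewrite /J mulf_eq0 negb_or => /andP[/gL_neq0 /andP[z2 _] /r1_neq0 /andP[_ z1]].
  by rewrite ler_wpM2r// ger0_norm ?expR_ge0// ler_expR ler_wpM2l// lerBlDr (le_trans z1)// lerDl.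
Qed.

Let ilK : (leb \x leb)%E.-integrable setT (EFin \o (fun z => lt12 z * K z)).
Proof.
apply: (@integrable_mul_bounded _ _ _ _ _ _ 1) => //.
by move=> z; rewrite /lt12; case: ltP => _; rewrite ?normr1 ?normr0.
Qed.

Let mlK : measurable_fun setT (fun z => lt12 z * K z) := measurable_integrable ilK.

(** The integrand of the lower triangle in the variables (v, s) with x = v - s. *)
Let H (z : R * R) : R := lt12 (z.1, z.1 - z.2) * K (z.1, z.1 - z.2).

Let mH : measurable_fun setT H.
Proof.
have : measurable_fun setT (fun z : R * R => (z.1, z.1 - z.2) : R * R).
  apply: measurable_fun_pair => //.
  exact: (measurable_funB (@measurable_fst _ _ _ _) (@measurable_snd _ _ _ _)).
by move=> h; exact: (measurableT_comp mlK h).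
Qed.

Let mslice (F : R * R -> R) (v : R) : measurable_fun setT F ->
  measurable_fun setT (fun x : R => F (v, x)).
Proof.
move=> mF; apply: (measurableT_comp mF).
by apply: measurable_fun_pair => //; exact: measurable_cst.
Qed.

Let iH : (leb \x leb)%E.-integrable setT (EFin \o H).
Proof.
apply/integrable12ltyP; first exact/measurable_EFinP.
have /integrableP[mlK' _] := ilK.
have /(integrable12ltyP leb leb mlK') := ilK.
apply: le_lt_trans; rewrite le_eqVlt; apply/orP; left; apply/eqP.
apply: eq_integral => v _.
rewrite -[RHS](integral_reflect v)//.
apply: measurableT_comp => //; apply/measurable_EFinP.
exact: (mslice v mlK).
Qed.

(** After the substitution x = v - s, Fubini leaves for each s > 0 the factor exp(ns) times the
    pairing of [r] with the translate of [g] by s, which is zero. *)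
Let lower0 : \int[(leb \x leb)%E]_z (lt12 z * K z) = 0.
Proof.
rewrite /Rintegral -(integral12_prod_meas1 ilK) /fubini_F/=.
transitivity (fine (\int[leb]_v \int[leb]_s (H (v, s))%:E)%E).
  congr fine; apply: eq_integral => v _.
  rewrite -[LHS](integral_reflect v)//; apply/measurable_EFinP.
  exact: (mslice v mlK).
rewrite (integral12_prod_meas1 iH) -(integral21_prod_meas1 iH) /fubini_G/=.
rewrite (_ : (\int[leb]_y _)%E = 0%E)//; apply: integral0_eq => s _.
have [s0|s0] := ltP 0 s; last first.
  apply: integral0_eq => v _; rewrite /H /lt12/=.
  by rewrite ltNge lerBrDl gerDr s0/= mul0r.
transitivity ((expR (n%:R * s) * \int[leb]_v (r v * (ind v * g (v - s))))%:E); last first.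
  by rewrite r_perp// mulr0.
rewrite -RintegralZl//; last by apply: integrable_mulf => //; apply: sqi_shift; exact: ltW.
rewrite EFin_Rintegral; last first.
  by apply: integrableZ; apply: integrable_mulf => //; apply: sqi_shift; exact: ltW.
apply: eq_integral => v _; congr EFin; rewrite /H /lt12 /K /J/= ltrBlDr ltrDl s0 mul1r.
rewrite subKr /r1 /ind; case: (boolP (0 <= v <= L)) => [/andP[_ vL]|_]; last first.
  by rewrite !mul0r !mulr0.
by rewrite gLE ?(le_trans _ vL) ?gerBl ?(ltW s0)//; ring.
Qed.

(** The product is the double integral of exp(n(v - x)) g(x) r(v). The part x < v is zero by
    [lower0], and on x >= v the exponential is at most 1, so the bound is the same for every n. *)
Lemma laplace_gL_r1 : `|\int[leb]_x (expR (- (n%:R * x)) * gL x) *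
    \int[leb]_v (expR (n%:R * v) * r1 v)| <=
  \int[(leb \x leb)%E]_z `|J z|.
Proof.
have i1 : leb.-integrable setT (EFin \o (fun v => expR (n%:R * v) * r1 v)).
  apply: (integrable_le _ _ (integrableZ (expR (n%:R * L)) (integrable_norm ir1))).
  - by apply: measurable_funM => //; apply: measurableT_comp => //; exact: measurable_funM.
  - move=> z; rewrite normrM /=; have [->|] := eqVneq (r1 z) 0; first by rewrite normr0 !mulr0.
    move=> /r1_neq0 /andP[_ zL]; rewrite ler_wpM2r// ger0_norm ?expR_ge0//.
    by rewrite ler_expR ler_wpM2l.
have i2 : leb.-integrable setT (EFin \o (fun v => expR (- (n%:R * v)) * gL v)).
  apply: (integrable_le _ _ (integrable_norm igL)).
  - apply: measurable_funM => //; apply: measurableT_comp => //.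
    by apply: measurableT_comp => //; exact: measurable_funM.
  - move=> z; rewrite normrM /=; have [->|] := eqVneq (gL z) 0; first by rewrite normr0 !mulr0.
    move=> /gL_neq0 /andP[z0 _]; rewrite ler_piMl// ger0_norm ?expR_ge0//.
    by rewrite -[leRHS]expR0 ler_expR oppr_le0 mulr_ge0.
rewrite mulrC -(Rintegral_prod i1 i2).
have -> : \int[(leb \x leb)%E]_z (expR (n%:R * z.1) * r1 z.1 * (expR (- (n%:R * z.2)) * gL z.2)) =
    \int[(leb \x leb)%E]_z (K z - lt12 z * K z).
  rewrite RintegralB// lower0 subr0; apply: eq_Rintegral => z _.
  by rewrite /K /J mulrBr expRD; ring.
apply: (le_trans (le_normr_Rintegral measurableT _)); first exact: integrable_subf.
apply: le_Rintegral => //.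
- by apply: integrable_norm; exact: integrable_subf.
- exact: integrable_norm.
- move=> z _; rewrite /K /lt12; case: ltP => h; first by rewrite mul1r subrr normr0.
  rewrite mul0r subr0 normrM ler_piMl// ger0_norm ?expR_ge0//.
  by rewrite -[leRHS]expR0 ler_expR mulr_ge0_le0// subr_le0.
Qed.

End exponent.

Let rt (y : R) : R := r1 (L - y).

Let irt : leb.-integrable setT (EFin \o rt) := integrable_reflect L ir1.

(** Replacing [r1] by its reflection y -> L - y multiplies the transform by exp(-nL), so the uniform
    bound of [laplace_gL_r1] becomes decay at rate L. Titchmarsh's theorem applies to u + v < L;
    with u in (0, L - v) taken from [g_nondeg], the factor of [g] is nonzero and that of [rt] must
    vanish. *)
Lemma annihilator_reflect_lt v : v < L -> \int[leb]_y ((y < v)%R%:R * rt y) = 0.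
Proof.
move=> vL.
have rtM x : rt x != 0 -> 0 <= x <= L by move=> /r1_neq0 /andP[? ?]; apply/andP; split; lra.
have [v0|v0] := leP v 0.
  transitivity (\int[leb]_y (0 : R)); last by rewrite Rintegral_cst// mul0r.
  apply: eq_Rintegral => y _; case: ltP => yv; last by rewrite mul0r.
  have [->|/rtM /andP[y0 _]] := eqVneq (rt y) 0; first by rewrite mulr0.
  by move: (lt_le_trans yv v0); rewrite ltNge y0.
have Lv : 0 < L - v by rewrite subr_gt0.
have [u /andP[u0 uv] gu] := g_nondeg Lv.
pose C := \int[(leb \x leb)%E]_z `|gL z.2 * r1 z.1|.
have C0 : 0 <= C by exact: Rintegral_ge0.
have bd (n : nat) : `|(\int[leb]_x (expR (- (n%:R * id x)) * gL x)) *
     (\int[leb]_x (expR (- (n%:R * id x)) * rt x))| <= C * expR (- (n%:R * L)).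
  have -> : \int[leb]_x (expR (- (n%:R * id x)) * rt x) =
      expR (- (n%:R * L)) * \int[leb]_v (expR (n%:R * v) * r1 v).
    rewrite -RintegralZl//; last first.
      apply: (integrable_le _ _ (integrableZ (expR (n%:R * L)) (integrable_norm ir1))).
      - by apply: measurable_funM => //; apply: measurableT_comp => //; exact: measurable_funM.
      - move=> z; rewrite normrM /=; have [->|] := eqVneq (r1 z) 0; first by rewrite normr0 !mulr0.
        move=> /r1_neq0 /andP[_ zL]; rewrite ler_wpM2r// ger0_norm ?expR_ge0//.
        by rewrite ler_expR ler_wpM2l.
    rewrite -[RHS](Rintegral_reflect L).
      apply: eq_Rintegral => x _; rewrite /rt mulrA -expRD /=.
      by congr (expR _ * _); ring.
    apply: measurable_funM; first exact: measurable_cst.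
    by apply: measurable_funM => //; apply: measurableT_comp => //; exact: measurable_funM.
  rewrite mulrCA normrM mulrC (ger0_norm (expR_ge0 _)) ler_wpM2r ?expR_ge0//.
  exact: laplace_gL_r1.
have uvL : u + v < L by rewrite addrC -ltrBrDl.
have mid : measurable_fun setT (id : measurableTypeR R -> R) by [].
have := titchmarsh_laplace mid mid igL irt gL_neq0 rtM L0 C0 bd uvL.
move/eqP; rewrite mulf_eq0 => /orP[|/eqP//].
rewrite (_ : \int[leb]_x (_ * gL x) = \int[leb]_x ((x < u)%R%:R * g x)); last first.
  apply: eq_Rintegral => x _ /=; case: ltP => xu; last by rewrite !mul0r.
  by rewrite gLE//; apply: ltW; apply: (lt_trans xu); lra.
by rewrite (negbTE gu).
Qed.

Lemma annihilator_reflect v : v <= L -> \int[leb]_y ((y < v)%R%:R * rt y) = 0.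
Proof.
move=> vL.
have : \int[leb]_y ((y < v - harmonic n)%R%:R * rt y) @[n --> \oo] -->
   \int[leb]_y ((y < v)%R%:R * rt y).
  apply: (Rintegral_dct _ _ _ (integrable_norm irt)).
  - move=> n; apply: measurable_funM; first exact: measurable_ltind.
    exact: measurable_integrable irt.
  - by apply: measurable_funM; [exact: measurable_ltind|exact: measurable_integrable irt].
  - move=> y; apply: cvgM; last exact: cvg_cst.
    case: (ltP y v) => yv; last first.
      apply: cvg_near_cst; apply: nearW => n.
      by rewrite ltNge (le_trans _ yv)// gerBl invr_ge0.
    apply: cvg_near_cst; near=> n.
    have : harmonic n < v - y.
      near: n; have /cvgrPdist_lt/(_ (v - y)) := @cvg_harmonic R.
      rewrite subr_gt0 => /(_ yv); apply: filterS => n.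
      by rewrite sub0r normrN ger0_norm// invr_ge0.
    by move=> h; rewrite (_ : y < _) //; lra.
  - move=> n y; rewrite normrM ler_piMl//.
    by case: (_ < _); rewrite ?normr1 ?normr0.
under eq_fun => n.
  rewrite annihilator_reflect_lt; last first.
    by rewrite (lt_le_trans _ vL)// ltrBlDr ltrDl invr_gt0.
  over.
by move=> /cvg_lim <-//; rewrite lim_cst.
Unshelve. all: end_near. Qed.

End annihilator.

(** A function orthogonal to all translates has zero integral over (a,b] by [annihilator_reflect],
    and this is what the criterion [L2_dense] requires of the indicator. *)
Lemma volterra_L2_dense (a b eps : R) : 0 <= a -> a <= b -> b <= L -> 0 < eps ->
  exists2 l, all (fun p => 0 < p.2) l &
  \int[leb]_v (((0 <= v <= L)%R%:R *
    ((a < v <= b)%R%:R - \sum_(p <- l) p.1 * g (v - p.2))) ^+ 2) < eps.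
Proof.
move=> a0 ab bL eps0.
pose E := [set e : R -> R | exists2 l, all (fun p => 0 < p.2) l & e = fun v => ind v * comb l v].
pose psi v : R := ind v * (a < v <= b)%R%:R.
have mab := measurable_ocind a b.
have spsi : sqi leb psi.
  have := @sqi_bounded _ _ _ leb 1 _ _ mab _ (sqi_itvind 0 L).
  move=> H; have {}H := H (fun x => _).
  have : sqi leb (fun x : R => (a < x <= b)%R%:R * (0 <= x <= L)%R%:R).
    by apply: H => x; case: (_ && _); rewrite ?normr1 ?normr0.
  by congr sqi; apply/funext => x; rewrite mulrC.
have [|||||e [l ls ->] h] := @L2_dense _ _ _ leb E psi _ _ _ _ spsi _ eps eps0.
- by exists [::] => //; apply/funext => v; rewrite /comb big_nil mulr0.
- move=> _ _ [l1 h1 ->] [l2 h2 ->]; exists (l1 ++ l2); first by rewrite all_cat h1.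
  by apply/funext => v; rewrite /comb big_cat/= mulrDr.
- move=> c _ [l h ->]; exists [seq (c * p.1, p.2) | p <- l].
    by rewrite all_map; apply: sub_all h => -[].
  apply/funext => v; rewrite /comb big_map mulrCA mulr_sumr; congr (_ * _).
  by apply: eq_bigr => p _; rewrite mulrA.
- by move=> _ [l h ->]; exact: sqi_translates.
- move=> r sr rE.
  have rp s : 0 < s -> \int[leb]_v (r v * (ind v * g (v - s))) = 0.
    move=> s0; rewrite -[RHS](rE (fun v => ind v * comb [:: (1, s)] v)); last first.
      by exists [:: (1, s)] => //=; rewrite s0.
    by apply: eq_Rintegral => v _; rewrite /comb big_seq1/= mul1r.
  have ir1 := sqi_integrable_itv 0 L sr; have mr1 := measurable_integrable ir1.
  have ann := annihilator_reflect sr rp.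
  transitivity (\int[leb]_y ((y < L - a)%R%:R * (ind (L - y) * r (L - y))) -
     \int[leb]_y ((y < L - b)%R%:R * (ind (L - y) * r (L - y)))); last first.
    by rewrite !ann ?subrr// gerBl// (le_trans a0).
  have irt := integrable_reflect L ir1.
  have ii u : leb.-integrable setT (EFin \o
      (fun y => (y < u)%R%:R * (ind (L - y) * r (L - y)))).
    apply: (@integrable_mul_bounded _ _ _ _ _ _ 1) => //; first exact: measurable_ltind.
    by move=> x; case: (_ < _); rewrite ?normr1 ?normr0.
  rewrite -RintegralB// -[LHS](Rintegral_reflect L).
    apply: eq_Rintegral => y _; rewrite -mulrBl /psi.
    have -> : (a < L - y <= b) = (y < L - a) && ~~ (y < L - b).
      by rewrite -leNgt; apply/andP/andP => -[h1 h2]; split; lra.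
    case: (boolP (y < L - b)) => h1; last by rewrite subr0 andbT; ring.
    have -> : y < L - a by lra.
    by rewrite /= subrr; ring.
  by apply: measurable_funM; [exact: sr.1|exact: spsi.1].
exists l => //; apply: le_lt_trans h; rewrite le_eqVlt; apply/orP; left; apply/eqP.
by apply: eq_Rintegral => v _; rewrite -mulrBr.
Qed.

End volterra.

(** * Uniform approximation of continuous paths by sums of translated primitives *)

Lemma Rintegral_sum_in d (T : measurableType d) (R : realType)
    (mu : {measure set T -> \bar R}) (I : eqType) (s : seq I) (h : I -> T -> R) :
  (forall i, i \in s -> mu.-integrable setT (EFin \o h i)) ->
  mu.-integrable setT (EFin \o (fun x => \sum_(i <- s) h i x)) /\
  \int[mu]_x (\sum_(i <- s) h i x) = \sum_(i <- s) \int[mu]_x h i x.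
Proof.
move=> hi; pose k i x := if i \in s then h i x else 0.
have ki i : mu.-integrable setT (EFin \o k i).
  rewrite /k; case: (boolP (i \in s)) => [/hi//|_].
  exact: integrable0.
have e x : \sum_(i <- s) h i x = \sum_(i <- s) k i x.
  by apply: eq_big_seq => i si; rewrite /k si.
split; first by apply: eq_integrable (integrable_sumf s ki) => // x _ /=; rewrite e.
under eq_Rintegral do rewrite e.
rewrite Rintegral_sum//; apply: eq_big_seq => i si.
by apply: eq_Rintegral => x _; rewrite /k si.
Qed.

Lemma uniformly_continuous_itv {R : realType} (a b : R) (f : R -> R) (eps : R) :
  {within [set v | a <= v <= b], continuous f} -> 0 < eps ->
  exists n : nat, forall x y, a <= x <= b -> a <= y <= b -> `|x - y| <= n.+1%:R^-1 ->
    `|f x - f y| <= eps.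
Proof.
move=> /subspace_continuousP cf eps0.
have /near_covering_withinP cK : near_covering [set v | a <= v <= b].
  apply/compact_near_coveringP; rewrite (_ : mkset _ = `[a, b]%classic).
    exact: segment_compact.
  by apply/seteqP; split => x /=; rewrite in_itv.
have [|n _ hn] := cK _ \oo (fun (n : nat) x => forall y, a <= y <= b -> `|x - y| <= n.+1%:R^-1 ->
    `|f x - f y| <= eps) _.
  move=> x Kx.
  have /cvgrPdist_lt/(_ _ (divr_gt0 eps0 (ltr0n R 2))) := cf x Kx.
  rewrite /within/= => /nbhs_ballP[e /= e0 he].
  have e20 : 0 < e / 2 by rewrite divr_gt0.
  exists (ball x (e / 2), [set n | n.+1%:R^-1 < e / 2]).
    split => /=; first exact: nbhsx_ballx.
    have /cvgrPdist_lt/(_ _ e20) := @cvg_harmonic R; apply: filterS => n.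
    by rewrite /= sub0r normrN ger0_norm// invr_ge0.
  move=> [x' n] /= [bx hn] Kx' y Ky x'y.
  have h1 : `|f x - f x'| < eps / 2.
    apply: he => //; rewrite /ball/= in bx *; apply: (lt_trans bx); lra.
  have h2 : `|f x - f y| < eps / 2.
    apply: he => //; rewrite /ball/= in bx *.
    rewrite (_ : x - y = (x - x') + (x' - y)); last by ring.
    rewrite (le_lt_trans (ler_normD _ _))// (splitr e) ltrD// (le_lt_trans x'y)//.
  rewrite (_ : f x' - f y = (f x - f y) - (f x - f x')); last by ring.
  by rewrite (le_trans (ler_normB _ _))// (splitr eps) lerD// ltW.
exists n => x y Kx Ky xy.
exact: (hn n (leqnn _) x Kx y Ky xy).
Qed.

Section ramps.
Context {R : realType}.
Notation leb := (@lebesgue_measure R).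

Definition ramp (a b v : R) : R := Num.min (Num.max v a) b - a.

Lemma Rintegral_ramp (a b v : R) : a <= b ->
  \int[leb]_x ((x < v)%R%:R * (a < x <= b)%R%:R) = ramp a b v.
Proof.
move=> ab.
rewrite (_ : \int[leb]_x _ = \int[leb]_x (\1_(`]a, b] `&` `]-oo, v[) x)); last first.
  apply: eq_Rintegral => x _; rewrite -natrM mulnb indicE; congr ((nat_of_bool _)%:R : R).
  by apply/idP/idP => [/andP[h1 h2]|]; rewrite in_setE/= !in_itv/= ?h1 ?h2// => -[-> ->].
rewrite /Rintegral integral_indic//; last by apply: measurableI; exact: measurable_itv.
rewrite setIT /ramp.
have [va|av] := leP v a.
  rewrite (_ : _ `&` _ = set0) ?measure0/= ?(min_idPl ab) ?subrr//.
  by apply/seteqP; split => x //= []; rewrite !in_itv/= => /andP[h1 h2] h3; lra.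
have [vb|bv] := leP v b.
  rewrite (_ : _ `&` _ = `]a, v[%classic); last first.
    apply/seteqP; split => x /=; rewrite !in_itv/=.
      by case=> /andP[-> _].
    by move=> /andP[h1 h2]; split => //; apply/andP; split => //; lra.
  rewrite -[fine _]/(fine (@lebesgue_measure R `]a, v[%classic)).
  by rewrite lebesgue_measure_itv/= lte_fin av.
rewrite (_ : _ `&` _ = `]a, b]%classic); last first.
  apply/seteqP; split => x /=; rewrite !in_itv/=; first by case.
  by move=> /andP[h1 h2]; split => //; [apply/andP|apply: le_lt_trans bv].
rewrite -[fine _]/(fine (@lebesgue_measure R `]a, b]%classic)).
rewrite lebesgue_measure_itv/= lte_fin.
by case: ltP => //= ba; lra.
Qed.

Variables (L : R) (g : R -> R).
Hypotheses (L0 : 0 <= L) (mg : measurable_fun setT g).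
Hypothesis g0 : forall x, x <= 0 -> g x = 0.
Hypothesis sg : sqi leb (fun x => (0 <= x <= L)%R%:R * g x).
Hypothesis g_nondeg : forall d, 0 < d -> exists2 u, 0 < u < d &
  \int[leb]_x ((x < u)%R%:R * g x) != 0.

Definition primitive (v : R) : R := \int[leb]_x ((x < v)%R%:R * g x).

Lemma integrable_ltr_g (v s : R) : v <= L -> 0 <= s ->
  leb.-integrable setT (EFin \o (fun x => (x < v)%R%:R * g (x - s))).
Proof.
move=> vL s0.
have ig : leb.-integrable setT (EFin \o (fun x => (x < v - s)%R%:R * g x)).
  have := integrable_mulf (sqi_itvind 0 L) sg.
  move/(integrable_ltind_mul (v - s)).
  apply: eq_integrable => // x _ /=; congr EFin.
  case: ltP => xv; last by rewrite !mul0r.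
  have -> : x <= L by lra.
  rewrite andbT; case: leP => x0; rewrite ?mul1r//.
  by rewrite g0 ?ltW// !mulr0.
have := integrable_translate s ig; apply: eq_integrable => // x _ /=.
by rewrite ltrD2r.
Qed.

Lemma primitive_translate (v s : R) :
  primitive (v - s) = \int[leb]_x ((x < v)%R%:R * g (x - s)).
Proof.
rewrite /primitive -(Rintegral_translate s).
  by apply: eq_Rintegral => x _; rewrite ltrD2r.
by apply: measurable_funM => //; exact: measurable_ltind.
Qed.

Definition shift_comb (l : seq (R * R)) (v : R) : R :=
  \sum_(p <- l) p.1 * primitive (v - p.2).

(** Integrating from 0 to v turns the L2 approximation of the indicator of (a,b] into a uniform
    approximation of its primitive: Cauchy-Schwarz costs a factor sqrt(L). Using L + 1 avoids a
    division by zero. *)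
Lemma ramp_approx (a b eps : R) : 0 <= a -> a <= b -> b <= L -> 0 < eps ->
  exists2 l, all (fun p => 0 < p.2) l &
  forall v, 0 <= v <= L -> `|ramp a b v - shift_comb l v| <= eps.
Proof.
move=> a0 ab bL eps0.
have L1 : 0 < L + 1 by lra.
have [l ls hl] := @volterra_L2_dense _ L g L0 g0 sg g_nondeg a b (eps ^+ 2 / (L + 1)) a0 ab bL
  (divr_gt0 (exprn_gt0 2 eps0) L1).
exists l => // v /andP[v0 vL].
pose u x : R := (0 <= x <= L)%R%:R * ((a < x <= b)%R%:R - \sum_(p <- l) p.1 * g (x - p.2)).
have mu_ := measurable_ocind a b.
have su : sqi leb u.
  have s1 : sqi leb (fun x : R => (a < x <= b)%R%:R * (0 <= x <= L)%R%:R).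
    apply: (@sqi_bounded _ _ _ _ 1) => //; last exact: sqi_itvind.
    by move=> x; case: (_ && _); rewrite ?normr1 ?normr0.
  have := sqiB s1 (sqi_translates g0 sg ls).
  by congr sqi; apply/funext => x; rewrite /u; ring.
have iab : leb.-integrable setT (EFin \o (fun x => (a < x <= b)%R%:R)).
  have := @integrable_indic_itv R a b false false.
  apply: eq_integrable => // x _ /=; rewrite indicE; congr ((nat_of_bool _)%:R%:E : \bar R).
  by apply/idP/idP; rewrite in_setE/= in_itv.
have i1 := integrable_ltind_mul v iab.
have [i3 e3] := @Rintegral_sum_in _ _ _ leb _ l (fun p x => p.1 * ((x < v)%R%:R * g (x - p.2)))
  (fun p pl => integrableZ _ (integrable_ltr_g vL (ltW (allP ls _ pl)))).
pose f x : R := (x < v)%R%:R * (0 < x <= L)%R%:R.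
have fE x : f x ^+ 2 = f x.
  by rewrite /f; case: (x < v); case: (0 < x <= L); rewrite ?mul0r ?mulr0 ?mulr1 ?expr0n ?expr1n.
have sf : sqi leb f.
  have : sqi leb (fun x : R => (x < v)%R%:R * ((0 < x <= L)%R%:R * (0 <= x <= L)%R%:R)).
    apply: (@sqi_bounded _ _ _ _ 1); first exact: measurable_ltind.
      by move=> x; exact: normr_bool_le1.
    apply: (@sqi_bounded _ _ _ _ 1); first exact: measurable_ocind.
      by move=> x; exact: normr_bool_le1.
    exact: sqi_itvind.
  congr sqi; apply/funext => x; rewrite /f; case: (ltP 0 x) => x0; rewrite ?mul0r ?mulr0//.
  by rewrite (ltW x0)/=; case: (x <= L); rewrite ?mulr1 ?mulr0.
have -> : ramp a b v - shift_comb l v = \int[leb]_x (f x * u x).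
  rewrite -Rintegral_ramp// /shift_comb.
  have -> : \sum_(p <- l) p.1 * primitive (v - p.2) =
     \int[leb]_x (\sum_(p <- l) p.1 * ((x < v)%R%:R * g (x - p.2))).
    rewrite e3; apply: eq_big_seq => p pl; rewrite RintegralZl ?primitive_translate//.
    by apply: integrable_ltr_g => //; exact: ltW (allP ls _ pl).
  rewrite -RintegralB//; apply: eq_Rintegral => x _; rewrite /f /u.
  case: (ltP x v) => xv; last first.
    by rewrite !mul0r big1 ?subrr// => p _; rewrite mul0r mulr0.
  have xL : x <= L by rewrite (le_trans (ltW xv)).
  rewrite xL !andbT !mul1r; under eq_bigr do rewrite mul1r.
  case: (ltP 0 x) => x0; first by rewrite (ltW x0) !mul1r.
  rewrite (_ : a < x = false) ?mul0r/=; last by apply/negbTE; rewrite -leNgt (le_trans x0).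
  rewrite big_seq big1 ?subrr// => p /(allP ls) p0.
  by rewrite g0 ?mulr0// subr_le0 (le_trans x0)// ltW.
apply: (le_trans (cauchy_schwarz_norm sf su)).
have f1 : \int[leb]_x (f x ^+ 2) <= L + 1.
  under eq_Rintegral do rewrite fE.
  rewrite Rintegral_ramp// /ramp subr0 ge_min (_ : L <= L + 1) ?orbT//.
  by rewrite lerDl.
rewrite -sqrtrM ?Rintegral_sqr_ge0// -[leRHS]ger0_norm ?(ltW eps0)// -sqrtr_sqr.
rewrite ler_sqrt ?exprn_ge0 ?(ltW eps0)//.
apply: (@le_trans _ _ ((L + 1) * (eps ^+ 2 / (L + 1)))).
  by apply: ler_pM; rewrite ?Rintegral_sqr_ge0// ltW.
by rewrite mulrCA divff ?mulr1// gt_eqF.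
Qed.

(* Piecewise linear interpolation, each piece being a multiple of a ramp. *)
Lemma path_approx (gam : R -> R) (eps : R) :
  {within [set v | 0 <= v <= L], continuous gam} -> gam 0 = 0 -> 0 < eps ->
  exists2 l, all (fun p => 0 < p.2) l &
  forall v, 0 <= v <= L -> `|gam v - shift_comb l v| <= eps.
Proof.
move=> cg gam0 eps0.
have [L00|Ln0] := eqVneq L 0.
  exists [::] => // v; rewrite L00 => /andP[v0 v1].
  have -> : v = 0 by apply/eqP; rewrite eq_le v0 v1.
  by rewrite gam0 /shift_comb big_nil subrr normr0 ltW.
have L1 : 0 < L by rewrite lt_def Ln0.
have [N N0 hN] : exists2 N : nat, (0 < N)%N & forall x y, 0 <= x <= L -> 0 <= y <= L ->
    `|x - y| <= L / N%:R -> `|gam x - gam y| <= eps / 2.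
  have [n hn] := uniformly_continuous_itv cg (divr_gt0 eps0 (ltr0n R 2)).
  (* This makes the mesh L / N at most 1 / (n + 1). *)
  exists (n.+1 * (Num.truncn L).+1)%N; first by [].
  move=> x y xL yL xy; apply: hn => //; apply: (le_trans xy).
  rewrite ler_pdivrMr ?ltr0n ?muln_gt0// natrM mulrA mulVf ?mul1r ?pnatr_eq0//.
  by have /andP[_ /ltW] := truncn_itv L0.
have NR : 0 < N%:R :> R by rewrite ltr0n.
pose t (i : nat) : R := i%:R * (L / N%:R).
have LN0 : 0 < L / N%:R by rewrite divr_gt0.
have t0 i : 0 <= t i by rewrite mulr_ge0// ltW.
have tle i j : (i <= j)%N -> t i <= t j by move=> ij; rewrite ler_wpM2r ?ler_nat// ltW.
have tN : t N = L by rewrite /t mulrCA divff ?mulr1// gt_eqF.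
have tS i : t i.+1 = t i + L / N%:R by rewrite /t -natr1 mulrDl mul1r.
pose c (i : nat) : R := (gam (t i.+1) - gam (t i)) / (L / N%:R).
(* The error of the i-th ramp is multiplied by the slope [c i]; the tolerance is divided by the sum
   of the slopes, plus 1 in case they all vanish. *)
pose K : R := \sum_(i < N) `|c i|.
have K0 : 0 <= K by exact: sumr_ge0.
have e0 : 0 < eps / 2 / (K + 1) by rewrite !divr_gt0//; lra.
have ap (i : 'I_N) : exists l, all (fun p => 0 < p.2) l /\
    forall v, 0 <= v <= L -> `|ramp (t i) (t i.+1) v - shift_comb l v| <= eps / 2 / (K + 1).
  have tiL : t i.+1 <= L by rewrite -tN tle.
  by have [l h1 h2] := ramp_approx (t0 i) (tle _ _ (leqnSn i)) tiL e0; exists l.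
have [l hl] := choice ap.
exists (flatten [seq [seq (c i * p.1, p.2) | p <- l i] | i : 'I_N <- enum 'I_N]).
  apply/allP => p /flattenP[s /mapP[i _ ->] /mapP[q ql ->]]/=.
  by have [/allP h _] := hl i; exact: h.
move=> v vL.
have -> : shift_comb (flatten [seq [seq (c i * p.1, p.2) | p <- l i] | i : 'I_N <- enum 'I_N]) v =
    \sum_(i < N) c i * shift_comb (l i) v.
  rewrite /shift_comb big_flatten/= big_map big_enum; apply: eq_bigr => i _.
  by rewrite big_map mulr_sumr; apply: eq_bigr => p _; rewrite mulrA.
have -> : gam v - \sum_(i < N) c i * shift_comb (l i) v =
  (gam v - \sum_(i < N) c i * ramp (t i) (t i.+1) v) +
  \sum_(i < N) c i * (ramp (t i) (t i.+1) v - shift_comb (l i) v).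
  under [X in _ = _ + X]eq_bigr do rewrite mulrBr.
  by rewrite sumrB; ring.
rewrite (splitr eps); apply: (le_trans (ler_normD _ _)); apply: lerD; last first.
  apply: (le_trans (ler_norm_sum _ _ _)).
  apply: (@le_trans _ _ (K * (eps / 2 / (K + 1)))).
    by rewrite mulr_suml ler_sum// => i _; rewrite normrM ler_wpM2l//; exact: (hl i).2.
  rewrite mulrCA ger_pMr; last by rewrite divr_gt0.
  by rewrite ler_pdivrMr ?mul1r; lra.
have [j jN /andP[vj1 vj2]] : exists2 j, (j < N)%N & t j <= v <= t j.+1.
  have /andP[v0 v1] := vL.
  have [k k1 k2] : exists2 k, (k < N)%N & k%:R <= v / (L / N%:R) <= k.+1%:R.
    have /andP[h1 h2] := @truncn_itv R (v / (L / N%:R)) (divr_ge0 v0 (ltW LN0)).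
    have [kN|kN] := ltnP (Num.truncn (v / (L / N%:R))) N.
      by exists (Num.truncn (v / (L / N%:R))); rewrite // h1 ltW.
    have vN : v / (L / N%:R) <= N%:R by rewrite ler_pdivrMr// -/(t N) tN.
    (* At v = L the truncation returns N, one past the last cell. *)
    exists N.-1; first by rewrite prednK.
    by rewrite prednK// vN (le_trans _ h1)// ler_nat (leq_trans (leq_pred _)).
  move: k2; rewrite ler_pdivlMr// ler_pdivrMr// => k2; by exists k.
have -> : \sum_(i < N) c i * ramp (t i) (t i.+1) v =
    gam (t j) + (gam (t j.+1) - gam (t j)) * ((v - t j) / (L / N%:R)).
  rewrite -(big_mkord xpredT (fun i => c i * ramp (t i) (t i.+1) v)).
  rewrite (@big_cat_nat _ _ _ j)//=; last exact: ltnW.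
  rewrite (@big_ltn _ _ _ j)//= [X in _ + (_ + X)]big_nat_cond [X in _ + (_ + X)]big1 ?addr0; last first.
    move=> i /andP[/andP[ji _] _]; rewrite /ramp (max_idPr _) ?(min_idPl _) ?subrr ?mulr0//.
      exact: tle.
    by rewrite (le_trans vj2)// tle.
  congr (_ + _); last first.
    by rewrite /ramp (max_idPl vj1) (min_idPl vj2) /c; field; rewrite !gt_eqF.
  rewrite (eq_big_nat _ _ (F2 := fun i => gam (t i.+1) - gam (t i))).
    rewrite telescope_sumr//; rewrite (_ : t 0 = 0) ?gam0 ?subr0//.
    by rewrite /t mul0r.
  move=> i /andP[_ ij]; rewrite /ramp (max_idPl _); last by rewrite (le_trans _ vj1)// tle// ltnW.
  rewrite (min_idPr _) ?(le_trans _ vj1)// ?tle//.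
  have -> : t i.+1 - t i = L / N%:R by rewrite tS; ring.
  by rewrite /c divfK// gt_eqF.
set th := (v - t j) / (L / N%:R).
have th01 : 0 <= th <= 1.
  rewrite divr_ge0 ?subr_ge0// ?(ltW LN0)//= ler_pdivrMr// mul1r.
  by rewrite lerBlDr addrC -tS.
have tjL : 0 <= t j <= L by rewrite t0 -tN tle// ltnW.
have tj1L : 0 <= t j.+1 <= L by rewrite t0 -tN tle.
have d1 : `|gam v - gam (t j)| <= eps / 2.
  by apply: hN => //; rewrite ger0_norm ?subr_ge0// lerBlDr addrC -tS.
have d2 : `|gam v - gam (t j.+1)| <= eps / 2.
  apply: hN => //; rewrite distrC ger0_norm ?subr_ge0//.
  by rewrite tS; lra.
move: d1 d2 th01; rewrite !ler_norml => /andP[? ?] /andP[? ?] /andP[? ?].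
by apply/andP; split; nra.
Qed.

End ramps.

(** * Measures with a density and exponential tilting of independent Gaussians *)

Section density_measure.
Context d (T : measurableType d) (R : realType) (mu : {measure set T -> \bar R}).
Variable W : T -> R.
Hypotheses (mW : measurable_fun setT W) (W0 : forall x, 0 <= W x).

(** The two hypotheses are arguments so that the measure structure can be attached to the term. *)
Definition mdens of measurable_fun setT W & (forall x, 0 <= W x) :=
  fun A : set T => (\int[mu]_(x in A) (W x)%:E)%E.

Let m := mdens mW W0.

Let m0 : m set0 = 0%E. Proof. exact: integral_set0. Qed.

Let m_ge0 A : (0 <= m A)%E.
Proof. by apply: integral_ge0 => x _; rewrite lee_fin. Qed.

Let m_sigma : semi_sigma_additive m.
Proof.
apply: semi_sigma_additive_nng_induced; first exact/measurable_EFinP.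
by move=> x; rewrite lee_fin.
Qed.

HB.instance Definition _ := isMeasure.Build _ _ _ m m0 m_ge0 m_sigma.

Lemma mdensE A : m A = (\int[mu]_(x in A) (W x)%:E)%E. Proof. by []. Qed.

Let mW' : measurable_fun setT (EFin \o W). Proof. exact/measurable_EFinP. Qed.

Import HBNNSimple.

Let nnsfun_mdens (h : {nnsfun T >-> R}) :
  (\int[m]_x (h x)%:E = \int[mu]_x (h x * W x)%:E)%E.
Proof.
transitivity (\sum_(k \in range h) (k%:E * m (h @^-1` [set k])))%E.
  under eq_integral do rewrite fimfunE -fsumEFin//.
  rewrite ge0_integral_fsum//; last 2 first.
  - by move=> y; exact/measurable_EFinP/measurable_funM.
  - by move=> y x _; rewrite nnfun_muleindic_ge0.
  apply: eq_fsbigr => r _; rewrite integralZl_indic_nnsfun// integral_indic//.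
  by rewrite setIT.
transitivity (\sum_(k \in range h) \int[mu]_x (k * \1_(h @^-1` [set k]) x * W x)%:E)%E.
  apply: eq_fsbigr => r /[!inE] -[y _ <-]; rewrite mdensE [in LHS]integral_mkcond.
  rewrite -ge0_integralZl_EFin//.
  - apply: eq_integral => x _; rewrite patchE indicE; case: ifPn => _.
      by rewrite mulr1.
    by rewrite mulr0 mul0r mule0.
  - by move=> x _; apply: erestrict_ge0 => z _; rewrite lee_fin.
  - by apply/(measurable_restrictT _ _).1 => //; exact: measurable_funTS.
rewrite -ge0_integral_fsum//.
- apply: eq_integral => x _; rewrite fsumEFin// (fimfunE h) mulrC mulr_fsumr//.
  by congr EFin; apply: eq_fsbigr => r _; rewrite mulrC.
- by move=> r; apply/measurable_EFinP; apply: measurable_funM => //; exact: measurable_funM.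
- move=> r x _; rewrite lee_fin mulr_ge0//.
  by have := nnfun_muleindic_ge0 h r x; rewrite -EFinM lee_fin.
Qed.

Lemma ge0_integral_mdens (f : T -> R) : measurable_fun setT f -> (forall x, 0 <= f x) ->
  (\int[m]_x (f x)%:E = \int[mu]_x (f x * W x)%:E)%E.
Proof.
move=> mf f0.
have mf' : measurable_fun setT (EFin \o f) by exact/measurable_EFinP.
pose f_ := nnsfun_approx measurableT mf'.
have cf x : (f_ n x)%:E @[n --> \oo] --> (f x)%:E.
  by apply: (@cvg_nnsfun_approx _ _ _ _ measurableT _ mf') => // y _; rewrite /= lee_fin.
have ndf x : nondecreasing_seq (fun n => f_ n x).
  by move=> m' n' mn; exact/lefP/nd_nnsfun_approx.
transitivity (limn (fun n => \int[m]_x (f_ n x)%:E)%E).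
  rewrite -monotone_convergence//.
  - by apply: eq_integral => y _; apply/esym/cvg_lim.
  - by move=> n; exact/measurable_EFinP/measurable_funP.
  - by move=> n y _; rewrite lee_fin.
  - by move=> y _ a b ab; rewrite lee_fin; exact: ndf.
transitivity (limn (fun n => \int[mu]_x (f_ n x * W x)%:E)%E).
  by congr (limn _); apply/funext => n; rewrite nnsfun_mdens.
rewrite -monotone_convergence//.
- apply: eq_integral => y _; apply/cvg_lim => //.
  rewrite EFinM; under eq_fun do rewrite EFinM.
  by apply: cvgeZr => //; exact: cf.
- by move=> n; apply/measurable_EFinP; apply: measurable_funM => //; exact: measurable_funP.
- by move=> n y _; rewrite lee_fin mulr_ge0.
- by move=> y _ a b ab; rewrite lee_fin ler_wpM2r//; exact: ndf.
Qed.

End density_measure.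

Section normal_tilt.
Context {R : realType}.
Notation leb := (@lebesgue_measure R).

Lemma ge0_integral_normal (s : R) (f : R -> R) : measurable_fun setT f -> (forall x, 0 <= f x) ->
  (\int[normal_prob 0 s]_x (f x)%:E = \int[leb]_x (f x * normal_pdf 0 s x)%:E)%E.
Proof.
move=> mf f0.
rewrite -(@ge0_integral_mdens _ _ _ leb (normal_pdf 0 s) (measurable_normal_pdf 0 s)
  (normal_pdf_ge0 0 s) f)//.
Qed.

(** Completing the square: the tilted density at x is the Gaussian density at x - cv. *)
Lemma normal_tilt (c v : R) (A : set R) : 0 < v -> measurable A ->
  (\int[normal_prob 0 (Num.sqrt v)]_x (expR (c * x - c ^+ 2 * v / 2) * \1_A x)%:E =
   normal_prob 0 (Num.sqrt v) ((fun x : R => x + c * v)%R @^-1` A))%E.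
Proof.
move=> v0 mA.
have mE : measurable_fun setT (fun x : R => expR (c * x - c ^+ 2 * v / 2)).
  by apply: measurableT_comp => //; apply: measurable_funB => //; exact: measurable_funM.
rewrite ge0_integral_normal//; last first.
  by apply: measurable_funM => //; exact: measurable_indic.
rewrite /normal_prob [RHS]integral_mkcond -[RHS](integral_translate (c * v)); last first.
  apply/(measurable_restrictT _ _).1; last first.
    by apply: measurable_funTS; apply/measurable_EFinP; exact: measurable_normal_pdf.
  rewrite -[X in measurable X]setTI.
  by apply: (measurable_funD (@measurable_id _ _ setT) (@measurable_cst _ _ _ _ setT (c * v))).
apply: eq_integral => x _; rewrite patchE indicE.
have -> : (x - c * v \in (fun x => x + c * v) @^-1` A) = (x \in A).
  by apply/idP/idP; rewrite !inE /= subrK.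
case: ifPn => _; last by rewrite mulr0 mul0r.
congr EFin; have s0 : Num.sqrt v != 0 by rewrite gt_eqF// sqrtr_gt0.
rewrite mulr1 !normal_pdfE// mulrCA; congr (_ * _).
rewrite /normal_fun -expRD !subr0 sqr_sqrtr ?ltW//; congr expR.
by field; rewrite gt_eqF.
Qed.

End normal_tilt.

Section independent_tilt.
Context {R : realType} d (Omega : measurableType d) (P : probability Omega R).
Variables (n : nat) (Y : 'I_n -> Omega -> R).
Hypothesis mY : forall i, measurable_fun setT (Y i).
Hypothesis indY : mutually_independent P Y.
Variables (D : 'I_n -> R -> R) (s : 'I_n -> R).
Hypotheses (mD : forall i, measurable_fun setT (D i)) (D0 : forall i x, 0 <= D i x).
Hypothesis tilt : forall i A, measurable A ->
  (\int[P]_w (D i (Y i w) * \1_A (Y i w))%:E = P [set w | A (Y i w + s i)%R])%E.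

(** Independence is given for events only, so the densities enter one factor at a time: here the
    first k factors carry one. *)
Let tiltS k := forall A : 'I_n -> set R, (forall i, measurable (A i)) ->
  (\int[P]_w (\prod_(i < n) ((if (i < k)%N then D i (Y i w) else 1) * \1_(A i) (Y i w)))%:E =
   \prod_(i < n) P [set w | A i (Y i w + (if (i < k)%N then s i else 0))%R])%E.

Let mpre i (t : R) A : measurable A -> measurable [set w | A (Y i w + t)].
Proof.
move=> mA; rewrite -[X in measurable X]setTI.
exact: (measurable_funD (mY i) (@measurable_cst _ _ _ _ setT t)).
Qed.

Let tilt0 : tiltS 0.
Proof.
move=> A mA.
rewrite (_ : \prod_(i < n) _ = \prod_(i < n) P (Y i @^-1` A i))%E; last first.
  apply: eq_bigr => i _; congr (P _); apply/seteqP; split => w /=; by rewrite addr0.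
rewrite -indY//.
have mI : measurable (\bigcap_(i in [set: 'I_n]) (Y i @^-1` A i)).
  apply: fin_bigcap_measurable => // i _.
  by rewrite -[X in measurable X]setTI; exact: mY.
transitivity (\int[P]_w (\1_(\bigcap_(i in [set: 'I_n]) (Y i @^-1` A i)) w)%:E)%E; last first.
  by rewrite integral_indic// setIT.
apply: eq_integral => w _; congr EFin; rewrite indicE.
under eq_bigr do rewrite mul1r indicE.
have [wI|wI] := boolP (w \in _).
  by rewrite big1// => i _; rewrite mem_set//; move: wI; rewrite inE => /(_ i I).
apply/eqP/prodf_eq0; apply: contrapT => h; move: wI; rewrite notin_setE; apply => i _ /=.
by apply: contrapT => nA; apply: h; exists i => //; rewrite memNset.
Qed.

Let tilt_step k : tiltS k -> tiltS k.+1.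
Proof.
move=> IH A mA; have [kn|nk] := ltnP k n; last first.
  have lk (i : 'I_n) : (i < k)%N = true by rewrite (leq_trans (ltn_ord i)).
  have lk1 (i : 'I_n) : (i < k.+1)%N = true by rewrite ltnS ltnW ?lk.
  by have := IH A mA; under eq_integral do under eq_bigr do rewrite lk;
    under eq_bigr do rewrite lk; move=> h;
    under eq_integral do under eq_bigr do rewrite lk1;
    under eq_bigr do rewrite lk1.
pose j := Ordinal kn.
have nj (i : 'I_n) : i != j -> (i < k.+1)%N = (i < k)%N.
  by move=> ij; rewrite ltnS leq_eqVlt (_ : (i == k :> nat) = false)//; apply/negbTE.
pose W w := \prod_(i < n | i != j) ((if (i < k)%N then D i (Y i w) else 1) * \1_(A i) (Y i w)).
have W0 w : 0 <= W w by apply: prodr_ge0 => i _; rewrite mulr_ge0//; case: ifP.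
have mW : measurable_fun setT W.
  rewrite (_ : W = fun w => \prod_(i < n) (if i != j then
      (if (i < k)%N then D i (Y i w) else 1) * \1_(A i) (Y i w) else 1)); last first.
    by apply/funext => w; rewrite /W big_mkcond.
  apply: measurable_prod => i _; case: (i != j); last exact: measurable_cst.
  apply: measurable_funM.
    by case: (i < k)%N; [exact: measurableT_comp|exact: measurable_cst].
  by apply: measurableT_comp => //; exact: measurable_indic.
pose c := (\prod_(i < n | i != j) P [set w | A i (Y i w + (if (i < k)%N then s i else 0))%R])%E.
have cfin : c \is a fin_num.
  rewrite /c; elim/big_ind : _ => // [x y xf yf|i _]; first by rewrite fin_numM.
  by apply: fin_num_measure; exact: mpre.
have c0 : (0 <= c)%E by apply: prode_ge0 => i _.
have fc0 : 0 <= fine c by rewrite fine_ge0.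
(* Under the measure with density [W], made of all other factors, the image of [Y j] is c times its
   law under [P]; the j-th density can then be integrated against it. *)
have key A1 : measurable A1 ->
    (\int[P]_w (\1_A1 (Y j w) * W w)%:E = P [set w | A1 (Y j w)] * c)%E.
  move=> mA1; have := IH (fun i => if i == j then A1 else A i) _.
  move=> H; have {}H := H (fun i => _); transitivity
   (\int[P]_w (\prod_(i < n) ((if (i < k)%N then D i (Y i w) else 1) *
      \1_(if i == j then A1 else A i) (Y i w)))%:E)%E.
    apply: eq_integral => w _; rewrite (bigD1 j)//= eqxx ltnn mul1r; congr (_ * _)%:E.
    by apply: eq_bigr => i /negbTE ->.
  rewrite H; last by move=> i; case: eqP.
  rewrite (bigD1 j)//= eqxx ltnn; congr (P _ * _)%E.
    by apply/seteqP; split => w /=; rewrite addr0.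
  by apply: eq_bigr => i /negbTE ->.
transitivity (\int[P]_w (D j (Y j w) * \1_(A j) (Y j w) * W w)%:E)%E.
  apply: eq_integral => w _; rewrite (bigD1 j)//= ltnSn; congr (_ * _)%:E.
  by apply: eq_bigr => i ij; rewrite nj.
rewrite [RHS](bigD1 j)//= ltnSn.
rewrite [X in (_ * X)%E](_ : _ = c); last by apply: eq_bigr => i ij; rewrite nj.
have mpsi : measurable_fun setT (fun x => D j x * \1_(A j) x).
  by apply: measurable_funM => //; exact: measurable_indic.
have psi0 x : 0 <= D j x * \1_(A j) x by rewrite mulr_ge0.
rewrite -(@ge0_integral_mdens _ _ _ P W mW W0 (fun w => D j (Y j w) * \1_(A j) (Y j w)))//; last first.
  exact: (measurableT_comp mpsi (mY j)).
have := @ge0_integral_pushforward _ _ _ _ R (Y j) (mY j) (mdens P mW W0) setT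
  (fun x => (D j x * \1_(A j) x)%:E) measurableT.
rewrite preimage_setT => <-//; last 2 first.
- exact/measurable_EFinP.
- by move=> x _; rewrite lee_fin.
rewrite (eq_measure_integral (mscale (NngNum fc0) (pushforward P (Y j)))); last first.
  move=> A1 mA1 _.
  change (mdens P mW W0 (Y j @^-1` A1) = (fine c)%:E * P (Y j @^-1` A1))%E.
  rewrite fineK// muleC.
  rewrite -(key A1 mA1) /mdens [LHS]integral_mkcond; apply: eq_integral => w _.
  rewrite patchE indicE (_ : (w \in Y j @^-1` A1) = (Y j w \in A1)); last first.
    by apply/idP/idP; rewrite !inE.
  case: ifPn => h; rewrite ?mul1r ?mul0r//.
rewrite ge0_integral_mscale//; last 2 first.
- exact/measurable_EFinP.
- by move=> x _; rewrite lee_fin.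
rewrite ge0_integral_pushforward//; last 2 first.
- exact/measurable_EFinP.
- by move=> x _; rewrite lee_fin.
rewrite preimage_setT /= fineK// muleC; congr (_ * _)%E.
exact: tilt.
Qed.

Lemma independent_tilt (A : 'I_n -> set R) : (forall i, measurable (A i)) ->
  (\int[P]_w (\prod_(i < n) (D i (Y i w) * \1_(A i) (Y i w)))%:E =
   \prod_(i < n) P [set w | A i (Y i w + s i)%R])%E.
Proof.
move=> mA; have H : tiltS n by elim: n => [|k]; [exact: tilt0|exact: tilt_step].
have := H A mA; under eq_integral do under eq_bigr do rewrite ltn_ord.
by under eq_bigr do rewrite ltn_ord.
Qed.

End independent_tilt.

(** * The Cameron-Martin formula for finitely many increments *)

Lemma eq_preimage_measure (R : realType) d1 (T1 : measurableType d1) d2 (T2 : measurableType d2)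
    (m1 : {measure set T1 -> \bar R}) (m2 : {measure set T2 -> \bar R})
    (U : pointedType) (G : set (set U))
    (f1 : T1 -> g_sigma_algebraType G) (f2 : T2 -> g_sigma_algebraType G) :
  measurable_fun setT f1 -> measurable_fun setT f2 -> setI_closed G -> G setT ->
  (m1 setT < +oo)%E -> (forall E, G E -> m1 (f1 @^-1` E) = m2 (f2 @^-1` E)) ->
  forall E, <<s G >> E -> m1 (f1 @^-1` E) = m2 (f2 @^-1` E).
Proof.
move=> mf1 mf2 GI GT fin eqG E mE.
apply: (@measure_unique _ R (g_sigma_algebraType G) G (fun=> setT) erefl GI (fun=> GT) _
  (pushforward m1 f1) (pushforward m2 f2)) => //.
by apply/seteqP; split => x // _; exists 0%N.
Qed.

Lemma measurable_sum_in (R : realType) d (T : measurableType d) (I : eqType) (s : seq I)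
    (h : I -> T -> R) :
  (forall i, i \in s -> measurable_fun setT (h i)) ->
  measurable_fun setT (fun x => \sum_(i <- s) h i x).
Proof.
elim: s => [_|i s IH mh].
  by under eq_fun do rewrite big_nil; exact: measurable_cst.
under eq_fun do rewrite big_cons.
apply: measurable_funD; first by apply: mh; rewrite mem_head.
by apply: IH => j js; apply: mh; rewrite inE js orbT.
Qed.

Section increments.
Context {R : realType}.

Definition incr_cyl (u : nat -> R) (n : nat) : set (set (R -> R)) :=
  [set E | exists2 A : 'I_n -> set R, (forall i, measurable (A i)) &
    E = [set x | forall i, A i (x (u i.+1) - x (u i))]].

Lemma incr_cyl_setI u n : setI_closed (incr_cyl u n).
Proof.
move=> _ _ [A mA ->] [A' mA' ->]; exists (fun i => A i `&` A' i).
  by move=> i; exact: measurableI.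
apply/seteqP; split => x /=; first by move=> [h h'] i; split; [exact: h|exact: h'].
by move=> h; split => i; [exact: (h i).1|exact: (h i).2].
Qed.

Lemma incr_cyl_setT u n : incr_cyl u n setT.
Proof. by exists (fun=> setT) => //; apply/seteqP; split. Qed.

Lemma measurable_incr_cyl d (T : measurableType d) u n (Th : T -> R -> R) :
  (forall s, measurable_fun setT (fun w => Th w s)) ->
  measurable_fun setT (Th : T -> g_sigma_algebraType (incr_cyl u n)).
Proof.
move=> mTh; apply: (@measurability _ _ _ (g_sigma_algebraType (incr_cyl u n)) setT Th (incr_cyl u n) erefl).
move=> _ [_ [A mA ->] <-]; rewrite setTI.
rewrite (_ : _ @^-1` _ = \bigcap_(i in [set: 'I_n]) [set w | A i (Th w (u i.+1) - Th w (u i))]).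
  apply: fin_bigcap_measurable => // i _; rewrite -[X in measurable X]setTI.
  exact: (measurable_funB (mTh _) (mTh _)).
by apply/seteqP; split => w /=; [move=> h i _; exact: h|move=> h i; exact: h].
Qed.

Lemma measurable_incr (u : nat -> R) n (i j : nat) : (i <= n)%N -> (j <= n)%N ->
  measurable_fun setT (fun x : g_sigma_algebraType (incr_cyl u n) => x (u j) - x (u i)).
Proof.
have step k : (k < n)%N ->
    measurable_fun setT (fun x : g_sigma_algebraType (incr_cyl u n) => x (u k.+1) - x (u k)).
  move=> kn _ A mA; rewrite setTI; apply: sub_sigma_algebra.
  exists (fun i => if i == Ordinal kn then A else setT); first by move=> a; case: ifP.
  apply/seteqP; split => x /=.
    by move=> h a; case: eqP => // ->.
  by move=> /(_ (Ordinal kn)); rewrite eqxx.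
have up k : (k <= n)%N -> measurable_fun setT
   (fun x : g_sigma_algebraType (incr_cyl u n) => x (u k) - x (u 0%N)).
  elim: k => [_|k IH kn].
    by apply: eq_measurable_fun (@measurable_cst _ _ _ _ setT (0 : R)) => x _ /=; rewrite subrr.
  apply: eq_measurable_fun (measurable_funD (step k kn) (IH (ltnW kn))) => x _ /=.
  by rewrite addrA subrK.
move=> hi hj; apply: eq_measurable_fun (measurable_funB (up _ hj) (up _ hi)) => x _ /=.
by rewrite opprB addrA subrK.
Qed.

(** [two_sided_BM] states independence along infinite strictly increasing sequences of times, so the
    sorted finite list is continued beyond its last element. *)
Lemma strictly_increasing_enum (s : seq R) :
  exists u : nat -> R, exists2 n, (forall i, u i < u i.+1) &
    forall p, p \in s -> exists2 i, (i <= n)%N & p = u i.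
Proof.
pose t := sort <=%R (undup s).
have tlt : sorted <%R t by rewrite sort_lt_sorted undup_uniq.
pose u i := if (i < size t)%N then nth 0 t i else last 0 t + i.+1%:R.
exists u, (size t).
  move=> i; rewrite /u; case: (ltnP i.+1 (size t)) => h1.
    by rewrite (ltnW h1); apply: (sorted_ltn_nth lt_trans) => //; rewrite inE// ltnW.
  case: (ltnP i (size t)) => h2; last by rewrite ltrD2l ltr_nat.
  have -> : i = (size t).-1 by apply/eqP; rewrite eqn_leq -ltnS (leq_trans h2 (leqSpred _))/=; case: (size t) h1.
  by rewrite nth_last ltrDl ltr0n.
move=> p ps; have pt : p \in t by rewrite mem_sort mem_undup.
exists (index p t); first by rewrite index_size.
by rewrite /u index_mem pt nth_index.
Qed.

End increments.

Section cameron_martin.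
Context {R : realType} d (Omega : measurableType d) (P : probability Omega R).
Variable B : R -> Omega -> R.
Hypothesis hB : two_sided_BM P B.

Let mB s : measurable_fun setT (B s). Proof. by case: hB. Qed.

Let law_incr (s t : R) (f : R -> R) : s < t -> measurable_fun setT f -> (forall x, 0 <= f x) ->
  (\int[P]_w (f (B t w - B s w))%:E = \int[normal_prob 0 (Num.sqrt (t - s))]_x (f x)%:E)%E.
Proof.
move=> st mf f0; have mI : measurable_fun setT ((fun w => B t w - B s w) : Omega -> measurableTypeR R).
  exact: measurable_funB.
have := @ge0_integral_pushforward _ _ _ _ R _ mI P setT (fun x => (f x)%:E) measurableT.
rewrite preimage_setT => <-; [|exact/measurable_EFinP|by move=> x _; rewrite lee_fin].
apply: eq_measure_integral => A mA _; case: hB => _ _ _ law _.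
transitivity (P [set w | B t w - B s w \in A]); last exact: law.
by congr (P _); apply/seteqP; split => w /=; rewrite inE.
Qed.

Section increments_shift.
Variables (u : nat -> R) (n : nat) (c : nat -> R) (l : R -> R).
Hypotheses (u_lt : forall i, u i < u i.+1).
Hypothesis l_incr : forall i, (i < n)%N -> l (u i.+1) - l (u i) = c i * (u i.+1 - u i).

Let Y (i : 'I_n) w := B (u i.+1) w - B (u i) w.
Let D (i : 'I_n) (x : R) := expR (c i * x - c i ^+ 2 * (u i.+1 - u i) / 2).
Let dens w := \prod_(i < n) D i (Y i w).

Let mY i : measurable_fun setT (Y i). Proof. exact: measurable_funB. Qed.
Let mD i : measurable_fun setT (D i).
Proof. by apply: measurableT_comp => //; apply: measurable_funB => //; exact: measurable_funM. Qed.
Let mdn : measurable_fun setT dens.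
Proof. by apply: measurable_prod => i _; exact: measurableT_comp. Qed.
Let dens0 w : 0 <= dens w.
Proof. by apply: prodr_ge0 => i _; exact: expR_ge0. Qed.
Let indY : mutually_independent P Y.
Proof. by case: hB => _ _ _ _; apply. Qed.

Let tilt i A : measurable A ->
  (\int[P]_w (D i (Y i w) * \1_A (Y i w))%:E =
   P [set w | A (Y i w + c i * (u i.+1 - u i))%R])%E.
Proof.
move=> mA.
have mf : measurable_fun setT (fun x => D i x * \1_A x).
  by apply: measurable_funM => //; exact: measurable_indic.
rewrite (law_incr (u_lt i) mf); last by move=> x; rewrite mulr_ge0// expR_ge0.
rewrite normal_tilt ?subr_gt0//; case: hB => _ _ _ law _.
have mA' : measurable ((fun x : R => x + c i * (u i.+1 - u i)) @^-1` A).
  rewrite -[X in measurable X]setTI.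
  exact: (measurable_funD (@measurable_id _ _ setT) (@measurable_cst _ _ _ _ setT _)).
rewrite -(law _ _ _ (u_lt i) mA'); congr (P _).
by apply/seteqP; split => w /=; rewrite inE.
Qed.

Let Th0 w : R -> R := fun s => B s w.
Let Th1 w : R -> R := fun s => B s w + l s.

(** Tilting the i-th increment by its Gaussian density translates it by c_i (u_(i+1) - u_i), the
    increment of [l], and independence multiplies the tilts. Both sides are integrals against image
    measures, which agree on the pi-system of increment cylinders. *)
Lemma cameron_martin_incr (Psi : (R -> R) -> R) :
  measurable_fun setT (Psi : g_sigma_algebraType (incr_cyl u n) -> R) ->
  (forall x, 0 <= Psi x) ->
  (\int[P]_w (Psi (fun s => B s w) * \prod_(i < n)
     expR (c i * (B (u i.+1) w - B (u i) w) - c i ^+ 2 * (u i.+1 - u i) / 2))%:E =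
   \int[P]_w (Psi (fun s => B s w + l s)%R)%:E)%E.
Proof.
move=> mPsi Psi0.
have m0 : measurable_fun setT (Th0 : Omega -> g_sigma_algebraType (incr_cyl u n)).
  by apply: measurable_incr_cyl => s; exact: mB.
have m1 : measurable_fun setT (Th1 : Omega -> g_sigma_algebraType (incr_cyl u n)).
  by apply: measurable_incr_cyl => s; apply: measurable_funD.
have ePsi : measurable_fun setT (EFin \o Psi : g_sigma_algebraType (incr_cyl u n) -> \bar R).
  exact/measurable_EFinP.
rewrite -(@ge0_integral_mdens _ _ _ P dens mdn dens0 (Psi \o Th0)) //; last 2 first.
- exact: (measurableT_comp mPsi m0).
- by move=> x; exact: Psi0.
have := @ge0_integral_pushforward _ _ _ _ R _ m0 (mdens P mdn dens0) setT (EFin \o Psi) measurableT ePsi.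
rewrite preimage_setT => <-; last by move=> x _; rewrite lee_fin.
have := @ge0_integral_pushforward _ _ _ _ R _ m1 P setT (EFin \o Psi) measurableT ePsi.
rewrite preimage_setT => H; rewrite -[RHS]H; last by move=> x _; rewrite lee_fin.
apply: eq_measure_integral => E mE _.
have agree F : incr_cyl u n F ->
    mdens P mdn dens0 (Th0 @^-1` F) = P (Th1 @^-1` F).
  move=> [A mA ->].
  rewrite [RHS](_ : _ = P (\bigcap_(i in [set: 'I_n]) (Y i @^-1`
     ((fun x : R => x + c i * (u i.+1 - u i)) @^-1` A i)))); last first.
    congr (P _); apply/seteqP; split => w /=.
      move=> h i _; have := h i; rewrite /Y /Th1 -l_incr//.
      by congr (A i _); ring.
    move=> h i; have := h i I; rewrite /Y /Th1 /= -l_incr//.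
    by congr (A i _); ring.
  rewrite indY; last first.
    move=> i; rewrite -[X in measurable X]setTI.
    exact: (measurable_funD (@measurable_id _ _ setT) (@measurable_cst _ _ _ _ setT _)).
  rewrite -(@independent_tilt _ _ _ _ _ Y mY indY D (fun i => c i * (u i.+1 - u i)) mD _ tilt A mA); last first.
    by move=> i x; exact: expR_ge0.
  rewrite mdensE integral_mkcond; apply: eq_integral => w _; rewrite patchE.
  rewrite big_split/= -/(dens w).
  case: ifPn => [|/negP] h.
    rewrite [X in _ * X]big1 ?mulr1// => i _; rewrite indicE mem_set//.
    by move: h; rewrite inE /=; exact.
  have -> : \prod_(i < n) \1_(A i) (Y i w) = 0 :> R; last by rewrite mulr0.
  apply/eqP/prodf_eq0; apply: contrapT => h'; apply: h; rewrite inE => i /=.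
  by apply: contrapT => nA; apply: h'; exists i => //; rewrite indicE memNset.
change (mdens P mdn dens0 (Th0 @^-1` E) = P (Th1 @^-1` E)).
apply: (eq_preimage_measure m0 m1 (@incr_cyl_setI R u n) (incr_cyl_setT u n)) => //.
change (mdens P mdn dens0 (Th0 @^-1` setT) < +oo)%E.
rewrite agree; last exact: incr_cyl_setT.
by rewrite preimage_setT (le_lt_trans (probability_le1 _ _))// ltry.
Qed.

End increments_shift.

Definition cm_density (c a b : R) (w : Omega) : R :=
  expR (c * (B b w - B a w) - c ^+ 2 * (b - a) / 2).

(** The integral of [stepfun h] over (a,b] when the steps are proper intervals, see
    [Rintegral_stepfun]; the form with increments of the ramp is the one in which shifting the path
    by a ramp changes [stepint]. *)
Definition step_mass (a b : R) (h : seq (R * R * R)) : R :=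
  \sum_(p <- h) p.1.1 * (ramp a b p.2 - ramp a b p.1.2).

Lemma cameron_martin_step (c a b : R) m (h : 'I_m -> seq (R * R * R)) (phi : 'I_m -> R -> R) :
  a < b -> (forall j, measurable_fun setT (phi j)) -> (forall j x, 0 <= phi j x) ->
  (\int[P]_w (\prod_(j < m) phi j (stepint B (h j) w) * cm_density c a b w)%:E =
   \int[P]_w (\prod_(j < m) phi j (stepint B (h j) w + c * step_mass a b (h j)))%:E)%E.
Proof.
move=> ab mphi phi0.
pose pts := [:: a; b] ++ flatten [seq flatten [seq [:: p.1.2; p.2] | p <- h j] | j : 'I_m <- enum 'I_m].
have [u [n u_lt hu]] := strictly_increasing_enum pts.
have [p pn ap] : exists2 i, (i <= n)%N & a = u i by apply: hu; rewrite inE eqxx.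
have [q qn bq] : exists2 i, (i <= n)%N & b = u i by apply: hu; rewrite !inE eqxx orbT.
have u_le : {homo u : i j / (i <= j)%N >-> i <= j}.
  by apply/nondecreasing_seqP => i; exact: ltW.
have pq : (p <= q)%N.
  by rewrite leqNgt; apply/negP => qp; move: ab; rewrite ap bq ltNge u_le// ltnW.
have hin j r : r \in h j -> exists i1 i2, [/\ (i1 <= n)%N, (i2 <= n)%N, r.1.2 = u i1 & r.2 = u i2].
  move=> rh.
  have sub x : x \in [:: r.1.2; r.2] -> x \in pts.
    move=> xr; rewrite mem_cat; apply/orP; right; apply/flattenP.
    exists (flatten [seq [:: p.1.2; p.2] | p <- h j]); first by apply/mapP; exists j; rewrite ?mem_enum.
    by apply/flattenP; exists [:: r.1.2; r.2] => //; apply/mapP; exists r.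
  have [i1 ? ?] := hu _ (sub r.1.2 (mem_head _ _)).
  have [i2 ? ?] := hu r.2 (sub r.2 ltac:(by rewrite !inE eqxx orbT)).
  by exists i1, i2.
(* The shift has slope c between the indices of a and b and is flat elsewhere, so that the product
   of the tilts telescopes to [cm_density]. *)
pose ci (i : nat) := if (p <= i < q)%N then c else 0.
pose l s := c * ramp a b s.
have l_incr i : (i < n)%N -> l (u i.+1) - l (u i) = ci i * (u i.+1 - u i).
  move=> _; rewrite /l /ci -mulrBr /ramp ap bq.
  have [pi|ip] := leqP p i; last first.
    rewrite (max_idPr (u_le _ _ ip)) (max_idPr (u_le _ _ (ltnW ip))) subrr mulr0.
    by rewrite /= mul0r.
  rewrite (max_idPl (u_le _ _ pi)) (max_idPl (u_le _ _ (leqW pi))).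
  have [iq|qi] := ltnP i q.
    by rewrite (min_idPl (u_le _ _ iq)) (min_idPl (u_le _ _ (ltnW iq)))/=; ring.
  by rewrite (min_idPr (u_le _ _ qi)) (min_idPr (u_le _ _ (leqW qi))) subrr mulr0 mul0r.
pose Psi (x : R -> R) := \prod_(j < m) phi j (\sum_(r <- h j) r.1.1 * (x r.2 - x r.1.2)).
have mPsi : measurable_fun setT (Psi : g_sigma_algebraType (incr_cyl u n) -> R).
  apply: measurable_prod => j _; apply: measurableT_comp => //.
  apply: measurable_sum_in => r rh; apply: measurable_funM => //.
  by have [i1 [i2 [h1 h2 -> ->]]] := hin j r rh; exact: measurable_incr.
have Psi0 x : 0 <= Psi x by apply: prodr_ge0.
have := cameron_martin_incr u_lt l_incr mPsi Psi0.
set lhs := (X in X = _ -> _); set rhs := (X in _ = X -> _) => E.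
transitivity lhs; last rewrite E; last first.
  apply: eq_integral => w _; congr EFin; apply: eq_bigr => j _; congr (phi j _).
  rewrite /stepint /step_mass mulr_sumr -big_split; apply: eq_bigr => r _ /=.
  by rewrite /l; ring.
apply: eq_integral => w _; congr (_ * _)%:E.
rewrite -expR_sum /cm_density; congr expR.
rewrite -(big_mkord xpredT (fun i => ci i * (B (u i.+1) w - B (u i) w) -
  ci i ^+ 2 * (u i.+1 - u i) / 2)).
rewrite (@big_cat_nat _ _ _ p)//= (@big_cat_nat _ _ _ q p n)//=.
rewrite [X in _ = X + _]big_nat_cond [X in _ = X + _]big1 ?add0r; last first.
  move=> i /andP[/andP[_ ip] _]; rewrite /ci leqNgt ip/= expr0n/=; ring.
rewrite [X in _ = _ + X]big_nat_cond [X in _ = _ + X]big1 ?addr0; last first.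
  move=> i /andP[/andP[qi _] _]; rewrite /ci (leq_gtF qi) andbF expr0n/=; ring.
rewrite (eq_big_nat _ _ (F2 := fun i => (c * B (u i.+1) w - c ^+ 2 * u i.+1 / 2) -
   (c * B (u i) w - c ^+ 2 * u i / 2))); last first.
  by move=> i piq; rewrite /ci piq; ring.
by rewrite telescope_sumr// ap bq; ring.
Qed.

End cameron_martin.

(** * Passage from elementary integrals to Wiener integrals *)

Section step_approximation.
Context {R : realType}.
Notation leb := (@lebesgue_measure R).

Lemma Rintegral_ocind (a b : R) : \int[leb]_x ((a < x <= b)%R%:R) = Num.max 0 (b - a).
Proof.
rewrite (_ : \int[leb]_x _ = \int[leb]_x (\1_(`]a, b]) x)); last first.
  apply: eq_Rintegral => x _; rewrite indicE; congr ((nat_of_bool _)%:R : R).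
  by apply/idP/idP; rewrite in_setE/= in_itv.
rewrite /Rintegral integral_indic; [|by []|exact: measurable_itv].
rewrite setIT -[fine _]/(fine (@lebesgue_measure R `]a, b]%classic)).
rewrite lebesgue_measure_itv/= lte_fin; case: ltP => ab/=.
  by apply/esym/max_idPr; rewrite subr_ge0 ltW.
by apply/esym/max_idPl; rewrite subr_le0.
Qed.

Lemma sqi_ocind (a b : R) : sqi leb (fun x : R => (a < x <= b)%R%:R).
Proof.
have : sqi leb (fun x : R => (a < x <= b)%R%:R * (a <= x <= b)%R%:R).
  apply: (@sqi_bounded _ _ _ _ 1); [exact: measurable_ocind|by move=> x; exact: normr_bool_le1|].
  exact: sqi_itvind.
congr sqi; apply/funext => x; case: ltP => ax; last by rewrite mul0r.
by rewrite (ltW ax)/=; case: (x <= b); rewrite ?mulr1 ?mulr0.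
Qed.

Lemma sqi_stepfun (h : seq (R * R * R)) : sqi leb (stepfun h).
Proof.
elim: h => [|p h IH].
  have := sqiZ 0 (sqi_ocind 0 0); congr sqi; apply/funext => x.
  by rewrite /stepfun big_nil mul0r.
have := sqiD (sqiZ p.1.1 (sqi_ocind p.1.2 p.2)) IH; congr sqi; apply/funext => x.
by rewrite /stepfun big_cons; case: (_ && _).
Qed.

Lemma Rintegral_stepfun (a b : R) (h : seq (R * R * R)) : a <= b ->
  all (fun p => p.1.2 < p.2) h ->
  \int[leb]_x ((a < x <= b)%R%:R * stepfun h x) = step_mass a b h.
Proof.
move=> ab; elim: h => [_|p h IH /= /andP[pp hh]].
  rewrite /step_mass big_nil; under eq_Rintegral do rewrite /stepfun big_nil mulr0.
  by rewrite Rintegral_cst// mul0r.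
rewrite /step_mass big_cons -/(step_mass a b h) -IH//.
transitivity (\int[leb]_x (p.1.1 * ((a < x <= b)%R%:R * (p.1.2 < x <= p.2)%R%:R) +
   (a < x <= b)%R%:R * stepfun h x)).
  apply: eq_Rintegral => x _; rewrite /stepfun big_cons mulrDr; congr (_ + _).
  by rewrite mulrCA; case: (p.1.2 < x <= p.2).
have i1 := integrable_mulf (sqi_ocind a b) (sqi_ocind p.1.2 p.2).
rewrite RintegralD//; last 2 first.
- exact: integrableZ.
- by apply: integrable_mulf; [exact: sqi_ocind|exact: sqi_stepfun].
rewrite RintegralZl//; congr (_ * _ + _).
transitivity (\int[leb]_x ((Num.max a p.1.2 < x <= Num.min b p.2)%R%:R)).
  apply: eq_Rintegral => x _; rewrite -natrM mulnb gt_max le_min; congr ((nat_of_bool _)%:R : R).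
  by rewrite andbACA.
rewrite Rintegral_ocind /ramp.
by case: (leP a p.1.2) => h1; case: (leP b p.2) => h2; case: (leP p.2 a) => h3;
  rewrite /Order.max /Order.min; repeat case: ifP; lra.
Qed.

End step_approximation.

Section cameron_martin_limit.
Context {R : realType} d (Omega : measurableType d) (P : probability Omega R).
Notation leb := (@lebesgue_measure R).
Variable B : R -> Omega -> R.
Hypothesis hB : two_sided_BM P B.

Let mB s : measurable_fun setT (B s). Proof. by case: hB. Qed.

Definition mass (a b : R) (k : R -> R) : R := \int[leb]_x ((a < x <= b)%R%:R * k x).

Lemma measurable_stepint (h : seq (R * R * R)) : measurable_fun setT (stepint B h).
Proof. by apply: measurable_sum => p; apply: measurable_funM => //; exact: measurable_funB. Qed.

Lemma sqi_cst (c : R) : sqi P (fun=> c).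
Proof.
split; first exact: measurable_cst.
apply: (eq_integrable _ (EFin \o cst (c ^+ 2))) => //.
exact: finite_measure_integrable_cst.
Qed.

Lemma sqi_of_le (d' : measure_display) (T : measurableType d') (mu : {measure set T -> \bar R})
    (u : T -> R) (e : R) :
  measurable_fun setT u -> (\int[mu]_x (u x ^+ 2)%:E <= e%:E)%E ->
  sqi mu u /\ \int[mu]_x (u x ^+ 2) <= e.
Proof.
move=> mu_ le.
have iu : mu.-integrable setT (EFin \o (fun x => u x ^+ 2)).
  apply/integrableP; split; first by apply/measurable_EFinP; exact: measurable_funX.
  apply: le_lt_trans (ltry e); apply: le_trans le.
  under eq_integral => x _ do rewrite /= ger0_norm ?sqr_ge0//.
  by [].
by split; [split|rewrite -lee_fin EFin_Rintegral].
Qed.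

Lemma wiener_integral_approx (k : R -> R) (Y : Omega -> R) (e : R) :
  measurable_fun setT k -> wiener_integral P B k Y -> 0 < e ->
  exists h, [/\ all (fun p => p.1.2 < p.2) h,
    sqi leb (fun x => k x - stepfun h x) /\ \int[leb]_x ((k x - stepfun h x) ^+ 2) <= e &
    sqi P (fun w => Y w - stepint B h w) /\ \int[P]_w ((Y w - stepint B h w) ^+ 2) <= e].
Proof.
move=> mk [mY [hs [hlt [c1 c2]]]] e0.
have ev (u : nat -> \bar R) : u n @[n --> \oo] --> 0%E -> \forall n \near \oo, (u n <= e%:E)%E.
  move=> /fine_cvgP[fu] /cvgrPdist_le/(_ e e0) H.
  near=> n; have fn : u n \is a fin_num by near: n.
  rewrite -(fineK fn) lee_fin; have : `|0 - fine (u n)| <= e by near: n.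
  by rewrite sub0r normrN; apply: le_trans; exact: ler_norm.
have [n _ hn] : \forall n \near \oo, (\int[leb]_x ((k x - stepfun (hs n) x) ^+ 2)%:E <= e%:E)%E /\
   (\int[P]_w ((Y w - stepint B (hs n) w) ^+ 2)%:E <= e%:E)%E.
  by near=> n; split; near: n; exact: ev.
have [h1 h2] := hn n (leqnn n).
exists (hs n); split; first exact: hlt.
- by apply: sqi_of_le h1; apply: measurable_funB => //; have [] := sqi_stepfun (hs n).
- by apply: sqi_of_le h2; apply: measurable_funB => //; exact: measurable_stepint.
Unshelve. all: by end_near. Qed.

Lemma integrable_mass (a b : R) (k : R -> R) (h : seq (R * R * R)) :
  sqi leb (fun x => k x - stepfun h x) ->
  leb.-integrable setT (EFin \o (fun x => (a < x <= b)%R%:R * k x)).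
Proof.
move=> s.
have := integrable_addf (integrable_mulf (sqi_ocind a b) s)
  (integrable_mulf (sqi_ocind a b) (sqi_stepfun h)).
by apply: eq_integrable => // x _ /=; congr EFin; ring.
Qed.

Lemma mass_step_mass (a b e : R) (k : R -> R) (h : seq (R * R * R)) : a <= b ->
  all (fun p => p.1.2 < p.2) h -> sqi leb (fun x => k x - stepfun h x) ->
  \int[leb]_x ((k x - stepfun h x) ^+ 2) <= e ->
  (mass a b k - step_mass a b h) ^+ 2 <= (b - a) * e.
Proof.
move=> ab hh s se; rewrite -Rintegral_stepfun// /mass -RintegralB//; last 2 first.
- exact: integrable_mass s.
- by apply: integrable_mulf; [exact: sqi_ocind|exact: sqi_stepfun].
rewrite (_ : \int[leb]_x _ = \int[leb]_x ((a < x <= b)%R%:R * (k x - stepfun h x))); last first.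
  by apply: eq_Rintegral => x _; rewrite mulrBr.
apply: le_trans (cauchy_schwarz (sqi_ocind a b) s) _.
rewrite ler_pM ?Rintegral_sqr_ge0//.
rewrite (_ : \int[leb]_x _ = \int[leb]_x ((a < x <= b)%R%:R)); last first.
  by apply: eq_Rintegral => x _; case: (a < x <= b); rewrite ?expr1n ?expr0n.
by rewrite Rintegral_ocind; case: (leP 0 (b - a)) => //; rewrite subr_lt0 ltNge ab.
Qed.

(** The square of the density is exp(c^2 (b - a)) times the density for 2c, whose integral is 1 by
    [cameron_martin_step] with no test function. *)
Lemma sqi_cm_density (c a b : R) : a < b -> sqi P (cm_density B c a b).
Proof.
move=> ab.
have mD c' : measurable_fun setT (cm_density B c' a b).
  apply: measurableT_comp => //; apply: measurable_funB => //; apply: measurable_funM => //.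
  exact: measurable_funB.
split => //.
have i2 : P.-integrable setT (EFin \o cm_density B (2 * c) a b).
  apply/integrableP; split; first exact/measurable_EFinP.
  under eq_integral => x _ do rewrite /= ger0_norm ?expR_ge0//.
  have := @cameron_martin_step _ _ _ P B hB (2 * c) a b 0 (fun=> [::]) (fun _ => cst 1) ab
    (fun _ => measurable_cst _) (fun _ _ => ler01).
  move=> E; rewrite (_ : (\int[P]_x _)%E = (\int[P]_w 1%:E)%E); last first.
    by transitivity (\int[P]_w (\prod_(j < 0) cst 1 (stepint B [::] w) *
       cm_density B (2 * c) a b w)%:E)%E; [|rewrite E];
      apply: eq_integral => w _; rewrite big_ord0 ?mul1r.
  by rewrite integral_cst// mul1e (le_lt_trans (probability_le1 _ _))// ltry.
have := integrableZ (expR (c ^+ 2 * (b - a))) i2.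
apply: eq_integrable => // w _ /=; congr EFin.
by rewrite /cm_density -expRD -expRM_natl; congr expR; field.
Qed.

End cameron_martin_limit.

Section lipschitz_products.
Context {R : realType}.

Lemma prodr01 m (x : 'I_m -> R) : (forall j, 0 <= x j <= 1) -> 0 <= \prod_(j < m) x j <= 1.
Proof.
move=> h; apply/andP; split; first by apply: prodr_ge0 => j _; case/andP: (h j).
by apply: Num.Theory.prodr_ile1 => j _.
Qed.

Lemma prod_diff_le m (x y : 'I_m -> R) :
  (forall j, 0 <= x j <= 1) -> (forall j, 0 <= y j <= 1) ->
  `|\prod_(j < m) x j - \prod_(j < m) y j| <= \sum_(j < m) `|x j - y j|.
Proof.
elim: m x y => [x y _ _|m IH x y hx hy].
  by rewrite !big_ord0 subrr normr0.
rewrite !big_ord_recl.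
set X := \prod_(i < m) x _; set Y := \prod_(i < m) y _.
have h := IH (fun j => x (lift ord0 j)) (fun j => y (lift ord0 j)) (fun j => hx _) (fun j => hy _).
have X01 : 0 <= X <= 1.
  by apply: prodr01.
rewrite (_ : x ord0 * X - y ord0 * Y = (x ord0 - y ord0) * X + y ord0 * (X - Y)); last by ring.
rewrite (le_trans (ler_normD _ _))// !normrM lerD//.
  case/andP: X01 => X0 X1; rewrite (ger0_norm X0) -[leRHS]mulr1 ler_wpM2l//.
case/andP: (hy ord0) => Y0 Y1; rewrite (ger0_norm Y0).
by apply: le_trans h; rewrite -[leRHS]mul1r ler_wpM2r.
Qed.

Context d (Omega : measurableType d) (P : probability Omega R).

Lemma sqi_norm_Rintegral (u W : Omega -> R) : sqi P u -> sqi P W -> (forall w, 0 <= W w) ->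
  \int[P]_w (`|u w| * W w) <= Num.sqrt (\int[P]_w (u w ^+ 2)) * Num.sqrt (\int[P]_w (W w ^+ 2)).
Proof.
move=> [mu iu] sW W0.
have su : sqi P (fun w => `|u w|).
  split; first exact: measurableT_comp.
  by apply: eq_integrable iu => // w _ /=; rewrite real_normK// num_real.
apply: (le_trans (ler_norm _)); apply: le_trans (cauchy_schwarz_norm su sW) _.
by rewrite le_eqVlt; apply/orP; left; apply/eqP; congr (Num.sqrt _ * _);
  apply: eq_Rintegral => w _; rewrite real_normK// num_real.
Qed.

(** This bounds the effect of L2 errors on both sides of the Cameron-Martin formula: a difference of
    products in [0,1] is at most the sum of the m differences, and Cauchy-Schwarz separates each of
    them from the weight [W]. *)
Lemma lipschitz_prod_diff m (phi : 'I_m -> R -> R) (K e : R) (Y Z : 'I_m -> Omega -> R)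
    (W : Omega -> R) :
  0 <= K -> 0 <= e ->
  (forall j, measurable_fun setT (phi j)) -> (forall j x, 0 <= phi j x <= 1) ->
  (forall j x y, `|phi j x - phi j y| <= K * `|x - y|) ->
  (forall j, measurable_fun setT (Y j)) -> (forall j, measurable_fun setT (Z j)) ->
  (forall j, sqi P (fun w => Y j w - Z j w)) ->
  (forall j, \int[P]_w ((Y j w - Z j w) ^+ 2) <= e ^+ 2) ->
  sqi P W -> (forall w, 0 <= W w) ->
  `|\int[P]_w (\prod_(j < m) phi j (Y j w) * W w) -
    \int[P]_w (\prod_(j < m) phi j (Z j w) * W w)| <=
  m%:R * (K * (e * Num.sqrt (\int[P]_w (W w ^+ 2)))).
Proof.
move=> K0 e0 mphi phi01 lip mY mZ sYZ hYZ sW W0.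
have iW : P.-integrable setT (EFin \o W).
  have := integrable_mulf (sqi_cst P 1) sW.
  by apply: eq_integrable => // w _ /=; rewrite mul1r.
have iprod (X : 'I_m -> Omega -> R) : (forall j, measurable_fun setT (X j)) ->
    P.-integrable setT (EFin \o (fun w => \prod_(j < m) phi j (X j w) * W w)).
  move=> mX; apply: (@integrable_mul_bounded _ _ _ _ _ _ 1) => //.
    by apply: measurable_prod => j _; exact: measurableT_comp.
  by move=> w; have /andP[h0 h1] := prodr01 (fun j => phi01 j (X j w)); rewrite ger0_norm.
have inorm j : P.-integrable setT (EFin \o (fun w => `|Y j w - Z j w| * W w)).
  apply: (@integrable_le _ _ _ _ _ (fun w => `|(Y j w - Z j w) * W w|)).
  - apply: measurable_funM; last by case: sW.
    by apply: measurableT_comp => //; case: (sYZ j).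
  - by move=> w; rewrite normrM normr_id normrM.
  - exact: integrable_norm (integrable_mulf (sYZ j) sW).
rewrite -RintegralB; [|by []|exact: iprod|exact: iprod].
apply: (le_trans (le_normr_Rintegral measurableT _)).
  by apply: integrable_subf; exact: iprod.
apply: (@le_trans _ _ (\int[P]_w (\sum_(j < m) K * (`|Y j w - Z j w| * W w)))).
  apply: le_Rintegral => //.
  - by apply: integrable_norm; apply: integrable_subf; exact: iprod.
  - by apply: integrable_sumf => j; apply: integrableZ; exact: inorm.
  move=> w _; rewrite -mulrBl normrM (ger0_norm (W0 w)).
  rewrite (_ : \sum_(j < m) _ = (\sum_(j < m) K * `|Y j w - Z j w|) * W w); last first.
    by rewrite mulr_suml; apply: eq_bigr => j _; rewrite mulrA.
  rewrite ler_wpM2r// (le_trans (prod_diff_le _ _))//.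
  by apply: ler_sum => j _; exact: lip.
rewrite Rintegral_sum; last by move=> j; apply: integrableZ; exact: inorm.
rewrite mulr_natl -[m in leRHS]card_ord -sumr_const; apply: ler_sum => j _.
rewrite RintegralZl// ler_wpM2l//; apply: le_trans (sqi_norm_Rintegral (sYZ j) sW W0) _.
rewrite ler_wpM2r ?sqrtr_ge0// -[leRHS]ger0_norm// -sqrtr_sqr.
by rewrite ler_sqrt ?exprn_ge0.
Qed.

End lipschitz_products.

Section cameron_martin_paths.
Context {R : realType} d (Omega : measurableType d) (P : probability Omega R).
Notation leb := (@lebesgue_measure R).
Variable B : R -> Omega -> R.
Hypothesis hB : two_sided_BM P B.

Lemma cm_density_ge0 c a b w : 0 <= cm_density B c a b w.
Proof. exact: expR_ge0. Qed.

(** Indicators are not stable under L2 approximation of the variables; Lipschitz test functions are,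
    and both sides of the formula for elementary integrals converge. *)
Lemma cameron_martin_lipschitz (c a b K : R) m (k : 'I_m -> R -> R) (Y : 'I_m -> Omega -> R)
    (phi : 'I_m -> R -> R) :
  a < b -> (forall j, measurable_fun setT (k j)) ->
  (forall j, wiener_integral P B (k j) (Y j)) -> 0 <= K ->
  (forall j, measurable_fun setT (phi j)) -> (forall j x, 0 <= phi j x <= 1) ->
  (forall j x y, `|phi j x - phi j y| <= K * `|x - y|) ->
  \int[P]_w (\prod_(j < m) phi j (Y j w) * cm_density B c a b w) =
  \int[P]_w (\prod_(j < m) phi j (Y j w + c * mass a b (k j))).
Proof.
move=> ab mk hY K0 mphi phi01 lip.
have sD := sqi_cm_density hB c ab; have D0 := cm_density_ge0 c a b.
have mY j : measurable_fun setT (Y j) by case: (hY j).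
set L := LHS; set Rr := RHS.
have Rr1 : Rr = \int[P]_w (\prod_(j < m) phi j (Y j w + c * mass a b (k j)) * 1).
  by apply: eq_Rintegral => w _; rewrite mulr1.
pose Q := Num.sqrt (\int[P]_w (cm_density B c a b w ^+ 2)).
(* An L2 error e in kernel and integral moves the shifted variable by at most e (1 + |c| sqrt(b -
   a)), the second term coming from [mass_step_mass]. The factor 2 in 2 M e pays for (x + y)^2 <= 2
   x^2 + 2 y^2. *)
pose M := 1 + `|c| * Num.sqrt (b - a).
have M0 : 0 <= M by rewrite addr_ge0// mulr_ge0// sqrtr_ge0.
pose C := m%:R * (K * Q) + m%:R * (K * (2 * M)).
have Q0 : 0 <= Q by exact: sqrtr_ge0.
have C0 : 0 <= C by rewrite addr_ge0// mulr_ge0// mulr_ge0// mulr_ge0.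
have main e : 0 < e -> `|L - Rr| <= C * e.
  move=> e0; have e20 : 0 < e ^+ 2 by rewrite exprn_gt0.
  pose hh j := cid (wiener_integral_approx hB (mk j) (hY j) e20).
  pose h j := projT1 (hh j).
  have hlt j : all (fun p => p.1.2 < p.2) (h j) by case: (projT2 (hh j)).
  have [hk hY2] : (forall j, sqi leb (fun x => k j x - stepfun (h j) x) /\
       \int[leb]_x ((k j x - stepfun (h j) x) ^+ 2) <= e ^+ 2) /\
     (forall j, sqi P (fun w => Y j w - stepint B (h j) w) /\
       \int[P]_w ((Y j w - stepint B (h j) w) ^+ 2) <= e ^+ 2).
    by split => j; case: (projT2 (hh j)).
  have mS j := measurable_stepint hB (h j).
  have E1 := lipschitz_prod_diff K0 (ltW e0) mphi phi01 lip mY mS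
    (fun j => (hY2 j).1) (fun j => (hY2 j).2) sD D0.
  have Me0 : 0 <= 2 * M * e by rewrite !mulr_ge0// ltW.
  have mYs j : measurable_fun setT (fun w => Y j w + c * mass a b (k j)) by exact: measurable_funD.
  have mSs j : measurable_fun setT (fun w => stepint B (h j) w + c * step_mass a b (h j)).
    exact: measurable_funD.
  have dE j w : (Y j w + c * mass a b (k j)) - (stepint B (h j) w + c * step_mass a b (h j)) =
     1 * (Y j w - stepint B (h j) w) + 1 * (c * (mass a b (k j) - step_mass a b (h j))) by ring.
  have sd j : sqi P (fun w => (Y j w + c * mass a b (k j)) -
      (stepint B (h j) w + c * step_mass a b (h j))).
    have := sqiD (sqiZ 1 (hY2 j).1) (sqiZ 1 (sqi_cst P (c * (mass a b (k j) - step_mass a b (h j))))).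
    by congr sqi; apply/funext => w; rewrite dE.
  have sde j : \int[P]_w (((Y j w + c * mass a b (k j)) -
      (stepint B (h j) w + c * step_mass a b (h j))) ^+ 2) <= (2 * M * e) ^+ 2.
    set mm := c * (mass a b (k j) - step_mass a b (h j)).
    have mme : mm ^+ 2 <= c ^+ 2 * ((b - a) * e ^+ 2).
      rewrite exprMn ler_wpM2l ?sqr_ge0//.
      by apply: mass_step_mass (hlt j) (hk j).1 (hk j).2; exact: ltW.
    apply: (@le_trans _ _ (\int[P]_w (2 * (Y j w - stepint B (h j) w) ^+ 2 + 2 * mm ^+ 2))).
      apply: le_Rintegral => //.
      - by case: (sd j).
      - apply: integrable_addf; first by apply: integrableZ; case: (hY2 j).1.
        by have := integrableZ 2 (sqi_cst P mm).2.
      by move=> w _; rewrite dE !mul1r -/mm; have := sqr_ge0 (Y j w - stepint B (h j) w - mm); nra.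
    rewrite RintegralD//; last 2 first.
    - by apply: integrableZ; case: (hY2 j).1.
    - by have := integrableZ 2 (sqi_cst P mm).2.
    rewrite RintegralZl//; last by case: (hY2 j).1.
    rewrite Rintegral_cst//= probability_setT/= mulr1.
    have h1 := (hY2 j).2.
    have h2 : `|c| * Num.sqrt (b - a) >= 0 by rewrite mulr_ge0// sqrtr_ge0.
    have h3 : (`|c| * Num.sqrt (b - a)) ^+ 2 = c ^+ 2 * (b - a).
      by rewrite exprMn sqr_sqrtr ?subr_ge0 ?(ltW ab)// real_normK// num_real.
    rewrite /M; set s := `|c| * _ in h2 h3 *.
    have h4 : mm ^+ 2 <= s ^+ 2 * e ^+ 2 by rewrite h3 -mulrA.
    have h5 : (2 * (1 + s) * e) ^+ 2 = 4 * e ^+ 2 + 8 * (s * e ^+ 2) + 4 * (s ^+ 2 * e ^+ 2) by ring.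
    have h6 : 0 <= s * e ^+ 2 by rewrite mulr_ge0// ltW.
    have h7 : 0 <= s ^+ 2 * e ^+ 2 by rewrite mulr_ge0// ?sqr_ge0// ltW.
    by rewrite h5; lra.
  have E2 := lipschitz_prod_diff K0 Me0 mphi phi01 lip mYs mSs sd sde (sqi_cst P 1) (fun _ => ler01).
  have E3 : \int[P]_w (\prod_(j < m) phi j (stepint B (h j) w) * cm_density B c a b w) =
     \int[P]_w (\prod_(j < m) phi j (stepint B (h j) w + c * step_mass a b (h j)) * 1).
    rewrite /Rintegral; congr fine.
    rewrite cameron_martin_step//; last by move=> j x; case/andP: (phi01 j x).
    by apply: eq_integral => w _; rewrite mulr1.
  rewrite Rr1 /L; rewrite E3 in E1.
  have q1 : Num.sqrt (\int[P]_w (1 ^+ 2)) = 1.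
    by rewrite Rintegral_cst//= probability_setT/= mulr1 expr1n sqrtr1.
  rewrite q1 mulr1 in E2; rewrite distrC in E2; rewrite -/Q in E1.
  rewrite (_ : C * e = m%:R * (K * (e * Q)) + m%:R * (K * (2 * M * e))); last by rewrite /C; ring.
  exact: le_trans (ler_distD _ _ _) (lerD E1 E2).
apply/eqP; rewrite -subr_eq0 -normr_le0; apply/ler_addgt0Pr => e e0; rewrite add0r.
apply: le_trans (main (e / (C + 1)) _) _; first by rewrite divr_gt0// ltr_wpDl.
rewrite mulrA ler_pdivrMr ?ltr_wpDl// mulrC ler_wpM2l ?(ltW e0)// lerDl//.
Qed.

(** A Lipschitz approximation from below of the indicator of x < q. It is 0 at x = q, so the
    convergence holds at every point and atoms do no harm. *)
Definition soft_lt (n : nat) (q x : R) : R := Num.max 0 (Num.min 1 (n%:R * (q - x))).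

Lemma soft_lt01 n q x : 0 <= soft_lt n q x <= 1.
Proof. by rewrite /soft_lt le_max lexx/= ge_max ler01/= ge_min lexx. Qed.

Lemma measurable_soft_lt n q : measurable_fun setT (soft_lt n q).
Proof.
have -> : soft_lt n q = cst 0 \max (cst 1 \min (fun x => n%:R * (q - x))) by [].
apply: measurable_maxr => //; apply: measurable_minr => //.
by apply: measurable_funM => //; exact: measurable_funB.
Qed.

Lemma soft_lt_lipschitz n q x y : `|soft_lt n q x - soft_lt n q y| <= n%:R * `|x - y|.
Proof.
have : `|n%:R * (q - x) - n%:R * (q - y)| <= n%:R * `|x - y|.
  by rewrite -mulrBr normrM ger0_norm// ler_wpM2l// (_ : q - x - (q - y) = - (x - y)) ?normrN//; ring.
apply: le_trans; rewrite /soft_lt; set u := n%:R * (q - x); set v := n%:R * (q - y).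
have := ler_norm (u - v); have := ler_norm (v - u); rewrite (distrC v u) => h1 h2.
rewrite ler_norml /Order.max /Order.min; repeat case: ifP; lra.
Qed.

Lemma soft_lt_cvg q x : soft_lt n q x @[n --> \oo] --> ((x < q)%R%:R : R).
Proof.
case: ltP => xq; last first.
  apply: cvg_near_cst; near=> n; rewrite /soft_lt.
  have : n%:R * (q - x) <= 0 by rewrite mulr_ge0_le0// subr_le0.
  by move=> h; apply/max_idPl; rewrite ge_min h orbT.
apply: cvg_near_cst; near=> n; rewrite /soft_lt.
have h : 1 <= n%:R * (q - x).
  rewrite -ler_pdivrMr ?subr_gt0// div1r.
  near: n; exact: nbhs_infty_ger.
by rewrite (min_idPl h); apply/max_idPr.
Unshelve. all: by end_near. Qed.

Lemma cameron_martin_cyl (c a b : R) m (k : 'I_m -> R -> R) (Y : 'I_m -> Omega -> R)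
    (q : 'I_m -> R) :
  a < b -> (forall j, measurable_fun setT (k j)) ->
  (forall j, wiener_integral P B (k j) (Y j)) ->
  \int[P]_w (\prod_(j < m) (Y j w < q j)%R%:R * cm_density B c a b w) =
  \int[P]_w (\prod_(j < m) (Y j w + c * mass a b (k j) < q j)%R%:R).
Proof.
move=> ab mk hY.
have sD := sqi_cm_density hB c ab; have D0 := cm_density_ge0 c a b.
have mY j : measurable_fun setT (Y j) by case: (hY j).
have iD : P.-integrable setT (EFin \o cm_density B c a b).
  have := integrable_mulf (sqi_cst P 1) sD.
  by apply: eq_integrable => // w _ /=; rewrite mul1r.
have mltr (Z : Omega -> R) r : measurable_fun setT Z ->
    measurable_fun setT (fun w => (Z w < r)%R%:R : R).
  by move=> mZ; apply: measurableT_comp (measurable_ltind r) mZ.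
have E n := cameron_martin_lipschitz c ab mk hY (ler0n R n)
  (fun j => measurable_soft_lt n (q j)) (fun j => soft_lt01 n (q j))
  (fun j => soft_lt_lipschitz n (q j)).
have c1 : \int[P]_w (\prod_(j < m) soft_lt n (q j) (Y j w) * cm_density B c a b w) @[n --> \oo] -->
   \int[P]_w (\prod_(j < m) (Y j w < q j)%R%:R * cm_density B c a b w).
  apply: (@Rintegral_dct _ _ _ _ _ _ (cm_density B c a b)) => //.
  - move=> n; apply: measurable_funM; last by case: sD.
    by apply: measurable_prod => j _; apply: measurableT_comp => //; exact: measurable_soft_lt.
  - apply: measurable_funM; last by case: sD.
    by apply: measurable_prod => j _; exact: mltr.
  - move=> w; apply: cvgMl; apply: cvg_big => [|j _]; first exact: mul_continuous.
    exact: soft_lt_cvg.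
  - move=> n w; rewrite normrM (ger0_norm (D0 w)) -[leRHS]mul1r ler_wpM2r//.
    by have /andP[h0 h1] := prodr01 (fun j => soft_lt01 n (q j) (Y j w)); rewrite ger0_norm.
have c2 : \int[P]_w (\prod_(j < m) soft_lt n (q j) (Y j w + c * mass a b (k j))) @[n --> \oo] -->
   \int[P]_w (\prod_(j < m) (Y j w + c * mass a b (k j) < q j)%R%:R).
  apply: (@Rintegral_dct _ _ _ _ _ _ (fun=> 1)) => //.
  - move=> n; apply: measurable_prod => j _; apply: measurableT_comp.
      exact: measurable_soft_lt.
    exact: measurable_funD.
  - by apply: measurable_prod => j _; apply: mltr; exact: measurable_funD.
  - move=> w; apply: cvg_big => [|j _]; first exact: mul_continuous.
    exact: soft_lt_cvg.
  - by have := (sqi_cst P 1).2; apply: eq_integrable => // w _ /=; rewrite expr1n.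
  - move=> n w.
    have /andP[h0 h1] := prodr01 (fun j => soft_lt01 n (q j) (Y j w + c * mass a b (k j))).
    by rewrite ger0_norm.
apply: (cvg_unique _ c1) => //; apply: cvg_trans c2; apply: near_eq_cvg.
by apply: nearW => n; rewrite E.
Qed.

End cameron_martin_paths.

(** * The Cameron-Martin formula on the product sigma-algebra and null sets under shifts *)

Section cylinders.
Context {R : realType}.

Lemma measurable_forall_in d (T : measurableType d) (I : eqType) (l : seq I) (F : I -> set T) :
  (forall i, i \in l -> measurable (F i)) -> measurable [set w | forall i, i \in l -> F i w].
Proof.
elim: l => [_|i l IH mF].
  by rewrite (_ : [set w | _] = setT)//; apply/seteqP; split.
rewrite (_ : [set w | _] = F i `&` [set w | forall i, i \in l -> F i w]).
  apply: measurableI; first by apply: mF; rewrite mem_head.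
  by apply: IH => j jl; apply: mF; rewrite inE jl orbT.
apply/seteqP; split => [w /= h|w /= [h1 h2] j]; last by rewrite inE => /orP[/eqP ->//|]; exact: h2.
by split; [apply: h; rewrite mem_head|move=> j jl; apply: h; rewrite inE jl orbT].
Qed.

Lemma measurable_forall d (T : measurableType d) (J : countType) (F : J -> set T) :
  (forall i, measurable (F i)) -> measurable [set w | forall i, F i w].
Proof.
move=> mF; rewrite (_ : [set w | _] = ~` \bigcup_i ~` F i).
  apply: measurableC; apply: countable_bigcupT_measurable => [|i]; last exact: measurableC.
  exact: countableP.
rewrite setC_bigcup; apply/seteqP; split => w /= h i; first by move=> _; apply.
by apply: contrapT => nF; exact: (h i I nF).
Qed.

Definition cyl (T : R) : set (set (R -> R)) :=
  [set E | exists2 l : seq (R * R), all (fun p => 0 <= p.1 <= T) l &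
    E = [set x | forall p, p \in l -> x p.1 < p.2]].

Notation paths T := (g_sigma_algebraType (cyl T)).

Lemma cyl_setI T : setI_closed (cyl T).
Proof.
move=> _ _ [l al ->] [l' al' ->]; exists (l ++ l'); first by rewrite all_cat al al'.
apply/seteqP; split => x /=.
  by move=> [h h'] p; rewrite mem_cat => /orP[]; [exact: h|exact: h'].
by move=> h; split => p pl; apply: h; rewrite mem_cat pl ?orbT.
Qed.

Lemma cyl_setT T : cyl T setT.
Proof. by exists [::] => //; apply/seteqP; split. Qed.

Lemma measurable_to_paths T d (V : measurableType d) (Th : V -> R -> R) :
  (forall s, 0 <= s <= T -> measurable_fun setT (fun w => Th w s)) ->
  measurable_fun setT (Th : V -> paths T).
Proof.
move=> mTh; apply: (@measurability _ _ _ (paths T) setT Th (cyl T) erefl).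
move=> _ [_ [l al ->] <-]; rewrite setTI.
apply: measurable_forall_in => p pl; rewrite -[X in measurable X]setTI.
have := mTh _ (allP al _ pl) measurableT _ (measurable_itv `]-oo, p.2[).
by congr measurable.
Qed.

Lemma measurable_coord T s : 0 <= s <= T -> measurable_fun setT (fun x : paths T => x s).
Proof.
move=> sT; apply: (measurability _ (RGenInftyO.measurableE R)) => //.
move=> _ [_ [q ->] <-]; rewrite setTI; apply: sub_sigma_algebra.
exists [:: (s, q)]; first by rewrite /= sT.
apply/seteqP; split => x /=; rewrite in_itv/=.
  by move=> h p; rewrite inE => /eqP ->.
by move=> h; apply: (h (s, q)); rewrite mem_head.
Qed.

Lemma measurable_add_path T (h : R -> R) :
  measurable_fun setT ((fun x s => x s + h s) : paths T -> paths T).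
Proof.
apply: measurable_to_paths => s sT.
by apply: measurable_funD => //; exact: measurable_coord.
Qed.

End cylinders.
Notation paths T := (g_sigma_algebraType (cyl T)).

Section shifts.
Context {R : realType} d (Omega : measurableType d) (P : probability Omega R).
Variable B : R -> Omega -> R.
Hypothesis hB : two_sided_BM P B.
Variables (T : R) (k : R -> R -> R) (X : R -> Omega -> R).
Hypothesis mk : forall s, 0 <= s <= T -> measurable_fun setT (k s).
Hypothesis hX : forall s, 0 <= s <= T -> wiener_integral P B (k s) (X s).

Let xpath w : R -> R := fun s => X s w.

Lemma measurable_path : measurable_fun setT (xpath : Omega -> paths T).
Proof. by apply: measurable_to_paths => s /hX[]. Qed.

(** Both sides are image measures evaluated at S; on the pi-system [cyl] they agree by
    [cameron_martin_cyl]. *)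
Lemma cameron_martin (c a b : R) (S : set (paths T)) : a < b -> measurable S ->
  (\int[P]_(w in [set w | S (xpath w)]) (cm_density B c a b w)%:E =
   P [set w | S (fun s => X s w + c * mass a b (k s))%R])%E.
Proof.
move=> ab mS.
have sD := sqi_cm_density hB c ab.
have [mD _] := sD; have D0 := cm_density_ge0 B c a b.
pose Th w : R -> R := fun s => X s w + c * mass a b (k s).
have mTh : measurable_fun setT (Th : Omega -> paths T).
  by apply: measurable_to_paths => s /hX[mX _]; exact: measurable_funD.
rewrite -mdensE.
have agree E : cyl T E -> mdens P mD D0 (xpath @^-1` E) = P (Th @^-1` E).
  move=> [l al ->].
  have mkl (j : 'I_(size l)) : measurable_fun setT (k (tnth (in_tuple l) j).1).
    by apply: mk; apply: (allP al); exact: mem_tnth.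
  have hXl (j : 'I_(size l)) : wiener_integral P B (k (tnth (in_tuple l) j).1) (X (tnth (in_tuple l) j).1).
    by apply: hX; apply: (allP al); exact: mem_tnth.
  have E0 := cameron_martin_cyl hB c (fun j => (tnth (in_tuple l) j).2) ab mkl hXl.
  have prodE (x : R -> R) : \prod_(j < size l)
      (x (tnth (in_tuple l) j).1 < (tnth (in_tuple l) j).2)%R%:R =
      (x \in [set x | forall p, p \in l -> x p.1 < p.2])%:R :> R.
    have [xi|xi] := boolP (x \in _).
      rewrite big1// => j _; move: xi; rewrite inE => -> //; exact: mem_tnth.
    apply/eqP/prodf_eq0; apply: contrapT => h; move: xi; rewrite notin_setE; apply => p /=.
    move=> /(tnthP (in_tuple l))[j ->]; apply: contrapT => nx; apply: h; exists j => //.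
    by move/negP/negbTE: nx => ->.
  have mC (Z : Omega -> R -> R) : measurable_fun setT (Z : Omega -> paths T) ->
     measurable [set w | Z w \in [set x | forall p, p \in l -> x p.1 < p.2]].
    move=> mZ; rewrite -[X in measurable X]setTI.
    have := mZ measurableT [set x | forall p, p \in l -> x p.1 < p.2].
    have H : measurable ([set x | forall p, p \in l -> x p.1 < p.2] : set (paths T)).
      by apply: sub_sigma_algebra; exists l.
    by move=> /(_ H); congr (measurable (_ `&` _)); apply/seteqP; split => w /=; rewrite inE.
  rewrite mdensE.
  transitivity (\int[P]_w ((\prod_(j < size l) (X (tnth (in_tuple l) j).1 w <
     (tnth (in_tuple l) j).2)%R%:R) * cm_density B c a b w)%:E)%E.
    rewrite integral_mkcond; apply: eq_integral => w _; rewrite patchE (prodE (xpath w)).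
    rewrite (_ : (w \in _) = (xpath w \in [set x | forall p, p \in l -> x p.1 < p.2])); last first.
      by apply/idP/idP; rewrite !inE.
    by case: (_ \in _); rewrite ?mul1r ?mul0r.
  transitivity (\int[P]_w (\prod_(j < size l) (X (tnth (in_tuple l) j).1 w +
     c * mass a b (k (tnth (in_tuple l) j).1) < (tnth (in_tuple l) j).2)%R%:R)%:E)%E.
    rewrite -!EFin_Rintegral ?E0//.
      under eq_fun do rewrite (prodE (Th _)).
      apply: (@integrable_le _ _ _ _ _ (cst 1)).
      + rewrite (_ : (fun w => _) = \1_[set w | Th w \in [set x | forall p, p \in l -> x p.1 < p.2]]).
          by apply: measurable_indic; exact: mC.
        by apply/funext => w; rewrite indicE mem_setE.
      + by move=> w; exact: normr_bool_le1.
      + exact: finite_measure_integrable_cst.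
    under eq_fun do rewrite (prodE (xpath _)).
    apply: (@integrable_mul_bounded _ _ _ _ _ _ 1).
    + rewrite (_ : (fun w => _) = \1_[set w | xpath w \in [set x | forall p, p \in l -> x p.1 < p.2]]).
        by apply: measurable_indic; apply: mC; exact: measurable_path.
      by apply/funext => w; rewrite indicE mem_setE.
    + by move=> w; exact: normr_bool_le1.
    + have := integrable_mulf (sqi_cst P 1) sD.
      by apply: eq_integrable => // w _ /=; rewrite mul1r.
  transitivity (\int[P]_w (\1_(Th @^-1` [set x | forall p, p \in l -> x p.1 < p.2]) w)%:E)%E.
    by apply: eq_integral => w _; rewrite (prodE (Th w)) indicE.
  rewrite integral_indic ?setIT//.
  by have := mC _ mTh; congr measurable; apply/seteqP; split => w /=; rewrite inE.
apply: (eq_preimage_measure measurable_path mTh (@cyl_setI R T) (cyl_setT T)) => //.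
change (mdens P mD D0 (xpath @^-1` setT) < +oo)%E.
rewrite agree; last exact: cyl_setT.
by rewrite preimage_setT (le_lt_trans (probability_le1 _ _))// ltry.
Qed.

(** From here on only null sets are kept. This makes shifts composable: no density of a sum of
    shifts has to be computed. *)
Lemma shift_null (c a b : R) (S : set (paths T)) : a < b -> measurable S ->
  P [set w | S (xpath w)] = 0%E ->
  P [set w | S (fun s => X s w + c * mass a b (k s))] = 0%E.
Proof.
move=> ab mS PS; rewrite -cameron_martin//; apply: null_set_integral => //.
- by rewrite -[X in measurable X]setTI; exact: measurable_path.
- by apply/measurable_EFinP; apply: measurable_funTS; have [] := sqi_cm_density hB c ab.
Qed.

Lemma shifts_null (l : seq (R * R * R)) (S : set (paths T)) :
  all (fun p => p.1.2 < p.2) l -> measurable S ->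
  P [set w | S (xpath w)] = 0%E ->
  P [set w | S (fun s => X s w + \sum_(p <- l) p.1.1 * mass p.1.2 p.2 (k s))] = 0%E.
Proof.
elim: l S => [|p l IH] S /= => [_ mS|/andP[pp al] mS] PS.
  by rewrite -[RHS]PS; congr (P _); apply/seteqP; split => w /=;
    rewrite (_ : (fun s => _) = xpath w)//; apply/funext => s; rewrite big_nil addr0.
pose S' : set (paths T) := [set x | S (fun s => x s + p.1.1 * mass p.1.2 p.2 (k s))].
have mS' : measurable S'.
  by rewrite -[X in measurable X]setTI; exact: (measurable_add_path _ measurableT mS).
have := IH S' al mS' (shift_null p.1.1 pp mS PS).
move=> <-; congr (P _); apply/seteqP; split => w; rewrite /S' /=;
  (congr S; apply/funext => s; rewrite big_cons); ring.
Qed.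

End shifts.

(** * The shifts produced by the kernel f(s - t) - f(s) *)

Section shift_realization.
Context {R : realType}.
Notation leb := (@lebesgue_measure R).

(** By Lebesgue differentiation [h] is almost everywhere the derivative of its primitive, which is
    constant. *)
Lemma vanish_ae (h : R -> R) : leb.-integrable setT (EFin \o h) ->
  (forall v, \int[leb]_x ((x < v)%R%:R * h x) = 0) -> {ae leb, forall x, h x = 0}.
Proof.
move=> ih hv.
have loc : locally_integrable setT h by exact: open_integrable_locally openT ih.
have ihy y : leb.-integrable `]-oo, y] (EFin \o h) by exact: integrableS ih.
have := FTC1Ny ihy loc => /=; apply: filterS; first exact: (ae_filter_ringOfSetsType leb).
move=> x [_ <-].
rewrite (_ : (fun _ => _) = cst 0) ?derive1_cst//.
apply/funext => y; rewrite -[RHS](hv y) -Rintegral_itv_bndo_bndc; last exact: integrableS ih.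
rewrite Rintegral_mkcond; apply: eq_Rintegral => z _.
rewrite patchE mem_setE in_itv/=.
by case: ltP; rewrite ?mul1r ?mul0r.
Qed.

Lemma eq_Rintegral_off_point (h k : R -> R) (a : R) : measurable_fun setT h ->
  measurable_fun setT k -> (forall x, x != a -> h x = k x) ->
  \int[leb]_x h x = \int[leb]_x k x.
Proof.
move=> mh mk hk; rewrite /Rintegral; congr fine.
apply: ae_eq_integral => //; [exact/measurable_EFinP|exact/measurable_EFinP|].
exists [set a]; split; [exact: measurable_set1|exact: lebesgue_measure_set1|].
move=> x /= nx; apply: contrapT => /eqP xa; apply: nx => _.
by rewrite hk.
Qed.

Variable f : R -> R.
Hypotheses (mf : measurable_fun setT f) (f0 : forall s, 0 <= s -> f s = 0).
Hypothesis f_sqi : forall t : R, 0 <= t ->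
     (\int[leb]_(s in [set s : R | (s <= t)%R]) ((f (s - t) - f s) ^+ 2)%R%:E < +oo)%E.
Hypothesis f_neq0 : (0 < leb [set s : R | f s != 0%R])%E.

Let fr x := f (- x).

Let fr0 x : x <= 0 -> fr x = 0.
Proof. by move=> x0; rewrite /fr f0// oppr_ge0. Qed.

Let mfr : measurable_fun setT fr.
Proof. by apply: measurableT_comp. Qed.

(** The integrability hypothesis at t = L controls the integral over 0 < s <= L, where f(s) = 0 and
    f(s - L) = fr(L - s). *)
Let sfr L : 0 <= L -> sqi leb (fun x => (0 <= x <= L)%R%:R * fr x).
Proof.
move=> L0.
have mm : measurable_fun setT (fun x : R => (0 <= x <= L)%R%:R * fr x).
  by apply: measurable_funM => //; exact: measurable_itvind.
split => //; apply/integrableP; split; first by apply/measurable_EFinP; exact: measurable_funX.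
under eq_integral => x _ do rewrite /= ger0_norm ?sqr_ge0//.
rewrite -(integral_reflect L); last by apply/measurable_EFinP; exact: measurable_funX.
apply: le_lt_trans (f_sqi L0); rewrite [leRHS]integral_mkcond.
apply: ge0_le_integral => //.
- by move=> x _; rewrite lee_fin sqr_ge0.
- apply/measurable_EFinP; apply: measurable_funX; apply: (measurableT_comp mm).
  exact: measurable_funB.
- apply/(measurable_restrictT _ _).1.
    by have := @measurable_itv R `]-oo, L]; congr measurable; apply/seteqP; split.
  apply: measurable_funTS; apply/measurable_EFinP; apply: measurable_funX.
  apply: measurable_funB => //; apply: measurableT_comp => //; exact: measurable_funB.
move=> x _; rewrite patchE; case: ifPn => [|]; rewrite ?inE ?notin_setE/=.
  move=> xL; rewrite lee_fin; case: (leP x 0) => x0.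
    case: (boolP (_ <= _ <= _)) => [h|_]; last by rewrite mul0r expr0n sqr_ge0.
    have -> : x = 0 by lra.
    by rewrite mul1r /fr (f0 (lexx 0)) !subr0 sub0r.
  rewrite (f0 (ltW x0)) subr0 /fr opprB.
  by case: (_ <= _ <= _); rewrite ?mul1r ?mul0r ?expr0n ?sqr_ge0.
move=> xL; rewrite (_ : (_ <= _ <= _) = false) ?mul0r ?expr0n//.
by apply/negbTE; apply/negP => /andP[h _]; apply: xL; lra.
Qed.

Let Fp := primitive fr.

Let ifr v : leb.-integrable setT (EFin \o (fun x => (x < v)%R%:R * fr x)).
Proof.
have h : v <= Num.max 0 v by rewrite le_max lexx orbT.
have h0 : 0 <= Num.max 0 v by rewrite le_max lexx.
have := integrable_ltr_g fr0 (sfr h0) h (lexx 0).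
by apply: eq_integrable => // x _ /=; rewrite subr0.
Qed.

Let Fp_le0 v : v <= 0 -> Fp v = 0.
Proof.
move=> v0; rewrite /Fp /primitive; under eq_Rintegral => x _.
  rewrite (_ : _ * _ = 0); last first.
    by case: ltP => xv; rewrite ?mul0r// fr0 ?mulr0// (le_trans (ltW xv)).
  over.
by rewrite Rintegral_cst// mul0r.
Qed.

Let gap := [set x : R | 0 <= x /\ forall v, v <= x -> Fp v = 0].

Let gap_bounded : exists M : R, forall x, gap x -> x <= M.
Proof.
apply: contrapT => nb.
have Fp0 v : Fp v = 0.
  apply: contrapT => nv; apply: nb; exists v => x [x0 hx].
  by rewrite leNgt; apply/negP => vx; apply: nv; apply: hx; exact: ltW.
(* [fr] need not be integrable on the whole line, so [vanish_ae] is applied to its truncations. *)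
have frae (n : nat) : {ae leb, forall x, (x < n%:R)%R%:R * fr x = 0}.
  apply: vanish_ae (ifr n%:R) _ => v.
  rewrite -[RHS](Fp0 (Num.min v n%:R)); apply: eq_Rintegral => x _.
  by rewrite lt_min mulrA -natrM mulnb.
have : {ae leb, forall x, forall n : nat, (x < n%:R)%R%:R * fr x = 0}.
  exact: ae_foralln.
move=> [N [mN N0 hN]].
move: f_neq0; rewrite ltNge => /negP; apply.
have mS : measurable [set s : R | f s != 0].
  rewrite (_ : [set s | _] = setT `&` f @^-1` (~` [set 0])); last first.
    by apply/seteqP; split => x /=; [move=> h; split => //; exact/eqP|case=> _ /eqP].
  by apply: mf => //; apply: measurableC; exact: measurable_set1.
rewrite -(lebesgue_measure_reflect 0 mS) -N0; apply: le_measure; rewrite ?inE//.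
  rewrite -[X in measurable X]setTI.
  by apply: (measurable_funB (@measurable_cst _ _ _ _ setT (0 : R)) (@measurable_id _ _ setT)).
move=> x /= fx; apply: hN => /= h; move: fx; rewrite sub0r => /eqP; apply.
have := h (Num.truncn x).+1; rewrite truncnS_gt ?mul1r//.
Qed.

(* [- a] is the essential supremum of the support of [f]. *)
Lemma exists_gap : exists (a : R) (g : R -> R), [/\ measurable_fun setT g, forall x, x <= 0 -> g x = 0,
  (forall L, 0 <= L -> sqi leb (fun x => (0 <= x <= L)%R%:R * g x)),
  (forall d, 0 < d -> exists2 u, 0 < u < d & \int[leb]_x ((x < u)%R%:R * g x) != 0) &
  (forall v, Fp (v + a) = primitive g v) /\ forall v, v <= a -> Fp v = 0].
Proof.
have [M hM] := gap_bounded.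
pose a := sup gap.
have hs : has_sup gap by split; [exists 0|exists M].
have a0 : 0 <= a by apply: ub_le_sup => //; exists M.
have Flt v : v < a -> Fp v = 0.
  move=> va; have av : 0 < a - v by rewrite subr_gt0.
  have [x [x0 hx] vx] := sup_adherent av hs; rewrite opprB addrC subrK in vx.
  by apply: hx; exact: ltW.
have Fa v : v <= a -> Fp v = 0.
  rewrite le_eqVlt => /predU1P[->|]; last exact: Flt.
  have : Fp (a - harmonic n) @[n --> \oo] --> Fp a.
    apply: (@Rintegral_dct _ _ _ leb (fun n x => (x < a - harmonic n)%R%:R * fr x)
      (fun x => (x < a)%R%:R * fr x) (fun x => `|(x < a)%R%:R * fr x|)).
    - by move=> n; exact: measurable_integrable (ifr _).
    - exact: measurable_integrable (ifr _).
    - move=> x; apply: cvgMl.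
      case: ltP => xa; last first.
        apply: cvg_near_cst; apply: nearW => n.
        by rewrite ltNge (le_trans _ xa)// gerBl harmonic_ge0.
      apply: cvg_near_cst; near=> n.
      have : harmonic n < a - x.
        near: n; have /cvgrPdist_lt/(_ (a - x)) := @cvg_harmonic R.
        rewrite subr_gt0 => /(_ xa); apply: filterS => n.
        by rewrite sub0r normrN ger0_norm ?harmonic_ge0.
      by move=> h; rewrite (_ : x < a - harmonic n)//; lra.
    - exact: integrable_norm (ifr _).
    - move=> n x; rewrite !normrM ler_wpM2r//.
      case: (ltP x (a - harmonic n)) => h; last by rewrite normr0.
      by rewrite (lt_le_trans h)// gerBl harmonic_ge0.
  move=> /cvg_lim <- //.
  rewrite (_ : (fun n => _) = cst 0) ?lim_cst//.
  by apply/funext => n; apply: Flt; rewrite gtrBl harmonic_gt0.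
(* [fr] moved so that its essential support starts at 0. The strict inequality gives g(0) = 0 and
   alters a single point, which [eq_Rintegral_off_point] ignores. *)
pose g x := (0 < x)%R%:R * fr (x + a).
have mg : measurable_fun setT g.
  apply: measurable_funM.
    rewrite (_ : (fun x => _) = (fun x => 1 - (x <= 0)%R%:R)); last first.
      by apply/funext => x; case: ltP; rewrite ?subrr ?subr0.
    rewrite (_ : (fun x => _) = (fun x => 1 - \1_(`]-oo, 0]) x)); last first.
      by apply/funext => x; rewrite indicE mem_setE in_itv.
    by apply: measurable_funB => //; apply: measurable_indic.
  by apply: measurableT_comp => //; exact: measurable_funD.
have gE v : Fp (v + a) = primitive g v.
  transitivity (Fp (v + a) - Fp a); first by rewrite (Fa a)// subr0.
  case: (leP v 0) => v0.
    rewrite !Fa ?gerDr// subrr; apply/esym; rewrite /primitive.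
    under eq_Rintegral => x _.
      rewrite (_ : _ * _ = 0); last first.
        by rewrite /g; case: ltP => xv; rewrite ?mul0r// ltNge (le_trans (ltW xv))// mul0r mulr0.
      over.
    by rewrite Rintegral_cst// mul0r.
  rewrite /Fp /primitive -RintegralB//.
  rewrite -[RHS](Rintegral_translate a); last first.
    by apply: measurable_funM => //; exact: measurable_ltind.
  apply: (@eq_Rintegral_off_point _ _ a).
  - apply: measurable_funB; exact: measurable_integrable (ifr _).
  - apply: measurable_funM; first by apply: measurableT_comp (measurable_ltind v) _; exact: measurable_funB.
    by apply: measurableT_comp mg _; exact: measurable_funB.
  move=> x xa; rewrite /g subrK subr_gt0 ltrBlDr.
  case: (ltgtP a x) xa => // ax _; last first.
    by rewrite mul0r mulr0 (lt_trans ax) ?ltrDr// mul1r subrr.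
  by rewrite mul0r subr0 mul1r.
exists a, g; split => //.
- by move=> x x0; rewrite /g ltNge x0 mul0r.
- move=> L L0.
  have La : 0 <= L + a by rewrite addr_ge0.
  have [m1 i1] := sfr La.
  split; first by apply: measurable_funM => //; exact: measurable_itvind.
  have := integrable_translate (- a) i1.
  apply: integrable_le.
  - by apply: measurable_funX; apply: measurable_funM => //; exact: measurable_itvind.
  - move=> x; rewrite opprK ger0_norm ?sqr_ge0// /g.
    case: (boolP (0 <= x <= L)) => [/andP[x0 xL]|_]; last by rewrite mul0r expr0n/= sqr_ge0.
    case: (ltP 0 x) => x1; last by rewrite mul0r mulr0 expr0n/= sqr_ge0.
    by rewrite !mul1r (_ : _ <= _ <= _) ?mul1r//; apply/andP; split; lra.
- move=> d d0; apply: contrapT => nd.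
  (* If the primitive of [g] vanished on (0, d), that of [fr] would vanish up to a + d / 2, beyond
     the supremum [a]. *)
  have : gap (a + d / 2).
    split => [|v vad]; first by rewrite addr_ge0// divr_ge0// ltW.
    case: (leP v a) => va; first exact: Fa.
    rewrite -(subrK a v) gE; apply: contrapT => nz; apply: nd.
    by exists (v - a); [apply/andP; split; lra|exact/eqP].
  move=> /(ub_le_sup (ex_intro _ M hM)); rewrite -/a; lra.
Unshelve. all: by end_near. Qed.

Definition vkernel (u x : R) : R := if x <= u then f (x - u) - f x else 0.

Lemma measurable_vkernel u : measurable_fun setT (vkernel u).
Proof.
rewrite (_ : vkernel u = fun x => \1_(`]-oo, u]) x * (f (x - u) - f x)).
  apply: measurable_funM; first exact: measurable_indic.
  by apply: measurable_funB => //; apply: measurableT_comp => //; exact: measurable_funB.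
apply/funext => x; rewrite /vkernel indicE mem_setE in_itv/=.
by case: (x <= u); rewrite ?mul1r ?mul0r.
Qed.

(** The kernel is carried by x <= u <= b, so [b] truncates nothing. Each term reflects into an
    integral of [fr] whose other end lies in x <= 0, where [fr] vanishes. *)
Lemma mass_vkernel (al b u : R) : u <= b -> 0 <= u -> mass al b (vkernel u) = Fp (u - al) - Fp (- al).
Proof.
move=> ub u0.
have i1 : leb.-integrable setT (EFin \o (fun x => (al < x <= u)%R%:R * f (x - u))).
  have := integrable_reflect u (ifr (u - al)); apply: eq_integrable => // x _ /=.
  rewrite /fr opprB ltrD2l ltrN2; case: (leP x u) => xu; first by rewrite andbT.
  by rewrite f0 ?mulr0// subr_ge0 ltW.
have i2 : leb.-integrable setT (EFin \o (fun x => (al < x <= u)%R%:R * f x)).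
  have := integrable_reflect 0 (ifr (- al)); apply: eq_integrable => // x _ /=.
  rewrite /fr opprB subr0 sub0r ltrN2; case: (leP x u) => xu; first by rewrite andbT.
  by rewrite f0 ?mulr0// (le_trans u0)// ltW.
transitivity (\int[leb]_x ((al < x <= u)%R%:R * f (x - u) - (al < x <= u)%R%:R * f x)).
  apply: eq_Rintegral => x _; rewrite /vkernel -mulrBr.
  case: (leP x u) => xu; last by rewrite andbF mul0r mulr0.
  by rewrite (le_trans xu ub).
rewrite RintegralB//; congr (_ - _).
  rewrite -(Rintegral_reflect u); last exact: measurable_integrable i1.
  apply: eq_Rintegral => y _; rewrite /fr (_ : u - y - u = - y); last by ring.
  case: (leP y 0) => y0; first by rewrite (f0 (s := - y)) ?mulr0// oppr_ge0.
  by congr ((nat_of_bool _)%:R * _); apply/andP/idP => [[? ?]|?]; [lra|split; lra].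
rewrite -(Rintegral_reflect 0); last exact: measurable_integrable i2.
apply: eq_Rintegral => y _; rewrite /fr sub0r.
case: (leP y 0) => y0; first by rewrite (f0 (s := - y)) ?mulr0// oppr_ge0.
by congr ((nat_of_bool _)%:R * _); apply/andP/idP => [[? ?]|?]; [lra|split; lra].
Qed.

Lemma shift_approx (T t eps : R) (gam : R -> R) : 0 <= t -> t <= T ->
  {within [set v | 0 <= v <= T - t], continuous gam} -> gam 0 = 0 -> 0 < eps ->
  exists l : seq (R * R * R), [/\ all (fun p => p.1.2 < p.2) l,
    forall u, 0 <= u <= t -> \sum_(p <- l) p.1.1 * mass p.1.2 p.2 (vkernel u) = 0 &
    forall u, t <= u <= T ->
      `|gam (u - t) - \sum_(p <- l) p.1.1 * mass p.1.2 p.2 (vkernel u)| <= eps].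
Proof.
move=> t0 tT cg gam0 eps0.
have [a [g [mg g0 sg nd [gE Fa]]]] := exists_gap.
have L0 : 0 <= T - t by rewrite subr_ge0.
have [l ls hl] := path_approx L0 mg g0 (sg _ L0) nd cg gam0 eps0.
(* The right end exceeds T, so that no kernel is truncated, and also the left end, so that the
   interval is proper. The second term of [mass_vkernel] vanishes since t + s >= 0 keeps its
   argument a - t - s at most [a]. *)
pose l' := [seq (p.1, t - a + p.2, Num.max T (t - a + p.2) + 1) | p <- l].
have E u : 0 <= u <= T ->
    \sum_(p <- l') p.1.1 * mass p.1.2 p.2 (vkernel u) = shift_comb g l (u - t).
  move=> /andP[u0 uT]; rewrite big_map /shift_comb; apply: eq_big_seq => p pl /=.
  rewrite mass_vkernel//; last by rewrite (le_trans uT)// ler_wpDr// le_max lexx.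
  rewrite (Fa (- (t - a + p.2))) ?subr0; last by have := allP ls _ pl => /=; lra.
  by rewrite -gE; congr (_ * Fp _); ring.
exists l'; split.
- by apply/allP => _ /mapP[p _ ->] /=; rewrite ltr_pwDr// le_max lexx orbT.
- move=> u /andP[u0 ut]; rewrite E; last by rewrite u0 (le_trans ut).
  rewrite /shift_comb big_seq big1// => p pl.
  rewrite -gE Fa ?mulr0//; have := allP ls _ pl => /=; lra.
- move=> u /andP[tu uT]; rewrite E; last by rewrite (le_trans t0 tu).
  by apply: hl; apply/andP; split; lra.
Qed.

End shift_realization.

(** * Continuous paths through countably many data *)

Section clamped_paths.
Context {R : realType}.
Implicit Types (t T e : R) (x y : R -> R).

Lemma clamp_itv t T u : t <= T -> t <= clamp t T u <= T.
Proof. by move=> tT; rewrite /clamp le_max lexx/= ge_max tT ge_min lexx orbT. Qed.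

Lemma clamp_id t T u : t <= u <= T -> clamp t T u = u.
Proof. by move=> /andP[tu uT]; rewrite /clamp (min_idPl uT); exact/max_idPr. Qed.

Lemma clamp_lipschitz t T u v : `|clamp t T u - clamp t T v| <= `|u - v|.
Proof.
rewrite /clamp; have := ler_norm (u - v); have := ler_norm (v - u); rewrite (distrC v u) => h1 h2.
by rewrite ler_norml /Order.max /Order.min; repeat case: ifP; lra.
Qed.

Lemma continuous_clamp t T x : t <= T -> {within [set v | t <= v <= T], continuous x} ->
  continuous (x \o clamp t T).
Proof.
move=> tT cx u; apply/cvgrPdist_le => e e0.
have [n hn] := uniformly_continuous_itv cx e0.
have n0 : 0 < n.+1%:R^-1 :> R by rewrite invr_gt0.
exists n.+1%:R^-1 => // v /= uv.
by apply: hn; rewrite ?clamp_itv// (le_trans (clamp_lipschitz _ _ _ _))// ltW.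
Qed.

(** Rationals clamped to [t,T] are dense in it even when t = T, a case in which the interval may
    contain no rational. *)
Lemma rat_dist_le t T e x y : t <= T ->
  {within [set v | t <= v <= T], continuous x} -> {within [set v | t <= v <= T], continuous y} ->
  (forall q : rat, `|x (clamp t T (ratr q)) - y (clamp t T (ratr q))| <= e) ->
  forall u, t <= u <= T -> `|x u - y u| <= e.
Proof.
move=> tT cx cy h u tu; rewrite leNgt; apply/negP => gt.
pose del := (`|x u - y u| - e) / 2.
have del0 : 0 < del by rewrite divr_gt0// subr_gt0.
have := continuous_clamp tT cx => /(_ u)/cvgrPdist_lt/(_ _ del0) nx.
have := continuous_clamp tT cy => /(_ u)/cvgrPdist_lt/(_ _ del0) ny.
have [r /= r0 hr] : \forall v \near u, `|x (clamp t T u) - x (clamp t T v)| < del /\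
    `|y (clamp t T u) - y (clamp t T v)| < del by near=> v; split; near: v.
have [q] := rat_in_itvoo (ltr_pwDr r0 (lexx u)); rewrite in_itv/= => /andP[q1 q2].
have /= [] := hr (ratr q); first by rewrite /ball/= ltr_distlC; apply/andP; split; lra.
rewrite (clamp_id tu) => h1 h2; have h3 := h q.
have : `|x u - y u| < e + (del + del).
  rewrite (_ : x u - y u = (x (clamp t T (ratr q)) - y (clamp t T (ratr q))) +
    ((x u - x (clamp t T (ratr q))) - (y u - y (clamp t T (ratr q))))); last by ring.
  rewrite (le_lt_trans (ler_normD _ _))// ler_ltD// (le_lt_trans (ler_normB _ _))//.
  exact: ltrD.
rewrite /del; lra.
Unshelve. all: by end_near. Qed.

(** Step functions with rational values on a uniform mesh: a countable family that comes uniformly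
    close to every continuous path, although its members are not continuous. *)
Definition grid_path t (c : nat * seq rat) u : R :=
  ratr (nth 0 c.2 (Num.truncn (c.1%:R * (u - t)))).

Lemma grid_path_dense t T x e : t <= T -> {within [set v | t <= v <= T], continuous x} ->
  0 < e -> exists c, forall u, t <= u <= T -> `|x u - grid_path t c u| <= e.
Proof.
move=> tT cx e0.
have e20 : 0 < e / 2 by rewrite divr_gt0.
have [n hn] := uniformly_continuous_itv cx e20.
pose v i := t + i%:R / n.+1%:R.
have rat_near (z : R) : {q : rat | `|z - ratr q| <= e / 2}.
  apply/cid; have [q] := rat_in_itvoo (ltr_pwDr e20 (lexx z)); rewrite in_itv/= => /andP[q1 q2].
  by exists q; rewrite ler_norml; apply/andP; split; lra.
pose s := mkseq (fun i => projT1 (rat_near (x (v i)))) (Num.truncn (n.+1%:R * (T - t))).+1.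
exists (n.+1, s) => u /andP[tu uT]; rewrite /grid_path/=.
have ut0 : 0 <= n.+1%:R * (u - t) by rewrite mulr_ge0// subr_ge0.
set i := Num.truncn _; have /andP[i1 i2] := truncn_itv ut0.
have is' : (i < (Num.truncn (n.+1%:R * (T - t))).+1)%N.
  by rewrite ltnS; apply: le_truncn; rewrite ler_wpM2l// lerD2r.
rewrite nth_mkseq//; case: (rat_near _) => q /= hq.
have vu : v i <= u by rewrite /v -lerBrDl ler_pdivrMr// mulrC.
have uv : u - v i <= n.+1%:R^-1.
  have : u - t < i.+1%:R / n.+1%:R by rewrite ltr_pdivlMr// mulrC.
  have -> : i.+1%:R / n.+1%:R = i%:R / n.+1%:R + n.+1%:R^-1 :> R.
    by rewrite -[X in X%:R / _ = _]addn1 natrD mulrDl mul1r.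
  by rewrite /v; set c := i%:R / _; set c' := _^-1; lra.
have tv : t <= v i by rewrite lerDl divr_ge0.
have h : `|x u - x (v i)| <= e / 2.
  apply: hn; [by rewrite tu|by rewrite tv (le_trans vu)|].
  by rewrite ger0_norm// subr_ge0.
rewrite (_ : x u - ratr q = (x u - x (v i)) + (x (v i) - ratr q)); last by ring.
by rewrite (le_trans (ler_normD _ _))// (splitr e) lerD.
Qed.

End clamped_paths.

(** * Events of the past meet every tube *)

Section tubes.
Context {R : realType} d (Omega : measurableType d) (P : probability Omega R).
Notation leb := (@lebesgue_measure R).
Variables (B : R -> Omega -> R) (f : R -> R) (T : R) (X : R -> Omega -> R).
Hypothesis hB : two_sided_BM P B.
Hypotheses (mf : measurable_fun setT f) (f0 : forall s, 0 <= s -> f s = 0).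
Hypothesis f_sqi : forall t : R, 0 <= t ->
     (\int[leb]_(s in [set s : R | (s <= t)%R]) ((f (s - t) - f s) ^+ 2)%R%:E < +oo)%E.
Hypothesis f_neq0 : (0 < leb [set s : R | f s != 0%R])%E.
Hypothesis hX : forall s, 0 <= s <= T -> wiener_integral P B (vkernel f s) (X s).
Hypothesis cX : forall w, {within [set u | 0 <= u <= T], continuous (fun u => X u w)}.
Variable t : R.
Hypotheses (t0 : 0 <= t) (tT : t <= T).

Let sub_cX w : {within [set u | t <= u <= T], continuous (fun u => X u w)}.
Proof.
apply: (@continuous_subspaceW _ _ _ [set u | 0 <= u <= T]); last exact: cX.
by move=> u /= /andP[tu ->]; rewrite (le_trans t0 tu).
Qed.

Let inT u : t <= u <= T -> 0 <= u <= T.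
Proof. by move=> /andP[tu ->]; rewrite (le_trans t0 tu). Qed.

(** The set S ignores the path after t, so a shift that vanishes on [0,t] does not leave the
    event. *)
Lemma natural_filtration_paths (A : set Omega) : natural_filtration X t A ->
  exists S : set (paths T), [/\ measurable S, A = [set w | S (X^~ w)] &
    forall x y : R -> R, (forall s, 0 <= s <= t -> x s = y s) -> S x -> S y].
Proof.
move: A; apply: smallest_sub; first split.
- by exists set0; split => //.
- move=> A [S [mS -> SS]]; exists (~` S); split; first exact: measurableC.
    by apply/seteqP; split => w /=; [case|].
  move=> x y xy nSx Sy; apply: nSx; apply: SS Sy => s hs.
  by rewrite xy.
- move=> A hA; pose S n := projT1 (cid (hA n)).
  have hS n : [/\ measurable (S n : set (paths T)), A n = [set w | S n (X^~ w)] &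
    forall x y : R -> R, (forall s, 0 <= s <= t -> x s = y s) -> S n x -> S n y].
    by rewrite /S; case: cid.
  exists (\bigcup_n S n); split.
  + by apply: bigcup_measurable => n _; case: (hS n).
  + by apply/seteqP; split => w [n _ h]; exists n => //; have [_ E _] := hS n;
      [rewrite E in h|rewrite E].
  + by move=> x y xy [n _ Snx]; exists n => //; have [_ _] := hS n; apply; [exact: xy|].
move=> _ [s [U [/andP[s0 st] oU ->]]].
exists [set x | U (x s)]; split => //.
- rewrite -[X in measurable X]setTI.
  have sT : 0 <= s <= T by rewrite s0 (le_trans st).
  exact: (measurable_coord sT measurableT (open_measurable oU)).
- by move=> x y xy /=; rewrite (xy s)// s0.
Qed.

Lemma measurable_natural_filtration A : natural_filtration X t A -> measurable A.
Proof.
move=> /natural_filtration_paths[S [mS -> _]]; rewrite -[X in measurable X]setTI.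
exact: (measurable_path hX measurableT mS).
Qed.

Definition tube (y : R -> R) (e : R) : set (R -> R) :=
  [set x | forall q : rat, `|x (clamp t T (ratr q)) - y (clamp t T (ratr q))| <= e].

(** Paths are measured relative to their value at t, so that one deterministic [gam] serves all
    values of X_t. *)
Definition rel_tube (gam : R -> R) (e : R) : set (R -> R) :=
  [set x | forall q : rat, `|x (clamp t T (ratr q)) - x t - gam (clamp t T (ratr q))| <= e].

Let measurable_rat_forall (F : rat -> R -> R -> R) (e : R) :
  (forall q, measurable_fun setT (fun x : paths T => F q (x (clamp t T (ratr q))) (x t))) ->
  measurable ([set x | forall q, `|F q (x (clamp t T (ratr q))) (x t)| <= e] : set (paths T)).
Proof.
move=> mF.
apply: measurable_forall => q.
have := measurableT_comp (@normr_measurable R setT) (mF q) measurableT (measurable_itv `]-oo, e]).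
by rewrite setTI; congr measurable.
Qed.

Lemma measurable_tube y e : measurable (tube y e : set (paths T)).
Proof.
apply: (@measurable_rat_forall (fun q a b => a - y (clamp t T (ratr q)))) => q.
by apply: measurable_funB => //; apply: measurable_coord; apply: inT; exact: clamp_itv.
Qed.

Lemma measurable_rel_tube gam e : measurable (rel_tube gam e : set (paths T)).
Proof.
apply: (@measurable_rat_forall (fun q a b => a - b - gam (clamp t T (ratr q)))) => q.
apply: measurable_funB => //; apply: measurable_funB; apply: measurable_coord; apply: inT.
  exact: clamp_itv.
by rewrite lexx.
Qed.

(* One of countably many thin tubes has positive probability inside [A]; a Cameron-Martin shift
   that vanishes on [0, t] moves it into the target tube. *)
Lemma rel_tube_gt0 (A : set Omega) (gam : R -> R) (e : R) : natural_filtration X t A ->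
  P A <> 0%E -> {within [set u | t <= u <= T], continuous gam} -> gam t = 0 -> 0 < e ->
  P (A `&` [set w | rel_tube gam e (X^~ w)]) <> 0%E.
Proof.
move=> FA PA cgam gamt e0 PAt.
have mA := measurable_natural_filtration FA.
have [S [mS AE SS]] := natural_filtration_paths FA.
(* Two paths in one tube of radius e / 8 differ by at most e / 4. The final error is e / 4 at u, e /
   4 at t, and e / 2 from [shift_approx]. *)
have e80 : 0 < e / 8 by rewrite divr_gt0.
have mX (V : set (paths T)) : measurable V -> measurable [set w | V (X^~ w)].
  by move=> mV; rewrite -[X in measurable X]setTI; exact: (measurable_path hX measurableT mV).
pose C n := if unpickle n is Some c then tube (grid_path t c) (e / 8) else set0.
have mC n : measurable (C n : set (paths T)).
  by rewrite /C; case: (unpickle n) => [c|]; [exact: measurable_tube|exact: measurable0].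
have [n PC] : exists n, P (A `&` [set w | C n (X^~ w)]) <> 0%E.
  apply: contrapT => /forallNP h; apply: PA.
  have : P.-negligible A.
    apply: negligibleS (negligible_bigcup (F := fun n => A `&` [set w | C n (X^~ w)]) _).
      move=> w Aw; have [c hc] := grid_path_dense tT (@sub_cX w) e80.
      exists (pickle c) => //; split => //=; rewrite /C pickleK => q.
      by apply: hc; exact: clamp_itv.
    move=> n; apply/negligibleP; first by apply: measurableI => //; exact: mX.
    by apply: contrapT; exact: h.
  by move/negligibleP; apply.
(* The path of w0 is a deterministic reference for the whole thin tube: the shift has to realize
   [gam] minus the increments of that path from t. *)
have [w0 [Aw0 Cw0]] : exists w0, A w0 /\ C n (X^~ w0).
  apply: contrapT => /forallNP h; apply: PC; rewrite (_ : _ `&` _ = set0) ?measure0//.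
  by apply/seteqP; split => w // -[h1 h2]; apply: (h w).
move: Cw0 PC; rewrite /C; case: (unpickle n) => // c Cw0 PC.
pose g0 u := X u w0 - X t w0.
have cg : {within [set v | 0 <= v <= T - t], continuous (fun v => gam (v + t) - g0 (v + t))}.
  have c1 := continuous_clamp tT cgam; have c2 := continuous_clamp tT (@sub_cX w0).
  have c3 : continuous (fun v => (gam \o clamp t T) (v + t) -
      (((fun u => X u w0) \o clamp t T) (v + t) - X t w0)).
    move=> v; apply: cvgB.
      apply: (@continuous_comp _ _ _ (fun v => v + t) (gam \o clamp t T)); last exact: c1.
      by apply: cvgD; [exact: cvg_id|exact: cvg_cst].
    apply: cvgB; last exact: cvg_cst.
    apply: (@continuous_comp _ _ _ (fun v => v + t) ((fun u => X u w0) \o clamp t T)); last exact: c2.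
    by apply: cvgD; [exact: cvg_id|exact: cvg_cst].
  have := continuous_subspaceT (A := [set v | 0 <= v <= T - t]) c3.
  apply: subspace_eq_continuous => v; rewrite inE /= => /andP[v0 vT].
  by rewrite /from_subspace /= clamp_id//; apply/andP; split; lra.
have cg0 : gam (0 + t) - g0 (0 + t) = 0 by rewrite add0r gamt /g0 !subrr.
have e20 : 0 < e / 2 by rewrite divr_gt0.
have [l [ls l1 l2]] := shift_approx mf f0 f_sqi f_neq0 t0 tT cg cg0 e20.
have mSR : measurable (S `&` rel_tube gam e : set (paths T)).
  by apply: measurableI => //; exact: measurable_rel_tube.
have PSR : P [set w | (S `&` rel_tube gam e) (X^~ w)] = 0%E.
  by rewrite -PAt AE.
have mk s : 0 <= s <= T -> measurable_fun setT (vkernel f s).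
  by move=> _; exact: measurable_vkernel.
have := shifts_null hB mk hX ls mSR PSR.
set V := [set w | _] => PV.
have mV : measurable V.
  have mH := measurable_add_path (T := T) (fun s => \sum_(p <- l) p.1.1 * mass p.1.2 p.2 (vkernel f s)).
  rewrite -[X in measurable X]setTI.
  exact: (measurableT_comp mH (measurable_path hX) measurableT mSR).
(* The null set V of outcomes whose shifted path lies in S and in the target tube contains the part
   of A in the thin tube. *)
apply: PC; apply/eqP; rewrite eq_le measure_ge0 andbT -PV; apply: le_measure; rewrite ?inE//.
  by apply: measurableI => //; apply: mX; exact: measurable_tube.
move=> w [Aw Tw]; split.
  rewrite AE in Aw; apply: SS Aw => s hs /=.
  by rewrite l1// addr0.
move=> q /=; set u := clamp t T (ratr q).
have tuT : t <= u <= T by exact: clamp_itv.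
have tube_le v : t <= v <= T -> `|X v w - X v w0| <= e / 4.
  apply: (@rat_dist_le R t T _ (fun u => X u w) (fun u => X u w0)) => // q'.
  have := Tw q'; have := Cw0 q'; rewrite /=.
  set a := X _ w0; set b := X _ w; set m := grid_path _ _ _ => h1 h2.
  rewrite (_ : b - a = (b - m) - (a - m)); last by ring.
  rewrite (le_trans (ler_normB _ _))// (_ : e / 4 = e / 8 + e / 8) ?lerD//; lra.
rewrite (l1 t) ?addr0; last by rewrite t0 lexx.
have h1 := tube_le u tuT; have h2 : `|X t w - X t w0| <= e / 4 by apply: tube_le; rewrite lexx.
have := l2 u tuT; rewrite subrK => h3.
rewrite (_ : _ - _ - _ = (X u w - X u w0) - (X t w - X t w0) -
  (gam u - g0 u - \sum_(p <- l) p.1.1 * mass p.1.2 p.2 (vkernel f u))); last by rewrite /g0; ring.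
apply: (le_trans (ler_normB _ _)); apply: (@le_trans _ _ (e / 4 + e / 4 + e / 2)); last by lra.
rewrite lerD//; apply: (le_trans (ler_normB _ _)); exact: lerD.
Qed.

End tubes.

(** * Borel structure of C[t,T] *)

Lemma invS_lt {R : realType} (e : R) : 0 < e -> exists n : nat, n.+1%:R^-1 < e.
Proof.
move=> e0; have /cvgrPdist_lt/(_ _ e0)[n _ /(_ n (leqnn n))] := @cvg_harmonic R.
by rewrite /= sub0r normrN ger0_norm ?harmonic_ge0//; exists n.
Qed.

Section path_space.
Context {R : realType}.
Variables t T : R.
Hypothesis tT : t <= T.

Notation pathsC := (g_sigma_algebraType (@path_open R t T)).

Lemma path_open_Cpath : path_open t T (Cpath t T).
Proof. by split => // g Cg; exists 1. Qed.

(** [path_borel] takes complements inside [Cpath], whereas a generated measurable type lives on all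
    functions; this translates between the two. *)
Lemma path_borelP S : path_borel t T S <-> measurable (S : set pathsC) /\ S `<=` Cpath t T.
Proof.
split.
  move: S; apply: smallest_sub; first split.
  - by split.
  - move=> A [mA sA]; split; last by move=> x [].
    by apply: measurableD => //; apply: sub_sigma_algebra; exact: path_open_Cpath.
  - move=> A hA; split; first by apply: bigcup_measurable => n _; case: (hA n).
    by move=> x [n _]; apply: (hA n).2.
  by move=> U oU; split; [exact: sub_sigma_algebra|case: oU].
have sb : sigma_algebra (Cpath t T) (path_borel t T) by exact: smallest_sigma_algebra.
have [b0 bD bU] := sb.
have bC : path_borel t T (Cpath t T) by rewrite -(setD0 (Cpath t T)); exact: bD.
suff H A : measurable (A : set pathsC) -> path_borel t T (A `&` Cpath t T).
  by move=> [mS sS]; rewrite (_ : S = S `&` Cpath t T); [exact: H|rewrite setIidl].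
move: A; apply: smallest_sub; first split.
- by rewrite /mkset set0I.
- move=> A hA; rewrite (_ : _ `&` _ = Cpath t T `\` (A `&` Cpath t T)); first exact: bD.
  apply/seteqP; split => x [h1 h2]; split => //; first by move=> [Ax _]; case: h1.
  by split => // Ax; apply: h2.
- by move=> A hA; rewrite setI_bigcupl; exact: bU.
move=> U oU; rewrite setIidl; last by case: oU.
exact: sub_sigma_algebra.
Qed.

Lemma path_continuous h : Cpath t T h -> {within [set u | t <= u <= T], continuous h}.
Proof. by case. Qed.

Lemma path_clamp h u : Cpath t T h -> h (clamp t T u) = h u.
Proof. by case=> _ /(_ u) <-. Qed.

Lemma clampK u : clamp t T (clamp t T u) = clamp t T u.
Proof. by rewrite clamp_id// clamp_itv. Qed.

Lemma Cpath_clamp (x : R -> R) : {within [set u | t <= u <= T], continuous x} ->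
  Cpath t T (x \o clamp t T).
Proof.
move=> cx; split; last by move=> u; rewrite /= clampK.
by apply: continuous_subspaceT; exact: continuous_clamp.
Qed.

Lemma supdist_lt (g h : R -> R) (e : R) : (supdist t T g h < e%:E)%E ->
  forall u, t <= u <= T -> `|g u - h u| < e.
Proof.
move=> gh u tu; rewrite -lte_fin; apply: le_lt_trans gh.
by apply: ereal_sup_ubound; exists u.
Qed.

Lemma supdist_le (g h : R -> R) (e : R) : (forall u, t <= u <= T -> `|g u - h u| <= e) ->
  (supdist t T g h <= e%:E)%E.
Proof. by move=> gh; apply: ge_ereal_sup => _ [u tu <-]; rewrite lee_fin gh. Qed.

(** Separability: on continuous paths an open set is the union of the countably many rational tubes
    it contains, and a tube is a countable intersection of conditions at single times. *)
Lemma measurable_to_pathsC d (Y : measurableType d) (Th : Y -> R -> R) :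
  (forall y, Cpath t T (Th y)) ->
  (forall u, t <= u <= T -> measurable_fun setT (fun y => Th y u)) ->
  measurable_fun setT (Th : Y -> pathsC).
Proof.
move=> CTh mTh; apply: (@measurability _ _ _ pathsC setT Th (@path_open R t T) erefl).
move=> _ [U [UC oU] <-]; rewrite setTI.
pose K (i : (nat * seq rat) * nat) : set (R -> R) :=
  tube T t (grid_path t i.1) i.2.+1%:R^-1.
pose good i := (K i `&` Cpath t T) `<=` U.
rewrite (_ : Th @^-1` U = \bigcup_(i : (nat * seq rat) * nat)
    (if `[< good i >] then Th @^-1` K i else set0)).
  apply: countable_bigcupT_measurable => [|i]; first exact: countableP.
  case: ifP => _; last exact: measurable0.
  apply: measurable_forall => q.
  have := measurableT_comp (@normr_measurable R setT) (measurable_funB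
    (mTh _ (clamp_itv (ratr q) tT)) (measurable_cst (grid_path t i.1 (clamp t T (ratr q)))))
    measurableT (measurable_itv `]-oo, i.2.+1%:R^-1]).
  by rewrite setTI; congr measurable.
apply/seteqP; split => y /=; last first.
  by move=> [i _]; case: ifPn => // /asboolP gi Ky; apply: gi.
move=> UTh; have [e e0 he] := oU _ UTh.
have [n hn] := invS_lt (divr_gt0 e0 (ltr0n R 4)).
have n0 : 0 < n.+1%:R^-1 :> R by rewrite invr_gt0.
have [c hc] := grid_path_dense tT (path_continuous (CTh y)) n0.
exists (c, n) => //; case: ifPn => [_|/asboolP]; first by move=> q; apply: hc; exact: clamp_itv.
move=> ng; apply: ng => h [Kh Ch]; apply: he => //.
apply: (@le_lt_trans _ _ (n.+1%:R^-1 + n.+1%:R^-1)%:E); last first.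
  by rewrite lte_fin; move: hn; set z := _^-1; lra.
apply: supdist_le => u tu.
apply: (rat_dist_le tT (path_continuous (CTh y)) (path_continuous Ch)) tu => q.
rewrite (_ : _ - _ = (Th y (clamp t T (ratr q)) - grid_path t c (clamp t T (ratr q))) -
  (h (clamp t T (ratr q)) - grid_path t c (clamp t T (ratr q)))); last by ring.
apply: (le_trans (ler_normB _ _)); apply: lerD; last exact: Kh.
by apply: hc; exact: clamp_itv.
Qed.

Lemma path_open_eval_lt u r : t <= u <= T -> path_open t T (Cpath t T `&` [set h | h u < r]).
Proof.
move=> tu; split => [x []//|g [Cg gr]]; exists (r - g u); first by rewrite subr_gt0.
move=> h Ch gh; split => //=; have := supdist_lt gh tu.
by rewrite ltr_norml => /andP[]; lra.
Qed.

Lemma measurable_eval u : t <= u <= T ->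
  measurable_fun (Cpath t T : set pathsC) (fun h : pathsC => h u).
Proof.
move=> tu; apply: (measurability _ (RGenInftyO.measurableE R)) => //.
move=> _ [_ [q ->] <-]; apply: sub_sigma_algebra.
by have := path_open_eval_lt q tu; congr (path_open _ _).
Qed.

Lemma measurable_Cpath : measurable (Cpath t T : set pathsC).
Proof. by apply: sub_sigma_algebra; exact: path_open_Cpath. Qed.

Lemma path_borel_rel_tube gam e : path_borel t T (Cpath t T `&` rel_tube T t gam e).
Proof.
apply/path_borelP; split; last by move=> x [].
rewrite (_ : _ `&` _ = [set h | forall q : rat, (Cpath t T `&`
  [set h | `|h (clamp t T (ratr q)) - h t - gam (clamp t T (ratr q))| <= e]) h]); last first.
  apply/seteqP; split => h /=; first by move=> [h1 h2] q; split => //; exact: h2.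
  by move=> hh; split => [|q]; [case: (hh 0)|case: (hh q)].
apply: measurable_forall => q.
have mt : t <= t <= T by rewrite lexx.
have := measurable_funB (measurable_funB (measurable_eval (clamp_itv (ratr q) tT))
    (measurable_eval mt)) (measurable_cst (gam (clamp t T (ratr q)))).
move=> /(measurableT_comp (@normr_measurable R setT))/(_ measurable_Cpath _ (measurable_itv `]-oo, e])).
by congr measurable.
Qed.

Lemma path_borel_eval (u : R) (D : set R) : t <= u <= T -> measurable D ->
  path_borel t T (Cpath t T `&` [set h | D (h u)]).
Proof.
move=> tu mD; apply/path_borelP; split; last by move=> x [].
exact: (measurable_eval tu measurable_Cpath mD).
Qed.

(** Grid paths are not continuous, so for each grid path and each radius one element of [Cpath] at
    that distance is chosen whenever there is one. *)
Lemma path_separable : exists gam : nat -> R -> R, (forall n, Cpath t T (gam n)) /\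
  forall x e, {within [set u | t <= u <= T], continuous x} -> 0 < e ->
    exists n, forall u, t <= u <= T -> `|x u - gam n u| <= e.
Proof.
pose near_grid (i : (nat * seq rat) * nat) (g : R -> R) := Cpath t T g /\
  forall u, t <= u <= T -> `|g u - grid_path t i.1 u| <= i.2.+1%:R^-1.
pose gam n : R -> R := if unpickle n is Some i then
   (if pselect (exists g, near_grid i g) is left h then sval (cid h) else cst 0) else cst 0.
have C0 : Cpath t T (cst 0) by split => // u; exact: cvg_cst.
exists gam; split.
  move=> n; rewrite /gam; case: (unpickle n) => // i; case: pselect => // h.
  by case: cid => g [].
move=> x e cx e0.
have [n hn] := invS_lt (divr_gt0 e0 (ltr0n R 2)).
have n0 : 0 < n.+1%:R^-1 :> R by rewrite invr_gt0.
have [c hc] := grid_path_dense tT cx n0.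
exists (pickle (c, n)) => u tu; rewrite /gam pickleK; case: pselect => [h|]; last first.
  move=> ng; exfalso; apply: ng; exists (x \o clamp t T); split; first exact: Cpath_clamp.
  by move=> v tv /=; rewrite clamp_id//; exact: hc.
case: cid => g [Cg hg] /=; have h1 := hg u tu; have h2 := hc u tu; rewrite /= in h1.
rewrite (_ : x u - g u = (x u - grid_path t c u) - (g u - grid_path t c u)); last by ring.
apply: (le_trans (ler_normB _ _)); rewrite (le_trans (lerD h2 h1))//.
by move: hn; set z := _^-1; lra.
Qed.

End path_space.

(** * Coding continuous paths measurably by real numbers *)

Section ternary_code.
Context {R : realType}.
Implicit Types (b : nat -> bool) (y : R).

(** Base 3 with digits 0 and 1: the digits after position k contribute at most 3^-k / 2, less than a
    digit at k, so greedy subtraction in [tern_rem] recovers each digit without the ambiguity of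
    binary expansions. *)
Definition tern_sum b m : R := \sum_(0 <= k < m) (b k)%:R / 3 ^+ k.
Definition tern_code b : R := sup (range (tern_sum b)).

Fixpoint tern_rem k y : R :=
  if k is j.+1 then tern_rem j y - (3 ^- j <= tern_rem j y)%R%:R / 3 ^+ j else y.
Definition tern_bit k y : bool := 3 ^- k <= tern_rem k y.

Lemma tern_sumS b k : tern_sum b k.+1 = tern_sum b k + (b k)%:R / 3 ^+ k.
Proof. by rewrite /tern_sum big_nat_recr. Qed.

Lemma tern_sum_homo b : {homo tern_sum b : i j / (i <= j)%N >-> i <= j}.
Proof. by apply/nondecreasing_seqP => k; rewrite tern_sumS lerDl divr_ge0 ?exprn_ge0. Qed.

Lemma exprV3S k : 3 ^- k = 3 * 3 ^- k.+1 :> R.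
Proof. by rewrite exprS invfM mulrA divff ?mul1r. Qed.

Lemma tern_sum_le b k m : tern_sum b m <= tern_sum b k + 3 / 2 * 3 ^- k.
Proof.
have p j : 0 < 3 ^- j :> R by rewrite invr_gt0 exprn_gt0.
have [mk|km] := leqP m k.
  by rewrite (le_trans (tern_sum_homo b mk))// lerDl mulr_ge0 ?divr_ge0// ltW.
rewrite -(subnKC (ltnW km)); elim: (m - k)%N => [|j IH].
  by rewrite addn0 lerDl mulr_ge0 ?divr_ge0// ltW.
(* The induction goes through with the exact geometric remainder. *)
suff {IH} : forall j, tern_sum b (k + j) <= tern_sum b k + 3 / 2 * (3 ^- k - 3 ^- (k + j)).
  move=> /(_ j.+1) /le_trans; apply; rewrite lerD2l ler_wpM2l ?divr_ge0// gerBl.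
  exact: ltW.
elim=> [|i IHi]; first by rewrite addn0 subrr mulr0 addr0.
rewrite addnS tern_sumS; have := exprV3S (k + i); have := p (k + i).+1.
have : (b (k + i)%N)%:R / 3 ^+ (k + i) <= 3 ^- (k + i) :> R.
  by case: (b _); rewrite ?mul1r ?mul0r// ltW.
move: IHi; set x := 3 ^- (k + i); set x' := 3 ^- (k + i).+1; set s := tern_sum b (k + i).
by set z := (b _)%:R / _; lra.
Qed.

Lemma tern_code_bounds b k : tern_sum b k <= tern_code b <= tern_sum b k + 3 / 2 * 3 ^- k.
Proof.
apply/andP; split.
  apply: ub_le_sup; last by exists k.
  by exists (tern_sum b k + 3 / 2 * 3 ^- k) => _ [m _ <-]; exact: tern_sum_le.
by apply: ge_sup => [|_ [m _ <-]]; [by exists (tern_sum b 0); exists 0%N|exact: tern_sum_le].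
Qed.

Lemma tern_code_itv b : 0 <= tern_code b < 2.
Proof.
have := tern_code_bounds b 0; rewrite /tern_sum big_geq// expr0 invr1.
by move=> /andP[h1 h2]; apply/andP; split; lra.
Qed.

Lemma tern_codeK b k : tern_bit k (tern_code b) = b k.
Proof.
have cmp i : (3 ^- i <= tern_code b - tern_sum b i) = b i.
  have := tern_code_bounds b i.+1; rewrite tern_sumS; have := exprV3S i.
  have : 0 < 3 ^- i.+1 :> R by rewrite invr_gt0 exprn_gt0.
  set x := 3 ^- i; set x' := 3 ^- i.+1; move=> x0 xx'.
  case: (b i); rewrite ?mul1r ?mul0r -/x => /andP[h1 h2]; apply/idP/idP => //; lra.
suff E : tern_rem k (tern_code b) = tern_code b - tern_sum b k by rewrite /tern_bit E cmp.
elim: k => [|k IH]; first by rewrite /= /tern_sum big_geq// subr0.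
by rewrite /= IH cmp tern_sumS opprD addrA.
Qed.

Lemma measurable_tern_rem k : measurable_fun setT (tern_rem k).
Proof.
elim: k => [|k IH]; first exact: measurable_id.
apply: measurable_funB => //; apply: measurable_funM => //.
rewrite (_ : (fun y => _) = fun y => 1 - (tern_rem k y < 3 ^- k)%R%:R); last first.
  by apply/funext => y; case: leP; rewrite ?subr0 ?subrr.
apply: measurable_funB => //; exact: (measurableT_comp (measurable_ltind _) IH).
Qed.

Lemma measurable_tern_bit k : measurable [set y | tern_bit k y].
Proof.
have := measurable_tern_rem k measurableT (measurable_itv `[3 ^- k, +oo[).
by rewrite setTI; congr measurable; apply/seteqP; split => y /=; rewrite in_itv/= andbT.
Qed.

Lemma measurable_tern_code d (Y : measurableType d) (b : nat -> Y -> bool) :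
  (forall k, measurable [set y : Y | b k y]) ->
  measurable_fun setT (fun y : Y => tern_code (fun k => b k y)).
Proof.
move=> mb.
have ms m : measurable_fun setT (fun y : Y => tern_sum (fun k => b k y) m).
  apply: measurable_sum => k; apply: measurable_funM => //.
  rewrite (_ : (fun y : Y => (b k y)%:R) = (\1_[set y : Y | b k y] : Y -> R)); first exact: measurable_indic.
  by apply/funext => y; rewrite indicE; congr ((nat_of_bool _)%:R); apply/idP/idP; rewrite inE.
apply: (measurability _ (RGenOInfty.measurableE R)) => //.
move=> _ [_ [r ->] <-]; rewrite setTI.
rewrite (_ : _ @^-1` _ = \bigcup_m ((fun y : Y => tern_sum (fun k => b k y) m) @^-1` `]r, +oo[)).
  by apply: bigcupT_measurable => m; rewrite -[X in measurable X]setTI; exact: ms.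
apply/seteqP; split => y /=; rewrite in_itv/= andbT.
  have hs : has_sup (range (tern_sum (fun k => b k y))).
    split; first by exists (tern_sum (fun k => b k y) 0); exists 0%N.
    by eexists => _ [m _ <-]; exact: (tern_sum_le _ 0).
  move=> h; have h0 : 0 < tern_code (fun k => b k y) - r by rewrite subr_gt0.
  have [_ [m _ <-] hm] := sup_adherent h0 hs.
  by exists m => //=; rewrite in_itv/= andbT; move: hm; rewrite -/(tern_code _); lra.
move=> [m _ /=]; rewrite in_itv/= andbT => /lt_le_trans; apply.
by have /andP[] := tern_code_bounds (fun k => b k y) m.
Qed.

(** A sequence of naturals is stored with one bit per pair: bit (n, i) says that its n-th term is i.
    If no such bit is set the default 0 is returned, so decoding is total on the reals. *)
Definition tern_idx (n : nat) (y : R) : nat :=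
  if pselect (exists i, tern_bit (pickle (n, i)) y) is left h then ex_minn h else 0%N.

Definition idx_bits (c : nat -> nat) (k : nat) : bool :=
  if unpickle k is Some (n, i) then c n == i else false.

Lemma tern_idxK (c : nat -> nat) n : tern_idx n (tern_code (idx_bits c)) = c n.
Proof.
have E i : tern_bit (pickle (n, i)) (tern_code (idx_bits c)) = (c n == i).
  by rewrite tern_codeK /idx_bits pickleK.
rewrite /tern_idx; case: pselect => [h|[]]; last by exists (c n); rewrite E.
by case: ex_minnP => i; rewrite E => /eqP.
Qed.

Lemma measurable_tern_idx n (D : set nat) : measurable [set y | D (tern_idx n y)].
Proof.
pose b (i : nat) (y : R) := tern_bit (pickle (n, i)) y.
have mb i : measurable [set y | b i y] by exact: measurable_tern_bit.
have mbC i : measurable [set y | ~~ b i y].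
  rewrite (_ : [set y | _] = ~` [set y | b i y]); first exact: measurableC.
  by apply/seteqP; split => y /= /negP.
rewrite (_ : [set y | _] = (\bigcup_(i in D) ([set y | b i y] `&`
    [set y | forall j : 'I_i, ~~ b j y])) `|` (if `[< D 0%N >] then [set y | forall i, ~~ b i y] else set0)).
  apply: measurableU.
    apply: bigcup_measurable => i _; apply: measurableI => //.
    by apply: (@measurable_forall _ _ 'I_i) => j; exact: mbC.
  by case: ifP => _; [apply: measurable_forall|exact: measurable0].
apply/seteqP; split => y /=; rewrite /tern_idx; case: pselect => [h|h].
- case: ex_minnP => i bi mi Di; left; exists i => //; split => // j.
  by apply/negP => /mi; rewrite leqNgt ltn_ord.
- move=> D0; right; case: ifPn => [_ i|/asboolP//].
  by apply/negP => bi; apply: h; exists i.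
- case: ex_minnP => i bi mi [[j Dj [/= bj hj]]|].
    rewrite (_ : i = j)//; apply/eqP; rewrite eqn_leq mi//=.
    by rewrite leqNgt; apply/negP => ij; have := hj (Ordinal ij); rewrite /b /= bi.
  by case: ifP => // _ /= /(_ i); rewrite /b bi.
- move=> [[j _ [/= bj _]]|]; first by exfalso; apply: h; exists j.
  by case: ifPn => // /asboolP.
Qed.

End ternary_code.

Section path_code.
Context {R : realType}.
Variables t T : R.
Hypothesis tT : t <= T.
Notation pathsC := (g_sigma_algebraType (@path_open R t T)).

(* A path is coded by the indices, in a dense sequence, of its first approximants at
   distance 1 / (n + 1). *)
Lemma path_code : exists (code : (R -> R) -> R) (dec : R -> R -> R),
  [/\ (forall h, 0 <= code h < 2), (forall h, Cpath t T h -> dec (code h) = h),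
   (forall y, Cpath t T (dec y)), measurable_fun setT (dec : R -> pathsC) &
   forall d (Y : measurableType d) (Th : Y -> R -> R), (forall y, Cpath t T (Th y)) ->
     (forall u, t <= u <= T -> measurable_fun setT (fun y => Th y u)) ->
     measurable_fun setT (fun y => code (Th y))].
Proof.
have [gam [Cgam hgam]] := path_separable tT.
pose e n : R := n.+1%:R^-1.
have e0 n : 0 < e n by rewrite invr_gt0.
pose close n (h : R -> R) i : bool :=
  `[< forall q : rat, `|h (clamp t T (ratr q)) - gam i (clamp t T (ratr q))| <= e n >].
have close_ex n h : Cpath t T h -> exists i, close n h i.
  move=> Ch; have [i hi] := hgam _ _ (path_continuous Ch) (e0 n).
  by exists i; apply/asboolP => q; apply: hi; exact: clamp_itv.
pose idx h n : nat := if pselect (exists i, close n h i) is left H then ex_minn H else 0%N.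
pose code h : R := tern_code (idx_bits (idx h)).
(* Not every real number is a code. [Gd] tests that the decoded approximants are uniformly Cauchy;
   all other numbers decode to the zero path, so that [dec] always returns a continuous path. *)
pose Gd (y : R) := forall n m u, t <= u <= T ->
  `|gam (tern_idx n y) u - gam (tern_idx m y) u| <= e n + e m.
pose dn (n : nat) (y u : R) : R := if `[< Gd y >] then gam (tern_idx n y) u else 0.
pose dec (y u : R) : R := limn (fun n => dn n y u).
have gam_clamp i u : gam i (clamp t T u) = gam i u by exact: path_clamp.
have dnC n m y u : `|dn n y u - dn m y u| <= e n + e m.
  rewrite /dn; case: ifPn => [/asboolP Gy|_].
    by rewrite -[gam _ u]gam_clamp -[gam (tern_idx m y) u]gam_clamp; apply: Gy; exact: clamp_itv.
  by rewrite subrr normr0 addr_ge0// ltW.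
have cdec y u : dn n y u @[n --> \oo] --> dec y u.
  apply: (cauchy_cvgP _).1; apply/cauchy_exP => r r0.
  have [N hN] := invS_lt (divr_gt0 r0 (ltr0n R 2)).
  exists (dn N y u); exists N => // n /= Nn; rewrite /ball/=.
  apply: le_lt_trans (dnC _ _ _ _) _; rewrite [r]splitr ltrD//.
  by apply: le_lt_trans hN; rewrite /e lef_pV2 ?posrE// ler_nat ltnS.
have decle n y u : `|dn n y u - dec y u| <= e n.
  apply/ler_addgt0Pr => r r0.
  have [N hN] := invS_lt (divr_gt0 r0 (ltr0n R 2)).
  have := cdec y u => /cvgrPdist_lt/(_ _ (divr_gt0 r0 (ltr0n R 2)))[M _ hM].
  have h1 := hM (maxn M N) (leq_maxl _ _); have h2 := dnC n (maxn M N) y u.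
  have h3 : e (maxn M N) <= e N by rewrite /e lef_pV2 ?posrE// ler_nat ltnS leq_maxr.
  rewrite (_ : _ - _ = (dn n y u - dn (maxn M N) y u) - (dec y u - dn (maxn M N) y u)); last by ring.
  apply: (le_trans (ler_normB _ _)).
  by move: h1 h2 h3 hN; rewrite -/(e N) /=; lra.
have Cdec y : Cpath t T (dec y).
  split; last first.
    move=> u; rewrite /dec; congr (limn _); apply/funext => n.
    by rewrite /dn; case: ifP => // _; rewrite gam_clamp.
  apply: continuous_subspaceT => u; apply/cvgrPdist_le => r r0.
  have [N hN] := invS_lt (divr_gt0 r0 (ltr0n R 3)).
  have cN : continuous (dn N y).
    rewrite /dn; case: (`[< Gd y >]) => v; last exact: cvg_cst.
    have := continuous_clamp tT (path_continuous (Cgam (tern_idx N y))) => /(_ v).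
    by rewrite (_ : gam _ \o clamp t T = gam (tern_idx N y))//; apply/funext => z; exact: gam_clamp.
  have := cN u => /cvgrPdist_lt/(_ _ (divr_gt0 r0 (ltr0n R 3))).
  apply: filterS => v h1; have h2 := decle N y u; have h3 := decle N y v.
  rewrite (_ : _ - _ = (dn N y u - dn N y v) - (dn N y u - dec y u) + (dn N y v - dec y v)); last by ring.
  apply: (le_trans (ler_normD _ _)); have := ler_normB (dn N y u - dn N y v) (dn N y u - dec y u).
  by move: h1 h2 h3 hN; rewrite -/(e N) /=; lra.
have codeK h : Cpath t T h -> dec (code h) = h.
  move=> Ch.
  have hidx n : forall u, t <= u <= T -> `|h u - gam (idx h n) u| <= e n.
    apply: (rat_dist_le tT (path_continuous Ch) (path_continuous (Cgam _))).
    rewrite /idx; case: pselect => [H|/(_ (close_ex n h Ch))//].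
    by case: ex_minnP => i /asboolP.
  have Gh : Gd (code h).
    move=> n m u tu; rewrite !tern_idxK.
    rewrite (_ : _ - _ = (h u - gam (idx h m) u) - (h u - gam (idx h n) u)); last by ring.
    by rewrite [leRHS]addrC; apply: (le_trans (ler_normB _ _)); apply: lerD; exact: hidx.
  apply/funext => u; rewrite -(path_clamp _ (Cdec _)) -(path_clamp u Ch).
  have cu := clamp_itv u tT; apply/eqP; rewrite -subr_eq0 -normr_le0.
  apply/ler_addgt0Pr => r r0; rewrite add0r.
  have [N hN] := invS_lt (divr_gt0 r0 (ltr0n R 2)).
  have := decle N (code h) (clamp t T u); have := hidx N _ cu.
  rewrite /dn asboolT// tern_idxK => h1 h2.
  rewrite (_ : _ - _ = (h (clamp t T u) - gam (idx h N) (clamp t T u)) * -1 -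
     (gam (idx h N) (clamp t T u) - dec (code h) (clamp t T u))); last by ring.
  apply: (le_trans (ler_normB _ _)); rewrite normrM normrN1 mulr1.
  by move: h1 h2 hN; rewrite -/(e N); lra.
exists code, dec; split => //.
- by move=> h; exact: tern_code_itv.
- apply: measurable_to_pathsC => // u tu.
  apply: (@measurable_fun_cvg _ _ _ setT (fun n y => dn n y u)) => // n.
  (* The quantifier over times concerns pairs of indices only, so [Gd] is a countable combination of
     conditions on decoded indices. *)
  have mG : measurable [set y : R | Gd y].
    rewrite (_ : [set y | _] = [set y | forall n m : nat, (\bigcup_(ij in
       [set ij : nat * nat | forall u, t <= u <= T -> `|gam ij.1 u - gam ij.2 u| <= e n + e m])
       ([set y | tern_idx n y = ij.1] `&` [set y | tern_idx m y = ij.2])) y]); last first.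
      apply/seteqP; split => y /= Gy n' m'; last first.
        by move=> v tv; have [[i j] /= hij [/= -> ->]] := Gy n' m'; exact: hij.
      by exists (tern_idx n' y, tern_idx m' y) => // v tv; exact: Gy.
    apply: measurable_forall => n'; apply: measurable_forall => m'.
    rewrite bigcup_mkcond; apply: countable_bigcupT_measurable => [|ij]; first exact: countableP.
    case: ifP => _; last exact: measurable0.
    by apply: measurableI; [exact: (measurable_tern_idx n' [set ij.1])|exact: (measurable_tern_idx m' [set ij.2])].
  move=> _ D mD; rewrite setTI.
  rewrite (_ : _ @^-1` D = ([set y | Gd y] `&` [set y | D (gam (tern_idx n y) u)]) `|`
     (~` [set y | Gd y] `&` [set y | D 0])).
    apply: measurableU; apply: measurableI => //.
    - exact: (measurable_tern_idx n [set i | D (gam i u)]).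
    - exact: measurableC.
    - have [D0|D0] := pselect (D 0).
        by rewrite (_ : [set y | _] = setT)//; apply/seteqP; split.
      by rewrite (_ : [set y | _] = set0)//; apply/seteqP; split.
  apply/seteqP; split => y; rewrite /= /dn.
    by case: ifPn => /asboolP h Dy; [left|right].
  by case=> -[h Dy]; [rewrite asboolT|rewrite asboolF].
- move=> d Y Th CTh mTh; apply: measurable_tern_code => k.
  rewrite /idx_bits; case: (unpickle k) => [[n i]|]; last first.
    by rewrite (_ : [set y | _] = set0)//; apply/seteqP; split.
  have mclose j : measurable [set y | close n (Th y) j].
    rewrite (_ : [set y | _] = [set y | forall q : rat,
       `|Th y (clamp t T (ratr q)) - gam j (clamp t T (ratr q))| <= e n]); last first.
      by apply/seteqP; split => y /= /asboolP.
    apply: measurable_forall => q.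
    have := measurableT_comp (@normr_measurable R setT) (measurable_funB
      (mTh _ (clamp_itv (ratr q) tT)) (measurable_cst (gam j (clamp t T (ratr q)))))
      measurableT (measurable_itv `]-oo, e n]).
    by rewrite setTI; congr measurable.
  rewrite (_ : [set y | _] = [set y | close n (Th y) i] `&`
     [set y | forall j : 'I_i, ~~ close n (Th y) j]); last first.
    apply/seteqP; split => y /=; rewrite /idx; case: pselect => [H|/(_ (close_ex n _ (CTh y)))//].
      case: ex_minnP => j cj mj /eqP <-; split => // l.
      by apply/negP => /mj; rewrite leqNgt ltn_ord.
    case: ex_minnP => j cj mj [ci hi]; apply/eqP/anti_leq; rewrite mj//=.
    by rewrite leqNgt; apply/negP => ij; have := hi (Ordinal ij); rewrite cj.
  apply: measurableI => //; apply: (@measurable_forall _ _ 'I_i) => j.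
  rewrite -[X in measurable X]setCK; apply: measurableC.
  by have := mclose j; congr measurable; apply/seteqP; split => y /=; case: (close n (Th y) j).
Qed.

End path_code.

(** * Conditional distribution functions and quantiles *)

Lemma ae_forall_countable {R : realType} d (T : measurableType d) (mu : {measure set T -> \bar R})
    (J : countType) (Q : J -> T -> Prop) :
  (forall j, {ae mu, forall x, Q j x}) -> {ae mu, forall x, forall j, Q j x}.
Proof.
move=> h; have : {ae mu, forall x, forall n : nat, if unpickle n is Some j then Q j x else True}.
  by apply: ae_foralln => n; case: (unpickle n) => [j|]; [exact: h|exact: (@aeW _ _ _ mu)].
by apply: filterS => x hx j; have := hx (pickle j); rewrite pickleK.
Qed.

Section sub_measure.
Context {R : realType} d (Omega : measurableType d) (mu : {finite_measure set Omega -> \bar R}).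
Variable gen : set (set Omega).
Notation Og := (g_sigma_algebraType gen).
Hypothesis gen_measurable : forall A, <<s gen >> A -> measurable A.

(** The measure on the smaller sigma-algebra, so that Radon-Nikodym densities come out measurable
    with respect to it. *)
Definition sub_measure of (forall A, <<s gen >> A -> measurable A) : set Og -> \bar R :=
  fun A => mu A.
Let m := sub_measure gen_measurable.

Let m0 : m set0 = 0%E. Proof. exact: measure0. Qed.
Let m_ge0 A : (0 <= m A)%E. Proof. exact: measure_ge0. Qed.
Let m_sigma : semi_sigma_additive m.
Proof.
move=> F mF tF mU; apply: measure_semi_sigma_additive => //.
  by move=> i; apply: gen_measurable; exact: mF.
exact: gen_measurable.
Qed.
HB.instance Definition _ := isMeasure.Build _ _ _ m m0 m_ge0 m_sigma.

Let m_fin : fin_num_fun m.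
Proof. by move=> A mA; apply: fin_num_measure; exact: gen_measurable. Qed.
HB.instance Definition _ := Measure_isFinite.Build _ _ _ m m_fin.

Lemma ge0_integral_sub (f : Og -> \bar R) (A : set Omega) : <<s gen >> A ->
  measurable_fun setT f -> (forall w, (0 <= f w)%E) ->
  (\int[mu]_(w in A) f w = \int[m]_(w in A) f w)%E.
Proof.
move=> GA mf f0.
have mid : measurable_fun setT ((fun w => w) : Omega -> Og).
  by move=> _ B mB; rewrite setTI; exact: gen_measurable.
have := @ge0_integral_pushforward _ _ _ _ R _ mid mu A f GA.
by move=> <-//; exact: measurable_funTS.
Qed.

End sub_measure.

Section unit_interval.
Context {R : realType}.
Notation leb := (@lebesgue_measure R).
Notation I01 := (`[0, 1]%classic : set (measurableTypeR R)).

Lemma measurable_unit_itv : measurable I01.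
Proof. exact: measurable_itv. Qed.

Lemma unit_itv_lty : (leb I01 < +oo)%E.
Proof. by rewrite lebesgue_measure_itv/= lte_fin ltr01 -EFinB ltry. Qed.

Definition unif : {finite_measure set (measurableTypeR R) -> \bar R} :=
  @mfrestr _ (measurableTypeR R) R _ leb measurable_unit_itv unit_itv_lty.

Lemma unif_le (a : R) : 0 <= a <= 1 -> unif [set v | v <= a] = a%:E.
Proof.
move=> /andP[a0 a1].
change (leb ([set v | v <= a] `&` I01) = a%:E); rewrite (_ : _ `&` _ = `[0, a]%classic).
  rewrite lebesgue_measure_itv/= lte_fin; case: ltP => h; first by rewrite -EFinB subr0.
  by congr EFin; apply/eqP; rewrite eq_le a0 h.
apply/seteqP; split => v /=; rewrite !in_itv/=.
  by move=> [-> /andP[-> _]].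
by move=> /andP[-> h]; rewrite h (le_trans h).
Qed.

Lemma unif_setT : unif setT = 1%E.
Proof.
change (leb (setT `&` I01) = 1%E).
by rewrite setTI lebesgue_measure_itv/= lte_fin ltr01 -EFinB subr0.
Qed.

End unit_interval.

Section conditional_quantile.
Context {R : realType} d (Omega : measurableType d) (P : probability Omega R).
Variable gen : set (set Omega).
Hypothesis gen_measurable : forall A, <<s gen >> A -> measurable A.
Notation Og := (g_sigma_algebraType gen).
Notation PG := (sub_measure P gen_measurable).

Variable Y : Omega -> R.
Hypothesis mY : measurable_fun setT Y.

Let mYlt (I : set R) : measurable I -> measurable (Y @^-1` I).
Proof. by move=> mI; rewrite -[X in measurable X]setTI; exact: mY. Qed.

Let density (D : set Omega) : measurable D -> exists f : Og -> R,
  [/\ measurable_fun setT f, PG.-integrable setT (EFin \o f), forall w, 0 <= f w &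
   forall A, <<s gen >> A -> (P (A `&` D) = \int[PG]_(w in A) (f w)%:E)%E].
Proof.
move=> mD.
have PD : (P D < +oo)%E by rewrite (le_lt_trans (probability_le1 _ _))// ltry.
pose nu : {finite_measure set Og -> \bar R} := sub_measure (mfrestr mD PD) gen_measurable.
pose mu : {finite_measure set Og -> \bar R} := PG.
have dom : nu `<< mu.
  apply/null_content_dominatesP => A mA PA0.
  apply/eqP; rewrite eq_le measure_ge0 andbT -PA0.
  change (P (A `&` D) <= P A)%E; apply: le_measure; rewrite ?inE//.
    by apply: measurableI => //; exact: gen_measurable.
  exact: gen_measurable.
have [f [f0 ffin fint fE]] := @radon_nikodym_sigma_finite _ _ _ mu nu dom.
exists (fun w => fine (f w)); split.
- by apply: measurableT_comp => //; case/integrableP: fint.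
- by apply: eq_integrable fint => // w _ /=; rewrite fineK.
- by move=> w; rewrite fine_ge0.
- move=> A GA; under eq_integral do rewrite fineK//.
  by rewrite -fE.
Qed.

(* Radon-Nikodym versions of P(Y < q | gen), corrected on a null set so as to be monotone in q. *)
Lemma conditional_cdf : exists F : rat -> Og -> R,
  [/\ forall q, measurable_fun setT (F q), forall q w, 0 <= F q w <= 1,
   forall p q w, p <= q -> F p w <= F q w &
   forall q A, <<s gen >> A -> (P (A `&` [set w | Y w < ratr q]%R) = \int[PG]_(w in A) (F q w)%:E)%E].
Proof.
have mlt q : measurable [set w | Y w < ratr q].
  by have := mYlt (measurable_itv `]-oo, ratr q[); congr measurable; apply/seteqP; split => w /=; rewrite in_itv.
pose F0 q := sval (cid (density (mlt q))).
have F0P q : [/\ measurable_fun setT (F0 q), PG.-integrable setT (EFin \o F0 q), forall w, 0 <= F0 q w &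
   forall A, <<s gen >> A -> (P (A `&` [set w | Y w < ratr q]%R) = \int[PG]_(w in A) (F0 q w)%:E)%E].
  by rewrite /F0; case: cid.
(* The density of D plus a nonnegative density of D' minus D is a density of D', hence almost
   everywhere equal to the given one. *)
have dom (D D' : set Omega) (f f' : Og -> R) : measurable D -> measurable D' -> D `<=` D' ->
    PG.-integrable setT (EFin \o f) -> PG.-integrable setT (EFin \o f') -> (forall w, 0 <= f w) ->
    (forall A, <<s gen >> A -> (P (A `&` D) = \int[PG]_(w in A) (f w)%:E)%E) ->
    (forall A, <<s gen >> A -> (P (A `&` D') = \int[PG]_(w in A) (f' w)%:E)%E) ->
    {ae PG, forall w, f w <= f' w}.
  move=> mD mD' DD' fi f'i f0 hf hf'.
  have [g [mg gi g0 hg]] := density (measurableD mD' mD).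
  have : ae_eq PG setT (EFin \o (fun w => f w + g w)) (EFin \o f').
    apply: integral_ae_eq => //.
    - exact: integrable_addf.
    - by case/integrableP: f'i.
    - move=> A _ mA; rewrite -[RHS]hf'//.
      rewrite (_ : A `&` D' = (A `&` D) `|` (A `&` (D' `\` D))); last first.
        by rewrite -setIUr setDUK.
      rewrite measureU//; last 3 first.
      + by apply: measurableI => //; exact: gen_measurable.
      + by apply: measurableI; [exact: gen_measurable|exact: measurableD].
      + by apply/seteqP; split => // w [[_ Dw] [_ [_]]].
      have e1 := hf A mA; have e2 := hg A mA.
      transitivity (\int[PG]_(x in A) (f x)%:E + \int[PG]_(x in A) (g x)%:E)%E; last first.
        by congr (_ + _)%E; exact/esym.
      rewrite -ge0_integralD//.
      + by move=> w _; rewrite lee_fin.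
      + by apply: measurable_funTS; case/integrableP: fi.
      + by move=> w _; rewrite lee_fin.
      + by apply: measurable_funTS; apply/measurable_EFinP.
  by apply: filterS => w /(_ I) [<-]; rewrite lerDl.
have ae1 (pq : rat * rat) : {ae PG, forall w, pq.1 <= pq.2 -> F0 pq.1 w <= F0 pq.2 w}.
  case: pq => p q /=; have [pq|] := boolP (p <= q); last first.
    by move=> _; apply: (@aeW _ _ _ PG) => w.
  have [m1 i1 n1 h1] := F0P p; have [m2 i2 n2 h2] := F0P q.
  have := dom _ _ _ _ (mlt p) (mlt q) _ i1 i2 n1 h1 h2.
  have sub : [set w | Y w < ratr p] `<=` [set w | Y w < ratr q].
    by move=> w /= /lt_le_trans; apply; rewrite ler_rat.
  by move=> /(_ sub); apply: filterS.
have ae2 q : {ae PG, forall w, F0 q w <= 1}.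
  have [m1 i1 n1 h1] := F0P q.
  apply: (dom _ setT _ (cst 1) (mlt q) measurableT (@subsetT _ _) i1 _ n1 h1).
    exact: finite_measure_integrable_cst.
  by move=> A GA; have := @integral_cst _ Og R PG A GA 1; rewrite mul1e setIT => H; exact: (esym H).
have aeP : {ae PG, forall w, (forall pq : rat * rat, pq.1 <= pq.2 -> F0 pq.1 w <= F0 pq.2 w) /\
    forall q, F0 q w <= 1}.
  by apply: filterI; exact: ae_forall_countable.
have [N [mN N0 hN]] := aeP.
exists (fun q w => \1_(~` N) w * F0 q w); split.
- move=> q; apply: measurable_funM; last by have [] := F0P q.
  by apply: measurable_indic; exact: measurableC.
- move=> q w; rewrite indicE; have [wN|wN] := boolP (w \in ~` N).
    rewrite mul1r; have [_ _ -> _] := F0P q; rewrite /=.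
    move: wN; rewrite inE => wN.
    by have [_] : [set w | _] w := contrapT (fun h => wN (hN w h)).
  by rewrite mul0r lexx ler01.
- move=> p q w pq; rewrite !indicE; have [wN|wN] := boolP (w \in ~` N); last by rewrite !mul0r.
  rewrite !mul1r; move: wN; rewrite inE => wN.
  have [/(_ (p, q)) + _] : [set w | _] w := contrapT (fun h => wN (hN w h)).
  exact.
- move=> q A GA; have [m1 i1 n1 ->] := F0P q => //.
  apply: ae_eq_integral => //.
  + by apply: measurable_funTS; exact/measurable_EFinP.
  + apply: measurable_funTS; apply/measurable_EFinP; apply: measurable_funM => //.
    by apply: measurable_indic; exact: measurableC.
  + exists N; split => // w /= h; apply: contrapT => wN; apply: h => _.
    by rewrite indicE mem_set// mul1r.
Qed.

(** Reaches the events Y < x from below through rational thresholds, the only ones at which the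
    conditional distribution function is defined. *)
Lemma rat_increasing (x : R) : 0 < x -> exists r : nat -> rat,
  [/\ nondecreasing_seq r, forall n, 0 <= r n, forall n, ratr (r n) < x &
   forall y, y < x -> exists n, y < ratr (r n)].
Proof.
move=> x0.
have ex n : exists q : rat, Num.max 0 (x - n.+1%:R^-1) < ratr q < x.
  have [|q] := @rat_in_itvoo R (Num.max 0 (x - n.+1%:R^-1)) x.
    by rewrite gt_max x0/= ltrBlDr ltrDl invr_gt0.
  by rewrite in_itv; exists q.
pose s n := sval (cid (ex n)).
have hs n : Num.max 0 (x - n.+1%:R^-1) < ratr (s n) < x by rewrite /s; case: cid.
pose r := fix r n := if n is m.+1 then Num.max (r m) (s m.+1) else s 0%N.
have sr n : s n <= r n by case: n => [|n]//=; rewrite le_max lexx orbT.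
exists r; split.
- by apply/nondecreasing_seqP => n /=; rewrite le_max lexx.
- move=> n; apply: le_trans (sr n); have /andP[h _] := hs n.
  by rewrite -(ler_rat R) rmorph0 ltW// (le_lt_trans _ h)// le_max lexx.
- elim=> [|n IH] /=; first by have /andP[] := hs 0%N.
  by rewrite /Num.max; case: ifP => _ //; have /andP[] := hs n.+1.
- move=> y yx; have [n hn] : exists n : nat, n.+1%:R^-1 < x - y by apply: invS_lt; rewrite subr_gt0.
  exists n; have /andP[h _] := hs n; move: h; rewrite gt_max => /andP[_ h].
  apply: (@lt_le_trans _ _ (ratr (s n))); last by rewrite ler_rat.
  by apply: lt_trans h; move: hn; set z := _^-1; lra.
Qed.

Hypothesis Y02 : forall w, 0 <= Y w < 2.

(* [Q (w, .)] is the generalized inverse of the conditional distribution function of [Y];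
   the value 2 keeps the set whose infimum is taken nonempty. *)
Lemma conditional_quantile : exists Q : Og * measurableTypeR R -> R, measurable_fun setT Q /\
  forall A D, <<s gen >> A -> measurable D ->
  (P (A `&` (Y @^-1` D)) = \int[P]_(w in A) unif [set v | D (Q (w, v))])%E.
Proof.
have [F [mF F01 Fmono hF]] := conditional_cdf.
(* v <= F q w is the condition that q is admissible in the infimum defining the quantile at level v;
   restricting q to [0,2] bounds that infimum from below. *)
pose V (q : rat) : set (Og * measurableTypeR R) := [set wv | 0 <= q <= 2 /\ wv.2 <= F q wv.1].
have mV q : measurable (V q).
  rewrite /V; case: (0 <= q <= 2); last first.
    by rewrite (_ : [set wv | _] = set0)//; apply/seteqP; split => wv // -[].
  have := measurable_funB (measurableT_comp (mF q) (@measurable_fst _ _ Og (measurableTypeR R)))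
    (@measurable_snd _ _ Og (measurableTypeR R)) measurableT (measurable_itv `[0, +oo[).
  rewrite setTI; congr measurable; apply/seteqP; split => wv /=; rewrite in_itv/= andbT subr_ge0//.
  by case.
pose W wv : set R := [set x | x = 2 \/ exists2 q : rat, V q wv & x = ratr q].
pose Q wv := inf (W wv).
have W0 wv x : W wv x -> 0 <= x.
  by case=> [->//|[q [/andP[q0 _] _] ->]]; rewrite ler0q.
have hW wv : has_inf (W wv) by split; [exists 2; left|exists 0 => x; exact: W0].
have Qlt wv x : Q wv < x <-> (2 < x \/ exists2 q : rat, V q wv & ratr q < x).
  split.
    move=> h; have h0 : 0 < x - Q wv by rewrite subr_gt0.
    have [y [->|[q Vq ->]] hy] := inf_adherent h0 (hW wv); first by left; move: hy; rewrite -/(Q wv); lra.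
    by right; exists q => //; move: hy; rewrite -/(Q wv); lra.
  case=> [x2|[q Vq]]; first by apply: le_lt_trans x2; apply: ge_inf; [exact: (hW wv).2|left].
  by apply: le_lt_trans; apply: ge_inf; [exact: (hW wv).2|right; exists q].
have mQ : measurable_fun setT Q.
  apply: (measurability _ (RGenInftyO.measurableE R)) => //.
  move=> _ [_ [x ->] <-]; rewrite setTI.
  rewrite (_ : _ @^-1` _ = (if 2 < x then setT else set0) `|`
      \bigcup_(q : rat) (if ratr q < x then V q else set0)).
    apply: measurableU; first by case: ifP.
    by apply: bigcupT_measurable_rat => q; case: ifP.
  apply/seteqP; split => wv /=; rewrite in_itv/=.
    by move=> /Qlt [->|[q Vq qx]]; [left|right; exists q => //; rewrite qx].
  case=> [|[q _]]; case: ifPn => [h Vq|_ []]; apply/Qlt; first by left.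
  by right; exists q.
exists Q; split => // A D GA mD.
pose M := (PG \x unif)%E.
have mAT : measurable ((A : set Og) `*` (setT : set (measurableTypeR R))) by exact: measurableX.
have mA : measurable A by exact: gen_measurable.
have ME E : measurable E -> (mrestr M mAT E = \int[PG]_(w in A) unif (xsection E w))%E.
  move=> mE; rewrite /mrestr /M /product_measure1 [RHS]integral_mkcond.
  apply: eq_integral => w _; rewrite patchE; case: ifPn => wA /=.
    congr (unif _); apply/seteqP; split => v; rewrite !xsectionE /=; first by case.
    by move=> Ev; split => //; split => //; rewrite inE in wA.
  rewrite (_ : xsection _ w = set0) ?measure0//; apply/seteqP; split => v //.
  by rewrite xsectionE /= => -[_ [wA' _]]; move: wA; rewrite notin_setE.
have MV q : 0 <= q <= 2 -> mrestr M mAT (V q) = P (A `&` [set w | Y w < ratr q]).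
  move=> q02; rewrite ME// hF//; apply: eq_integral => w _.
  rewrite -(unif_le (F01 q w)); congr (unif _).
  by apply/seteqP; split => v; rewrite xsectionE /V /=; [case|].
(* Half-lines determine the joint law. For 0 < x <= 2 the event Q < x is the increasing union of the
   sets V(r_n), with rationals r_n increasing to x, because F is monotone in q; for other x both
   events are trivial. *)
have ray x : mrestr M mAT (Q @^-1` `]-oo, x[) = P (A `&` Y @^-1` `]-oo, x[).
  have [x2|x2] := ltP 2 x.
    rewrite (_ : Q @^-1` _ = setT); last first.
      by apply/seteqP; split => wv //= _; rewrite in_itv/=; apply/Qlt; left.
    rewrite (_ : A `&` _ = A); last first.
      apply/seteqP; split => w /=; [by case|move=> Aw; split => //; rewrite in_itv/=].
      by have /andP[_ h] := Y02 w; exact: lt_trans h x2.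
    rewrite ME// (_ : (\int[PG]_(w in A) _)%E = (\int[PG]_(w in A) cst 1 w)%E); last first.
      apply: eq_integral => w _; rewrite -unif_setT; congr (unif _).
      by apply/seteqP; split => v // _; rewrite xsectionE.
    by rewrite (@integral_cst _ Og R PG A GA 1) mul1e.
  have [x0|x0] := leP x 0.
    rewrite (_ : Q @^-1` _ = set0); last first.
      apply/seteqP; split => wv //=; rewrite in_itv/= => /Qlt [|[q [/andP[q0 _] _] qx]]; first by rewrite ltNge x2.
      by move: qx; rewrite ltNge (le_trans x0)// ler0q.
    rewrite (_ : A `&` _ = set0) ?measure0//; apply/seteqP; split => w //= [_]; rewrite in_itv/=.
    by have /andP[h _] := Y02 w; rewrite ltNge (le_trans x0 h).
  have [r [rmono r0 rx rsup]] := rat_increasing x0.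
  have r2 n : 0 <= r n <= 2.
    rewrite r0 -(ler_rat R) (ltW (lt_le_trans (rx n) _))//.
    by rewrite (_ : ratr 2 = 2%:R) ?ratr_nat.
  have cv1 : mrestr M mAT (V (r n)) @[n --> \oo] --> mrestr M mAT (\bigcup_n V (r n)).
    apply: nondecreasing_cvg_mu => //; first exact: bigcupT_measurable.
    move=> n m nm; apply/subsetPset => wv [_ h]; split; first exact: r2.
    by apply: le_trans h _; apply: Fmono; exact: rmono.
  have mYr n : measurable (A `&` [set w | Y w < ratr (r n)]).
    apply: measurableI => //; have := mYlt (measurable_itv `]-oo, ratr (r n)[).
    by congr measurable; apply/seteqP; split => w /=; rewrite in_itv.
  have cv2 : P (A `&` [set w | Y w < ratr (r n)]) @[n --> \oo] -->
      P (\bigcup_n (A `&` [set w | Y w < ratr (r n)])).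
    apply: nondecreasing_cvg_mu => //; first exact: bigcupT_measurable.
    move=> n m nm; apply/subsetPset => w /= [Aw h]; split => //.
    by apply: lt_le_trans h _; rewrite ler_rat; exact: rmono.
  transitivity (mrestr M mAT (\bigcup_n V (r n))).
    congr (mrestr M mAT _); apply/seteqP; split => wv /=; rewrite in_itv/=.
      move=> /Qlt [|[q [q02 h] qx]]; first by rewrite ltNge x2.
      have [n hn] := rsup _ qx; exists n => //; split; first exact: r2.
      by apply: le_trans h _; apply: Fmono; rewrite -(ler_rat R) ltW.
    by move=> [n _ Vn]; apply/Qlt; right; exists (r n).
  rewrite (_ : A `&` _ = \bigcup_n (A `&` [set w | Y w < ratr (r n)])); last first.
    apply/seteqP; split => w /=; rewrite in_itv/=.
      by move=> [Aw] /rsup[n hn]; exists n.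
    by move=> [n _ [Aw h]]; split => //; exact: lt_trans h (rx n).
  apply: (cvg_unique _ cv1) => //; apply: cvg_trans cv2; apply: near_eq_cvg.
  by apply: nearW => n; rewrite MV.
have MQ : mrestr M mAT (Q @^-1` D) = P (A `&` (Y @^-1` D)).
  pose m1 : {measure set R -> \bar R} :=
    measure_function_pushforward__canonical__measure_function_Measure (mrestr M mAT) mQ.
  pose m2 : {measure set R -> \bar R} :=
    measure_function_pushforward__canonical__measure_function_Measure (mrestr P mA) mY.
  have MQ0 : m1 D = m2 D.
    apply: (@measure_unique _ R R (@RGenInftyO.G R) (fun n => `]-oo, n%:R[%classic)
      (RGenInftyO.measurableE R)) => //.
    - move=> _ _ [x ->] [y ->]; exists (Num.min x y).
      by apply/seteqP; split => z /=; rewrite !in_itv/= lt_min; [move=> [-> ->]|move=> /andP[-> ->]].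
    - by move=> n; exists n%:R.
    - apply/seteqP; split => z // _; exists (Num.truncn z).+1 => //=.
      by rewrite in_itv/= truncnS_gt.
    - move=> _ [x ->].
      change (mrestr M mAT (Q @^-1` `]-oo, x[) = mrestr P mA (Y @^-1` `]-oo, x[)).
      by rewrite ray /mrestr setIC.
    - move=> n; change (mrestr M mAT (Q @^-1` `]-oo, n%:R[) < +oo)%E.
      rewrite ray (le_lt_trans (probability_le1 _ _)) ?ltry//.
      by apply: measurableI => //; exact: mYlt.
  change (m1 D = P (A `&` Y @^-1` D)); rewrite MQ0.
  change (P (Y @^-1` D `&` A) = P (A `&` Y @^-1` D)).
  by rewrite setIC.
rewrite -MQ ME; last by rewrite -[X in measurable X]setTI; exact: mQ.
rewrite (@ge0_integral_sub _ _ _ P gen gen_measurable (fun w => unif [set v | D (Q (w, v))])) //.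
- by apply: eq_integral => w _; congr (unif _); apply/seteqP; split => v; rewrite xsectionE.
- have mE : measurable (Q @^-1` D) by rewrite -[X in measurable X]setTI; exact: mQ.
  have := measurable_fun_xsection unif mE.
  congr (measurable_fun _ _); apply/funext => w /=; congr (unif _).
  by apply/seteqP; split => v; rewrite xsectionE.
Qed.

End conditional_quantile.

(** * Regular conditional laws and their support *)

Lemma within_continuous_subr {R : realType} (A : set R) (f : R -> R) (c : R) :
  {within A, continuous f} -> {within A, continuous (fun u => f u - c)}.
Proof. by move=> cf u; apply: cvgB; [exact: cf|exact: cvg_cst]. Qed.

Section conditional_laws.
Context {R : realType} d (Omega : measurableType d) (P : probability Omega R).
Variables (X : R -> Omega -> R) (t T : R).
Hypothesis tT : t <= T.
Notation pathsC := (g_sigma_algebraType (@path_open R t T)).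
Hypothesis CX : forall w, Cpath t T (path_of X t T w).
Hypothesis mX : forall u, t <= u <= T -> measurable_fun setT (X u).

(** The conditional law is that of a path built from w and one uniform variable: the conditional
    quantile of the code, decoded. *)
Lemma exists_regular_cond_law (gen : set (set Omega)) :
  (forall A, <<s gen >> A -> measurable A) ->
  exists kappa, regular_cond_law P X t T <<s gen >> kappa.
Proof.
move=> gen_m; have [code [dec [code02 decK Cdec mdec mcode]]] := path_code tT.
pose Y w := code (path_of X t T w).
have mY : measurable_fun setT Y.
  apply: mcode => // u tu.
  by rewrite (_ : (fun w => _) = X u); [exact: mX|apply/funext => w; rewrite /path_of clamp_id].
have [Q [mQ hQ]] := conditional_quantile P gen_m mY (fun w => code02 _).
pose dQ w v := dec (Q (w, v)).
have mS S : path_borel t T S -> measurable (S : set pathsC) by move=> /path_borelP[].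
have mD S : path_borel t T S -> measurable (dec @^-1` S).
  by move=> /mS mS'; rewrite -[X in measurable X]setTI; exact: mdec.
have mQS S : path_borel t T S -> measurable (Q @^-1` (dec @^-1` S)).
  by move=> bS; rewrite -[X in measurable X]setTI; apply: mQ => //; exact: mD.
have xsec S w : [set v | S (dQ w v)] = xsection (Q @^-1` (dec @^-1` S)) w.
  by apply/seteqP; split => v; rewrite xsectionE.
have mv S w : path_borel t T S -> measurable ([set v | S (dQ w v)] : set (measurableTypeR R)).
  by move=> bS; rewrite xsec; apply: measurable_xsection; exact: mQS.
exists (fun w S => unif [set v | S (dQ w v)]); split.
- move=> w; split.
  + exact: measure0.
  + by move=> S _; exact: measure_ge0.
  + move=> S bS tS.
    have := @measure_semi_sigma_additive _ _ _ (@unif R) (fun n => [set v | S n (dQ w v)])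
      (fun n => mv _ w (bS n)).
    have tS' : trivIset setT (fun n => [set v | S n (dQ w v)]).
      by move=> i j _ _ [v [/= h1 h2]]; apply: (tS i j) => //; exists (dQ w v).
    have mU : measurable (\bigcup_n ([set v | S n (dQ w v)] : set (measurableTypeR R))).
      by apply: bigcupT_measurable => n; exact: mv.
    move=> /(_ tS' mU); rewrite (_ : \bigcup_n _ = [set v | (\bigcup_k S k) (dQ w v)]); last by [].
    by under eq_fun do rewrite big_mkord.
  + rewrite -(@unif_setT R); congr (unif _); apply/seteqP; split => v // _; exact: Cdec.
- move=> S bS r.
  have := measurable_fun_xsection (@unif R) (mQS S bS) measurableT (@emeasurable_itv R `]-oo, r%:E]).
  rewrite setTI; congr (_ : Prop); congr <<s gen >>.
  by apply/seteqP; split => w /=; rewrite in_itv/= xsec.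
- move=> A S GA bS; rewrite -(hQ A (dec @^-1` S) GA (mD S bS)); congr (P _).
  by apply/seteqP; split => w [Aw h]; split => //; move: h; rewrite /Y /= decK.
Qed.

Section support.
Variables (G : set (set Omega)) (kappa : Omega -> set (R -> R) -> \bar R).
Hypothesis GE : sigma_algebra setT G.
Hypothesis Gm : forall A, G A -> measurable A.
Hypothesis hk : regular_cond_law P X t T G kappa.

Let kprob w : path_probability t T (kappa w). Proof. by case: hk. Qed.

Let borelI S : measurable (S : set pathsC) -> path_borel t T (S `&` Cpath t T).
Proof.
move=> mS; apply/path_borelP; split; last by move=> x [].
by apply: measurableI => //; exact: measurable_Cpath.
Qed.

Lemma exists_path_measure w : exists m : {measure set pathsC -> \bar R},
  forall S, path_borel t T S -> m S = kappa w S.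
Proof.
have [k0 kge0 ksigma k1] := kprob w.
pose m0 (S : set pathsC) := if `[< measurable S >] then kappa w (S `&` Cpath t T) else 0%E.
have m00 : m0 set0 = 0%E by rewrite /m0 asboolT// set0I.
have m0ge0 S : (0 <= m0 S)%E.
  by rewrite /m0; case: ifPn => // /asboolP mS; apply: kge0; exact: borelI.
have m0s : semi_sigma_additive m0.
  move=> F mF tF mU; rewrite /m0 asboolT// setI_bigcupl.
  have := ksigma (fun n => F n `&` Cpath t T) (fun n => borelI (mF n)) _.
  have tF' : trivIset setT (fun n => F n `&` Cpath t T).
    by move=> i j _ _ [x [[h1 _] [h2 _]]]; apply: (tF i j) => //; exists x.
  move=> /(_ tF'); under eq_fun do rewrite -(big_mkord xpredT (fun k => kappa w (F k `&` Cpath t T))).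
  apply: cvg_trans; apply: near_eq_cvg; apply: nearW => n.
  by apply: eq_bigr => i _; rewrite asboolT.
pose mM := isMeasure.Build _ _ _ m0 m00 m0ge0 m0s.
exists (HB.pack m0 mM : {measure set pathsC -> \bar R}) => S /path_borelP[mS SC].
by change (m0 S = kappa w S); rewrite /m0 asboolT// setIidl.
Qed.

Lemma measurable_kappa S : path_borel t T S -> measurable_fun setT (fun w => kappa w S).
Proof.
move=> bS; have [_ km _] := hk.
apply: (measurability _ (ErealGenOInfty.measurableE R)) => //.
move=> _ [_ [r ->] <-]; rewrite setTI -[X in measurable X]setCK; apply: measurableC.
rewrite (_ : ~` _ = [set w | (kappa w S <= r%:E)%E]); first by apply: Gm; exact: km.
apply/seteqP; split => w /=; rewrite in_itv/= andbT; first by move/negP; rewrite -leNgt.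
by move=> h; apply/negP; rewrite -leNgt.
Qed.

Lemma kappa_ge0 w S : path_borel t T S -> (0 <= kappa w S)%E.
Proof. by move=> bS; have [_ h _ _] := kprob w; exact: h. Qed.

Lemma kappa_null A S : G A -> path_borel t T S ->
  P (A `&` (path_of X t T @^-1` S)) = 0%E -> {ae P, forall w, A w -> kappa w S = 0%E}.
Proof.
move=> GA bS; have [_ _ ki] := hk; rewrite ki// => i0.
apply/(ae_eq_integral_abs _ (Gm GA) (measurable_funTS (measurable_kappa bS))).
by rewrite -[RHS]i0; apply: eq_integral => w _; rewrite gee0_abs// kappa_ge0.
Qed.

Hypothesis GX : forall r, G [set w | X t w < r].
Hypothesis tubes : forall A gam e, G A -> P A <> 0%E ->
  {within [set u | t <= u <= T], continuous gam} -> gam t = 0 -> 0 < e ->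
  P (A `&` [set w | rel_tube T t gam e (X^~ w)]) <> 0%E.

Let tt : t <= t <= T. Proof. by rewrite lexx. Qed.

(** The event A that the tube has no conditional mass belongs to G. Were it of positive probability,
    [tubes] would put the path in the tube on a non-null part of A, yet the probability of that part
    is the integral of 0. *)
Lemma kappa_rel_tube gam e : {within [set u | t <= u <= T], continuous gam} -> gam t = 0 ->
  0 < e -> {ae P, forall w, kappa w (Cpath t T `&` rel_tube T t gam e) <> 0%E}.
Proof.
move=> cg g0 e0; set S := _ `&` _.
have bS : path_borel t T S by exact: path_borel_rel_tube.
have [_ km ki] := hk.
pose A := [set w | (kappa w S <= 0)%E].
have GA : G A by exact: km.
have PA : P A = 0%E.
  apply: contrapT => nA; apply: (tubes GA nA cg g0 e0).
  rewrite (_ : _ `&` _ = A `&` (path_of X t T @^-1` S)).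
    rewrite ki//; apply: integral0_eq => w /= Aw.
    by apply/eqP; rewrite eq_le kappa_ge0// andbT.
  apply/seteqP; split => w [Aw h]; split => //.
    split; first exact: CX.
    by move=> q; rewrite /path_of clampK// (clamp_id tt); exact: h.
  case: h => _ h q; have := h q.
  by rewrite /path_of clampK// (clamp_id tt).
exists A; split => //; first exact: Gm.
by move=> w /= h; apply: contrapT => nA; apply: h => k0; apply: nA; rewrite /A /= k0.
Qed.

(** Conditionally the value at t is X_t; rational thresholds gather this into a single null set. *)
Lemma kappa_initial : {ae P, forall w, forall r : rat,
  (X t w < ratr r -> kappa w (Cpath t T `&` [set h | ratr r <= h t]) = 0%E) /\
  (ratr r <= X t w -> kappa w (Cpath t T `&` [set h | h t < ratr r]) = 0%E)}.
Proof.
apply: ae_forall_countable => r; apply: filterI.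
  apply: (@kappa_null [set w | X t w < ratr r]); first exact: GX.
    have := path_borel_eval tt (measurable_itv `[ratr r : R, +oo[).
    by congr (path_borel t T); apply/seteqP; split => h /=; rewrite in_itv/= andbT.
  rewrite (_ : _ `&` _ = set0) ?measure0//; apply/seteqP; split => w //= [h1 [_]].
  by rewrite /path_of (clamp_id tt) leNgt h1.
apply: (@kappa_null [set w | ratr r <= X t w]).
- have [_ GC _] := GE; have := GC _ (GX (ratr r)); rewrite setTD.
  by congr G; apply/seteqP; split => w /=; [move/negP; rewrite -leNgt|move=> h; apply/negP; rewrite -leNgt].
- have := path_borel_eval tt (measurable_itv `]-oo, ratr r : R[).
  by congr (path_borel t T); apply/seteqP; split => h /=; rewrite in_itv/=.
- rewrite (_ : _ `&` _ = set0) ?measure0//; apply/seteqP; split => w //= [h1 [_]].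
  by rewrite /path_of (clamp_id tt) ltNge h1.
Qed.

Lemma path_closed_initial x : path_closed t T (Cpath_from t T x).
Proof.
split; first by move=> g [].
split => [g []//|g [Cg ng]].
have gx : g t != x by apply/eqP => h; apply: ng.
exists `|g t - x|; first by rewrite normr_gt0 subr_eq0.
move=> h Ch gh; split => // -[_ hx].
by have := supdist_lt gh tt; rewrite hx ltxx.
Qed.

Lemma path_closed_borel F : path_closed t T F -> path_borel t T F.
Proof.
move=> [FC oF]; apply/path_borelP; split => //.
rewrite (_ : F = Cpath t T `\` (Cpath t T `\` F)).
  by apply: measurableD; [exact: measurable_Cpath|exact: sub_sigma_algebra].
by rewrite setDD setIidr.
Qed.

(** Countably many centres and radii give one null set valid for all target paths. Off it, a closed
    set of full mass that missed g would miss a ball around g; but up to the null set of paths not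
    starting at X_t this ball contains a relative tube of nonzero mass. *)
Lemma support_full : {ae P, forall w, path_support t T (kappa w) = Cpath_from t T (X t w)}.
Proof.
have [gam [Cgam hgam]] := path_separable tT.
pose g0 n u := gam n u - gam n t.
have cg0 n : {within [set u | t <= u <= T], continuous (g0 n)}.
  by apply: within_continuous_subr; exact: path_continuous.
have g00 n : g0 n t = 0 by rewrite /g0 subrr.
have e0 n : 0 < n.+1%:R^-1 :> R by rewrite invr_gt0.
have ae1 : {ae P, forall w, forall nm : nat * nat,
    kappa w (Cpath t T `&` rel_tube T t (g0 nm.1) nm.2.+1%:R^-1) <> 0%E}.
  by apply: ae_forall_countable => nm; exact: kappa_rel_tube.
apply: filterS2 ae1 kappa_initial => w h1 h2.
have [m mk] := exists_path_measure w.
have b_lt r : path_borel t T (Cpath t T `&` [set h | h t < r]).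
  have := path_borel_eval tt (measurable_itv `]-oo, r : R[).
  by congr (path_borel t T); apply/seteqP; split => h /=; rewrite in_itv/=.
have b_ge r : path_borel t T (Cpath t T `&` [set h | r <= h t]).
  have := path_borel_eval tt (measurable_itv `[r : R, +oo[).
  by congr (path_borel t T); apply/seteqP; split => h /=; rewrite in_itv/= andbT.
have mb S : path_borel t T S -> measurable (S : set pathsC) by move=> /path_borelP[].
have mDS S : path_borel t T S -> measurable (Cpath t T `\` S : set pathsC).
  by move=> bS; apply: measurableD; [exact: measurable_Cpath|exact: mb].
have m1 : m (Cpath t T) = 1%E.
  rewrite mk; first by have [_ _ _] := kprob w.
  by apply/path_borelP; split => //; exact: measurable_Cpath.
have m_split S : path_borel t T S -> 1%E = (m S + m (Cpath t T `\` S))%E.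
  move=> bS; have /path_borelP[_ SC] := bS; rewrite -m1 -[in LHS](setDUK SC).
  rewrite measureU//; [exact: mb|exact: mDS|].
  by apply/seteqP; split => x // -[? []].
have bF0 := path_closed_borel (path_closed_initial (X t w)).
have null_init : m (Cpath t T `\` Cpath_from t T (X t w)) = 0%E.
  have mD : measurable (Cpath t T `\` Cpath_from t T (X t w) : set pathsC).
    by apply: measurableD; [exact: measurable_Cpath|exact: mb].
  suff : m.-negligible (Cpath t T `\` Cpath_from t T (X t w)) by move/negligibleP; apply.
  (* If h(t) differs from X_t, a rational strictly between them puts h in one of the null sets of
     [kappa_initial]. *)
  pose E n : set (R -> R) := if (unpickle n : option rat) is Some r then
    (if X t w < ratr r then Cpath t T `&` [set h | ratr r <= h t]
     else Cpath t T `&` [set h | h t < ratr r]) else set0.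
  have mz S : path_borel t T S -> kappa w S = 0%E -> m.-negligible (S : set pathsC).
    move=> bS k0; exists S; split; [exact: mb|rewrite -[RHS]k0; exact: mk|by []].
  have nE : m.-negligible (\bigcup_n (E n : set pathsC)).
    apply: negligible_bigcup => n; rewrite /E; case: (unpickle n : option rat) => [r|]; last exact: negligible_set0.
    have [h3 h4] := h2 r.
    case: ltP => xr.
      by apply: mz; [exact: b_ge|exact: h3].
    by apply: mz; [exact: b_lt|exact: h4].
  apply: (@negligibleS _ pathsC R m _ _ _ nE) => h [Ch nh].
  have : h t != X t w by apply/eqP => ht; apply: nh.
  rewrite neq_lt => /orP[] /rat_in_itvoo[r]; rewrite in_itv/= => /andP[r1 r2].
    by exists (pickle r); [by []|rewrite /E pickleK ltNge (ltW r2)].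
  by exists (pickle r); [by []|rewrite /E pickleK r1; split; [by []|exact: ltW]].
apply/seteqP; split => g.
  move=> [Cg hg]; apply: hg; first exact: path_closed_initial.
  by rewrite (m_split _ bF0) null_init adde0; exact/esym/mk.
move=> [Cg gt]; split => // F cF kF.
have [FC [_ oF]] := cF.
have bF := path_closed_borel cF.
apply: contrapT => nF.
have [e e_gt0 he] := oF g (conj Cg nF).
(* Three errors of size 1 / (n + 1) add up in the distance from h to g: the tube, and the
   approximation of g at u and at t. *)
have [n hn] := invS_lt (divr_gt0 e_gt0 (ltr0n R 8)).
have [k hk'] := hgam _ _ (path_continuous Cg) (e0 n).
pose S := Cpath t T `&` rel_tube T t (g0 k) n.+1%:R^-1.
have bS : path_borel t T S by exact: path_borel_rel_tube.
apply: (h1 (k, n)); rewrite -mk//.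
have mCF : m (Cpath t T `\` F) = 0%E.
  have h := m_split _ bF.
  have e1 : m F = 1%E by rewrite -[RHS]kF; exact: mk.
  apply/eqP; rewrite eq_le measure_ge0 andbT -(@leeD2lE _ 1%E)// adde0.
  by rewrite [leRHS]h e1.
apply: (@subset_measure0 _ _ _ m _ ((Cpath t T `\` F) `|` (Cpath t T `\` Cpath_from t T (X t w)))).
- exact: mb.
- by apply: measurableU; [exact: mDS bF|exact: mDS bF0].
- move=> h [Ch Sh]; have [hx|hx] := eqVneq (h t) (X t w); last first.
    by right; split => // -[_]; exact/eqP.
  left; apply: he => //; apply: (@le_lt_trans _ _ (3 * n.+1%:R^-1)%:E); last first.
    by rewrite lte_fin; move: hn; set z := _^-1; lra.
  apply: supdist_le => u tu; rewrite distrC.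
  have h3 : `|(h u - h t) - g0 k u| <= n.+1%:R^-1.
    apply: (@rat_dist_le R t T _ (fun u => h u - h t) (g0 k)) => //.
    by apply: within_continuous_subr; exact: path_continuous.
  have h4 := hk' u tu; have h5 := hk' t tt.
  rewrite (_ : h u - g u = (h u - h t - g0 k u) - (g u - gam k u) + (g t - gam k t)); last first.
    by rewrite /g0 hx gt; ring.
  apply: le_trans (ler_normD _ _) _; have := ler_normB (h u - h t - g0 k u) (g u - gam k u).
  by move: h3 h4 h5; set z := _^-1; lra.
- exact: etrans (@measureU0 _ pathsC R m _ _ (mDS _ bF) (mDS _ bF0) null_init) mCF.
Qed.

End support.

End conditional_laws.

Theorem theorem1p1 (R : realType) (d : measure_display) (Omega : measurableType d)
  (P : probability Omega R) (T : R) (B : R -> Omega -> R) (f : R -> R)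
  (X : R -> Omega -> R) :
  0 < T ->
  two_sided_BM P B ->
  measurable_fun setT f ->
  (forall s, 0 <= s -> f s = 0) ->
  (forall t : R, 0 <= t ->
     (\int[lebesgue_measure]_(s in [set s : R | (s <= t)%R]) ((f (s - t) - f s) ^+ 2)%R%:E < +oo)%E) ->
  (0 < lebesgue_measure [set s : R | f s != 0%R])%E ->
  (forall t, 0 <= t <= T ->
     wiener_integral P B (fun s => if s <= t then f (s - t) - f s else 0) (X t)) ->
  (forall w, {within [set u | 0 <= u <= T], continuous (fun u => X u w)}) ->
  forall t, 0 <= t <= T ->
    (exists kappa, regular_cond_law P X t T (natural_filtration X t) kappa) /\
    (forall kappa, regular_cond_law P X t T (natural_filtration X t) kappa ->
       {ae P, forall w, path_support t T (kappa w) = Cpath_from t T (X t w)}).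
Proof.
move=> T0 hB mf f0 f_sqi f_neq0 hX cX t /andP[t0 tT].
have Gm A : natural_filtration X t A -> measurable A.
  exact: (measurable_natural_filtration hX tT).
have CX w : Cpath t T (path_of X t T w).
  apply: (@Cpath_clamp _ t T tT (fun u => X u w)).
  apply: (@continuous_subspaceW _ _ _ [set u | 0 <= u <= T]); last exact: cX.
  by move=> u /= /andP[tu ->]; rewrite (le_trans t0 tu).
have mX u : t <= u <= T -> measurable_fun setT (X u).
  by move=> /andP[tu uT]; case: (hX u); rewrite ?(le_trans t0 tu).
split; first exact: exists_regular_cond_law.
move=> kappa hk; apply: (support_full tT CX _ Gm hk) => //.
- exact: smallest_sigma_algebra.
- move=> r; apply: sub_sigma_algebra; exists t, `]-oo, r[%classic; split.
  + by rewrite t0 lexx.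
  + exact: interval_open.
  + by apply/seteqP; split => w /=; rewrite in_itv.
- move=> A gam e GA PA cg g0 e0.
  exact: (rel_tube_gt0 hB mf f0 f_sqi f_neq0 hX cX t0 tT GA PA cg g0 e0).
Qed.
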